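(* For any constant $\alpha\in(0,1/10)$, there exist constants $C\ge1$, $\delta\in(0,1)$ such that any incidence sketch of $N$ measurements that computes an $o(n^{\frac23(1-\alpha)})$-spanner with probability $\ge1-\delta$ on any $w\in\mathbb{R}_{\ge0}^{\binom n2}$ with $\frac{w_{\max}}{w_{\min}}\le C$ must satisfy $N\ge n^{1+\alpha-o(1)}$.
   Context: Graphs are on a fixed vertex set $V$ with $|V|=n$; a weighted graph is identified with its weight vector $w\in\mathbb{R}_{\ge 0}^{\binom{n}{2}}$ indexed by vertex pairs, where $w_e=0$ means no edge. A linear sketch of $N$ measurements consists of a (random) sketching matrix $\Phi\in\mathbb{R}^{N\times\binom n2}$ and a (randomized) recovery algorithm that receives only $\Phi w$. An incidence sketch is a linear sketch in which each row of $\Phi$ is supported on edge slots incident on a single vertex. $w_{\max}$, $w_{\min}$ denote the largest and smallest nonzero edge weights. The length of a path is its total edge weight and $d_G(u,v)$ is the shortest path length; for $t\ge1$, $H=(V,F,w')$ with $F\subseteq E$ is a $t$-spanner of $G=(V,E,w)$ if $d_G(u,v)\le d_H(u,v)\le t\,d_G(u,v)$ for all $u,v$. *)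

(* Defs.v *)
From HB Require Import structures.
From mathcomp Require Import all_boot all_order all_algebra.
From mathcomp Require Import all_classical all_reals all_analysis.

Set Implicit Arguments.
Unset Strict Implicit.
Unset Printing Implicit Defensive.

Import Order.TTheory GRing.Theory Num.Theory.
Import numFieldNormedType.Exports.

Local Open Scope ring_scope.

(* The edge slots: unordered pairs of distinct vertices of V = 'I_n. *)
Definition vpair (n : nat) := {e : {set 'I_n} | #|e| == 2}.

Section Graphs.
Variables (R : realType) (n : nat).
Implicit Types (w h : vpair n -> R) (u v : 'I_n) (p : seq 'I_n).

Definition nonneg w : Prop := forall e, 0 <= w e.

Definition is_edge w (e : vpair n) : bool := w e != 0.

(* The value at u = v is a dummy: [set u; u] is not a vpair. *)
Definition weight w u v : R :=
  if insub [set u; v]%SET is Some e then w e else 0.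

Definition adj w : rel 'I_n := fun u v => weight w u v != 0.

Definition path_length w u p : R := \sum_(x <- pairmap (weight w) u p) x.

(* u :: p is the vertex sequence of a path from u to v. *)
Definition is_path w u v p : bool :=
  [&& path (adj w) u p, uniq (u :: p) & last u p == v].

(* The distance is +oo when v is not reachable from u. *)
Definition dist w u v : \bar R :=
  ereal_inf [set (path_length w u p)%:E | p in [set p | is_path w u v p]]%classic.

(* h is the weight vector w' of H = (V, F, w'), with F its set of nonzero
   slots. *)
Definition spanner (t : R) w h : Prop :=
  [/\ nonneg h,
      forall e, is_edge h e -> is_edge w e
    & forall u v, (dist w u v <= dist h u v)%E /\
                  (dist h u v <= t%:E * dist w u v)%E].

Definition wmax w : R := \big[Num.max/0]_e w e.
Definition wmin w : R := \big[Num.min/wmax w]_(e | is_edge w e) w e.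

(* The ratio is only meaningful for a graph with at least one edge; the edgeless
   graph is not an admissible input. *)
Definition ratio_le (C : R) w : Prop :=
  (exists e, is_edge w e) /\ wmax w / wmin w <= C.

End Graphs.

(* A single sample omega, drawn independently of the input, carries the
   randomness of both the matrix and the recovery algorithm, so that the
   algorithm may know the sampled matrix; it accesses w only through the tuple
   of measurements.  Recovery is required to be jointly (Borel) measurable:
   inputs range over a continuum, and averaging the success probability over
   them needs Fubini. *)
Record linear_sketch (R : realType) (n N : nat) := LinearSketch {
  sk_disp : measure_display;
  sk_space : measurableType sk_disp;
  sk_prob : probability sk_space R;
  sk_mx : sk_space -> 'I_N -> vpair n -> R;
  sk_recover : sk_space * N.-tuple R -> vpair n -> R;
  sk_mx_measurable : forall i e,
    measurable_fun [set: sk_space]%classic (fun omega => sk_mx omega i e);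
  sk_recover_measurable : forall e,
    measurable_fun [set: sk_space * N.-tuple R]%classic
      (fun x => sk_recover x e)
}.

Section Sketches.
Variables (R : realType) (n N : nat).
Implicit Type S : linear_sketch R n N.

Definition measurements S (omega : sk_space S) (w : vpair n -> R) :
    N.-tuple R :=
  [tuple \sum_e sk_mx omega i e * w e | i < N].

Definition output S (omega : sk_space S) (w : vpair n -> R) : vpair n -> R :=
  sk_recover (omega, measurements omega w).

Definition incidence S : Prop :=
  forall (omega : sk_space S) (i : 'I_N),
    exists v : 'I_n, forall e : vpair n, sk_mx omega i e != 0 -> v \in val e.

Definition computes_spanner (C delta t : R) S : Prop :=
  forall w : vpair n -> R, nonneg w -> ratio_le C w ->
    ((1 - delta)%:E <=
      sk_prob S [set omega | spanner t w (output omega w)]%classic)%E.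

End Sketches.

(* Main.v *)
Require Import Defs.
From HB Require Import structures.
From mathcomp Require Import all_boot all_order all_algebra all_fingroup.
From mathcomp Require Import all_classical all_reals all_analysis measurable_realfun ring lra
  zify.

Set Implicit Arguments.
Unset Strict Implicit.
Unset Printing Implicit Defensive.

Import Order.TTheory GRing.Theory Num.Theory.
Import numFieldNormedType.Exports.

Local Open Scope classical_set_scope.
Local Open Scope ring_scope.

(** Fix a sketching matrix [Phi] and call [f_a] the part of a combination [y Phi]
    of its rows that comes from the measurements at the vertex [a]; it lies in a
    space of dimension [k_a], the [k_a] sum to [N], and [y Phi] takes the value
    [f_a b + f_b a] on the slot [{a, b}].  If [N] is much smaller than
    [n ^ (1 + alpha)], then most [k_a] are at most [K = n ^ (alpha - o(1))].

    Place a layered graph on a random set of vertices: [L + 1] levels, with [L]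
    about [n ^ (2 / 3 (1 - alpha))], each made of blocks of [s] vertices, in which
    all pairs at level distance at most 1 are adjacent; [u] lies on level 0 and a
    last vertex [v] forms level [L + 1].  A spanner of stretch at most [L] has to
    keep the edge [uv] whenever it is present.

    A random block of [s >> K ^ 2] vertices determines [f_v] up to a small error,
    so that the value of [y Phi] on [uv] can be transported to the preceding level,
    at the cost of the energy of [y Phi] on the edges that are used.  Going down
    level by level, and choosing among several blocks per level to avoid the
    exceptional ones, shows that for most placements [(y Phi) uv ^ 2] is at most a
    small constant times the energy of [y Phi] on the layered graph.

    By duality the column of [uv] is [Phi z], with [z] of small norm supported on
    the layered graph.  Hence shifting the weights by [z] hides the edge [uv] from
    the sketch.  When the weights are independent with density [g ^ 2] on [1, 2],
    [g] Lipschitz, this shift is almost invisible in Hellinger distance, and the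
    recovery cannot tell whether [uv] is present. *)

(** The two parts of a slot value [f_a b + f_b a] make [y Phi] the sum of a matrix with prescribed
    row spaces and of its transpose. If all leverage scores are O(K / n), these two matrix spaces
    are almost orthogonal: with [P], [P'] the projections on them and [Q] the projection on their
    sum, [P + P' - Q] has squared Hilbert-Schmidt norm at most 2 tr(P P'), a sum of products of two
    leverage scores. An arbitrary [Phi] has no such bound, so vertices with more than [K]
    measurements are dropped and slots of large leverage are scaled down. This only lowers the
    energy and touches few slots.

    With eta of order K / s, a transport step costs order eta ^ 2 on average, and L levels of blocks
    require L s < n. Hence the constraint L (K L / n) ^ 2 << 1, which for K near n ^ alpha gives the
    exponent 2 / 3 (1 - alpha). The bound alpha < 1 / 10 says s >> K ^ 4, used for the entrywise
    concentration of sampled Gram matrices.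

    A full placement has too many vertices to be compared with independent sampling; the comparison
    is made separately for each failure event, which reads at most one block, one further level, u
    and v. *)

(** * Orthogonal projections in finite dimension *)

Section Dot.
Variables (R : realType) (T : finType).
Implicit Types x y z : T -> R.

Definition dot x y : R := \sum_t x t * y t.
Definition delta (t : T) : T -> R := fun t' => (t' == t)%:R.

Lemma dotC x y : dot x y = dot y x.
Proof. by apply: eq_bigr => t _; rewrite mulrC. Qed.

Lemma dotDl x y z : dot (fun t => x t + y t) z = dot x z + dot y z.
Proof. by rewrite /dot -big_split; apply: eq_bigr => t _; rewrite mulrDl. Qed.

Lemma dotBl x y z : dot (fun t => x t - y t) z = dot x z - dot y z.
Proof. by rewrite /dot -sumrB; apply: eq_bigr => t _; rewrite mulrBl. Qed.

Lemma dotZl a x y : dot (fun t => a * x t) y = a * dot x y.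
Proof. by rewrite /dot mulr_sumr; apply: eq_bigr => t _; rewrite mulrA. Qed.

Lemma dot_suml (I : finType) (F : I -> T -> R) y :
  dot (fun t => \sum_i F i t) y = \sum_i dot (F i) y.
Proof.
rewrite /dot exchange_big; apply: eq_bigr => t _; exact: mulr_suml.
Qed.

Lemma dotDr x y z : dot z (fun t => x t + y t) = dot z x + dot z y.
Proof. by rewrite dotC dotDl !(dotC _ z). Qed.

Lemma dotBr x y z : dot z (fun t => x t - y t) = dot z x - dot z y.
Proof. by rewrite dotC dotBl !(dotC _ z). Qed.

Lemma dotZr a x y : dot y (fun t => a * x t) = a * dot y x.
Proof. by rewrite dotC dotZl (dotC _ y). Qed.

Lemma dot0l x : dot (fun=> 0) x = 0.
Proof. by rewrite /dot big1 // => t _; rewrite mul0r. Qed.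

Lemma dot0r x : dot x (fun=> 0) = 0.
Proof. by rewrite dotC dot0l. Qed.

Lemma dot_deltal t x : dot (delta t) x = x t.
Proof.
rewrite /dot (bigD1 t) //= big1 => [|i /negPf it]; rewrite /delta ?eqxx ?it.
  by rewrite mul1r addr0.
by rewrite mul0r.
Qed.

Lemma dot_deltar t x : dot x (delta t) = x t.
Proof. by rewrite dotC dot_deltal. Qed.

Lemma dot_ge0 x : 0 <= dot x x.
Proof. by apply: sumr_ge0 => t _; rewrite -expr2 sqr_ge0. Qed.

Lemma dot_eq0 x : dot x x = 0 -> x = fun=> 0.
Proof.
move=> /eqP; rewrite psumr_eq0 => [/allP h|t _]; last by rewrite -expr2 sqr_ge0.
apply: funext => t; have /= := h t (mem_index_enum t).
by rewrite mulf_eq0 orbb => /eqP.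
Qed.

Lemma dot_sqr_le x y : dot x y ^+ 2 <= dot x x * dot y y.
Proof.
have [y0|y0] := eqVneq (dot y y) 0.
  by rewrite (dot_eq0 y0) !dot0r mulr0 expr0n.
have yp : 0 < dot y y by rewrite lt_def y0 dot_ge0.
have := dot_ge0 (fun t => x t - (dot x y / dot y y) * y t).
rewrite dotBl !dotBr !dotZl !dotZr (dotC y x) => h.
have e : dot x x * dot y y - dot x y ^+ 2 = dot y y *
   (dot x x - dot x y / dot y y * dot x y -
     (dot x y / dot y y * dot x y - dot x y / dot y y * (dot x y / dot y y * dot y y))).
  by field.
by rewrite -subr_ge0 e mulr_ge0 // ltW.
Qed.

Lemma dot_add_le x y :
  dot (fun t => x t + y t) (fun t => x t + y t) <= 2 * dot x x + 2 * dot y y.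
Proof.
have := dot_ge0 (fun t => x t - y t).
rewrite dotBl !dotBr dotDl !dotDr (dotC y x) => h; lra.
Qed.

Section Onz.
Variables (I : finType).
Implicit Types (e g : I -> T -> R) (b : I -> bool) (c : I -> R).

Definition comb g c : T -> R := fun t => \sum_i c i * g i t.
Definition pr e x : T -> R := comb e (fun i => dot x (e i)).

(* An orthonormal system padded with zero vectors. *)
Definition onz b e := forall i j, dot (e i) (e j) = ((i == j) && b i)%:R.

Lemma dot_comb g c y : dot (comb g c) y = \sum_i c i * dot (g i) y.
Proof. by rewrite dot_suml; apply: eq_bigr => i _; rewrite dotZl. Qed.

Lemma onz0 b e i : onz b e -> b i = false -> e i = fun=> 0.
Proof. by move=> h bi; apply: dot_eq0; rewrite h bi andbF. Qed.

Lemma onz_coord b e y i : onz b e -> (b i)%:R * dot y (e i) = dot y (e i).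
Proof.
by move=> h; case bi: (b i); rewrite ?mul1r ?mul0r // (onz0 h bi) dot0r.
Qed.

Lemma dot_comb_onz b e c i : onz b e -> dot (comb e c) (e i) = (b i)%:R * c i.
Proof.
move=> h; rewrite dot_comb (bigD1 i) //= big1 => [|j ji].
  by rewrite h eqxx addr0 mulrC.
by rewrite h (negPf ji) mulr0.
Qed.

Lemma dot_pr e x y : dot (pr e x) y = \sum_i dot x (e i) * dot y (e i).
Proof. by rewrite dot_comb; apply: eq_bigr => i _; rewrite (dotC y). Qed.

Lemma pr_sym e x y : dot (pr e x) y = dot x (pr e y).
Proof.
by rewrite dot_pr dotC dot_pr; apply: eq_bigr => i _; rewrite mulrC.
Qed.

Lemma dot_pr_e b e x i : onz b e -> dot (pr e x) (e i) = dot x (e i).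
Proof. by move=> h; rewrite (dot_comb_onz _ _ h) (onz_coord _ _ h). Qed.

Lemma pr_comb e g c : (forall i, pr e (g i) = g i) -> pr e (comb g c) = comb g c.
Proof.
move=> h; apply: funext => t; rewrite /pr /comb.
under [RHS]eq_bigr => i _ do rewrite -(h i) /pr /comb mulr_sumr.
rewrite exchange_big; apply: eq_bigr => i _ /=.
rewrite dot_comb mulr_suml; apply: eq_bigr => j _.
by rewrite mulrA.
Qed.

(** One Gram-Schmidt step: the new vector is the normalized residual of [g i0], and nothing changes
    when the residual vanishes. The basis keeps the index type of the family, so a dependent vector
    becomes a zero slot. *)
Lemma onz_extend b e g i0 : onz b e -> b i0 = false ->
  exists b' e', [/\ onz b' e', pr e' (g i0) = g i0,
     forall x, pr e x = x -> pr e' x = x,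
     forall i, i != i0 -> b' i = b i /\ e' i = e i &
     (g i0 = (fun=> 0) -> b' i0 = false) /\
     exists a a1, e' i0 = fun t => a * g i0 t + a1 * pr e (g i0) t].
Proof.
move=> h bi; have e0 := onz0 h bi.
pose r := fun t => g i0 t - pr e (g i0) t.
have re i : dot r (e i) = 0 by rewrite dotBl (dot_pr_e _ _ h) subrr.
have [r0|rn] := eqVneq (dot r r) 0.
  exists b, e; split => //.
    apply: funext => t; have /= := congr1 (fun f => f t) (dot_eq0 r0).
    by rewrite /r => /eqP; rewrite subr_eq0 => /eqP.
  split => //; exists 0, 0; rewrite e0; apply: funext => t; ring.
have rp : 0 < dot r r by rewrite lt_def rn dot_ge0.
pose k := (Num.sqrt (dot r r))^-1.
have kk : k * k * dot r r = 1.
  by rewrite -[X in _ * X](sqr_sqrtr (ltW rp)) /k -expr2 -exprMn mulVf ?expr1n // gt_eqF //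
    sqrtr_gt0.
pose e' i := if i == i0 then (fun t => k * r t) else e i.
pose b' i := if i == i0 then true else b i.
have h' : onz b' e'.
  move=> i j; rewrite /e' /b'; case: (eqVneq i i0) => [->|ii]; case: (eqVneq j i0) => [ej|jj].
  - by rewrite dotZl dotZr mulrA kk.
  - by rewrite dotZl re mulr0.
  - by rewrite ej (negPf ii) dotZr dotC re mulr0.
  - by rewrite h.
have pre' x : pr e' x = fun t => pr e x t + dot x r * (k * k) * r t.
  apply: funext => t; rewrite /pr /comb (bigD1 i0) //= [in RHS](bigD1 i0) //=.
  rewrite e0 mulr0 add0r addrC; congr (_ + _).
    by apply: eq_bigr => i ii; rewrite /e' (negPf ii).
  by rewrite /e' eqxx dotZr; ring.
exists b', e'; split => //.
- have gr : dot (g i0) r = dot r r.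
    by rewrite {2}/r dotBl dot_pr big1 ?subr0 // => i _; rewrite re mulr0.
  rewrite pre'; apply: funext => t.
  by rewrite gr [dot r r * _]mulrC kk mul1r /r; ring.
- move=> x px; rewrite pre' px; apply: funext => t.
  have -> : dot x r = 0; last by rewrite !mul0r addr0.
  by rewrite -px dot_pr big1 // => i _; rewrite re mulr0.
- by move=> i ii; rewrite /e' /b' (negPf ii).
- rewrite /b' /e' eqxx; split; last by exists k, (- k); apply: funext => t; rewrite /r; ring.
  move=> g0; exfalso; move: rn; rewrite /r g0; apply/negP; rewrite negbK.
  have -> : pr e (fun=> 0) = (fun=> 0).
    by apply: funext => t; rewrite /pr /comb big1 // => i _; rewrite dot0l mul0r.
  by rewrite /dot big1 // => t _; rewrite subrr mul0r.
Qed.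

Lemma gram_schmidt g : exists b e, [/\ onz b e, forall i, pr e (g i) = g i,
  forall i, exists c, e i = comb g c & forall i, g i = (fun=> 0) -> b i = false].
Proof.
suff H : forall s : seq I, uniq s -> exists b e, [/\ onz b e,
   forall i, i \in s -> pr e (g i) = g i,
   forall i, exists c, e i = comb g c,
   forall i, g i = (fun=> 0) -> b i = false &
   forall i, i \notin s -> b i = false].
  have [b [e [h1 h2 h3 h4 _]]] := H _ (enum_uniq I).
  by exists b, e; split => // i; apply: h2; rewrite mem_enum.
elim=> [_|i0 s IH /= /andP[i0s us]].
  exists (fun=> false), (fun _ _ => 0); split => //.
  - by move=> i j; rewrite dot0l andbF.
  - by move=> i; exists (fun=> 0); apply: funext => t; rewrite /comb big1 // => j _;
    rewrite mul0r.
have [b [e [h1 h2 h3 h4 h5]]] := IH us.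
have [b' [e' [k1 k2 k3 k4 [k5 [a [a1 k6]]]]]] := onz_extend g h1 (h5 _ i0s).
exists b', e'; split => //.
- by move=> i; rewrite inE => /orP[/eqP->//|/h2/k3].
- move=> i; case: (eqVneq i i0) => [->|/k4[_ ->]//].
  have [cc Hc] := choice h3.
  exists (fun i => a * (i == i0)%:R + a1 * \sum_j dot (g i0) (e j) * cc j i).
  rewrite k6; apply: funext => t; rewrite /comb.
  under [RHS]eq_bigr => j _ do rewrite mulrDl -!mulrA.
  rewrite big_split -!mulr_sumr; congr (_ * _ + _ * _).
    rewrite (bigD1 i0) //= eqxx mul1r big1 ?addr0 // => j /negPf->.
    by rewrite mul0r.
  under [RHS]eq_bigr => j _ do rewrite mulr_suml.
  rewrite exchange_big; apply: eq_bigr => j _ /=.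
  rewrite [in X in _ * X]Hc /comb mulr_sumr; apply: eq_bigr => l _; ring.
- by move=> i g0; case: (eqVneq i i0) => [ii|/k4[-> _]]; [rewrite ii; apply: k5;
  rewrite -ii|exact: h4].
- by move=> i; rewrite inE negb_or => /andP[/k4[-> _]]; exact: h5.
Qed.

Definition gsb g : I -> bool := projT1 (cid (gram_schmidt g)).
Definition gsf g : I -> T -> R := projT1 (cid (projT2 (cid (gram_schmidt g)))).
Lemma gsP g : [/\ onz (gsb g) (gsf g), forall i, pr (gsf g) (g i) = g i,
  forall i, exists c, gsf g i = comb g c & forall i, g i = (fun=> 0) -> gsb g i = false].
Proof. exact: (projT2 (cid (projT2 (cid (gram_schmidt g))))). Qed.

Definition proj g := pr (gsf g).

Lemma proj_fix g i : proj g (g i) = g i.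
Proof. by have [_ + _ _] := gsP g; apply. Qed.

Lemma proj_sym g x y : dot (proj g x) y = dot x (proj g y).
Proof. exact: pr_sym. Qed.

Lemma proj_fix_comb g c : proj g (comb g c) = comb g c.
Proof. by apply: pr_comb => i; exact: proj_fix. Qed.

Lemma proj_in g x : exists c, proj g x = comb g c.
Proof.
have [_ _ h _] := gsP g; have [cc Hc] := choice h.
exists (fun i => \sum_j dot x (gsf g j) * cc j i).
apply: funext => t; rewrite /proj /pr /comb.
under [RHS]eq_bigr => j _ do rewrite mulr_suml.
rewrite exchange_big; apply: eq_bigr => j _ /=.
rewrite [in X in _ * X]Hc /comb mulr_sumr; apply: eq_bigr => l _; ring.
Qed.

Lemma proj_idem g x : proj g (proj g x) = proj g x.
Proof. by have [c ->] := proj_in g x; exact: proj_fix_comb. Qed.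

Lemma dot_proj g x : dot (proj g x) (proj g x) = dot x (proj g x).
Proof. by rewrite proj_sym proj_idem. Qed.

Lemma projD g x y : proj g (fun t => x t + y t) = fun t => proj g x t + proj g y t.
Proof.
apply: funext => t; rewrite /proj /pr /comb -big_split; apply: eq_bigr => i _.
by rewrite dotDl mulrDl.
Qed.

Lemma projZ g a x : proj g (fun t => a * x t) = fun t => a * proj g x t.
Proof.
apply: funext => t; rewrite /proj /pr /comb mulr_sumr; apply: eq_bigr => i _.
by rewrite dotZl mulrA.
Qed.

Lemma proj_orth g x : (forall i, dot x (g i) = 0) -> proj g x = fun=> 0.
Proof.
move=> h; apply: dot_eq0; rewrite dot_proj; have [c ->] := proj_in g x.
by rewrite dotC dot_comb big1 // => i _; rewrite dotC h mulr0.
Qed.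

Lemma proj_res g x i : dot (fun t => x t - proj g x t) (g i) = 0.
Proof. by rewrite dotBl proj_sym proj_fix subrr. Qed.

Lemma proj_uniq g x y : (exists c, y = comb g c) ->
  (forall i, dot (fun t => x t - y t) (g i) = 0) -> proj g x = y.
Proof.
move=> [c yc] h.
have -> : x = fun t => (x t - y t) + y t by apply: funext => t; rewrite subrK.
rewrite projD (proj_orth h) yc proj_fix_comb.
by apply: funext => t; rewrite add0r.
Qed.

Lemma proj_le g x : dot (proj g x) (proj g x) <= dot x x.
Proof.
have := dot_ge0 (fun t => x t - proj g x t).
rewrite dotBl !dotBr (dotC (proj g x) x) -!dot_proj => h; lra.
Qed.

(** The trace of the projection is computed in two bases: [delta], and the Gram-Schmidt basis, where
    it is the rank. *)
Lemma proj_trace g :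
  \sum_t dot (proj g (delta t)) (proj g (delta t)) = (\sum_i gsb g i)%:R.
Proof.
transitivity (\sum_t \sum_i dot (delta t) (gsf g i) * dot (delta t) (gsf g i)).
  by apply: eq_bigr => t _; rewrite dot_proj dotC dot_pr.
rewrite exchange_big natr_sum; apply: eq_bigr => i _ /=.
have [h _ _ _] := gsP g.
have := h i i; rewrite eqxx /= => <-; apply: eq_bigr => t _.
by rewrite dot_deltal.
Qed.

End Onz.

Lemma proj_eq (I J : finType) (g : I -> T -> R) (g' : J -> T -> R) :
  (forall i, exists c, g i = comb g' c) -> (forall j, exists c, g' j = comb g c) ->
  proj g = proj g'.
Proof.
move=> h h'; apply: funext => x; apply: proj_uniq => [|i].
  have [c ->] := proj_in g' x; have [cc Hc] := choice h'.
  exists (fun i => \sum_j c j * cc j i); apply: funext => t; rewrite /comb.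
  under [RHS]eq_bigr => j _ do rewrite mulr_suml.
  rewrite exchange_big; apply: eq_bigr => j _ /=.
  rewrite Hc /comb mulr_sumr; apply: eq_bigr => l _; ring.
have [c ->] := h i; rewrite dotC dot_comb big1 // => j _.
by rewrite dotC proj_res mulr0.
Qed.

End Dot.

Lemma proj_reindex (R : realType) (T T' I : finType) (g : I -> T -> R) (h : T' -> T) x :
  bijective h -> proj (fun i => g i \o h) (x \o h) = proj g x \o h.
Proof.
move=> hb; apply: proj_uniq => [|i].
  by have [c ->] := proj_in g x; exists c.
rewrite -(proj_res g x i) /dot [RHS](reindex h) //.
by case: hb => k hk kh; exists k => t _; rewrite ?hk ?kh.
Qed.

(** * Two subspaces and the projection on their sum *)

Section TwoProjections.
Variables (R : realType) (T I1 I2 : finType).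
Variables (g1 : I1 -> T -> R) (g2 : I2 -> T -> R).
Implicit Types x y : T -> R.

Definition joinf (i : I1 + I2) : T -> R :=
  match i with inl i => gsf g1 i | inr i => gsf g2 i end.

Definition jproj := proj joinf.

(* [P + P' - Q], for the projections on two subspaces and on their sum. *)
Definition jdefect x : T -> R := fun t => proj g1 x t + proj g2 x t - jproj x t.

Lemma jproj1 x : jproj (proj g1 x) = proj g1 x.
Proof.
have -> : proj g1 x = comb joinf
    (fun i => match i with inl i => dot x (gsf g1 i) | inr _ => 0 end).
  apply: funext => t; rewrite /comb big_sumType /= [X in _ + X]big1 ?addr0 //.
  by move=> i _; rewrite mul0r.
exact: proj_fix_comb.
Qed.

Lemma jproj2 x : jproj (proj g2 x) = proj g2 x.
Proof.
have -> : proj g2 x = comb joinf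
    (fun i => match i with inr i => dot x (gsf g2 i) | inl _ => 0 end).
  apply: funext => t; rewrite /comb big_sumType /= [X in X + _]big1 ?add0r //.
  by move=> i _; rewrite mul0r.
exact: proj_fix_comb.
Qed.

Lemma jdefect_sum x y : jdefect (fun t => x t + y t) = fun t => jdefect x t + jdefect y t.
Proof. by apply: funext => t; rewrite /jdefect /jproj !projD; ring. Qed.

(** The joint projection fixes the ranges of both projections, so its inner products with
    [proj g1 x] and [proj g2 x] are their squared norms and the expansion collapses. *)
Lemma jdefect_sqr x : dot (jdefect x) (jdefect x) =
  dot (jproj x) (jproj x) - dot (proj g1 x) (proj g1 x) -
  dot (proj g2 x) (proj g2 x) + 2 * dot (proj g1 x) (proj g2 x).
Proof.
rewrite /jdefect; set p := proj g1 x; set p' := proj g2 x; set q := jproj x.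
have pq : dot p q = dot p p by rewrite /q /jproj -proj_sym -/jproj jproj1 dotC -dot_proj.
have pq' : dot p' q = dot p' p' by rewrite /q /jproj -proj_sym -/jproj jproj2 dotC -dot_proj.
rewrite !dotBl !dotBr !dotDl !dotDr (dotC q p) (dotC q p') (dotC p' p) pq pq'; ring.
Qed.

(** Summed over a basis, the first three terms of [jdefect_sqr] are ranks, and the rank of a sum of
    subspaces is at most the sum of the ranks. Only the trace of the product of the two projections
    remains. *)
Lemma jdefect_hs :
  \sum_t dot (jdefect (delta R t)) (jdefect (delta R t)) <=
  2 * \sum_t dot (proj g1 (delta R t)) (proj g2 (delta R t)).
Proof.
under eq_bigr => t _ do rewrite jdefect_sqr.
rewrite big_split !sumrB /= -mulr_sumr !proj_trace -[leRHS]add0r lerD2r.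
rewrite -addrA -opprD subr_le0 -natrD ler_nat big_sumType /=.
(* The rank inequality is checked slot by slot: a zero slot of either basis is a zero vector of
   [joinf], hence a zero slot of the joint basis. *)
apply: leq_add; apply: leq_sum => i _; have [_ _ _ h] := gsP joinf.
  case bi : (gsb g1 i); first exact: leq_b1.
  by rewrite (h (inl i)) //=; have [h1 _ _ _] := gsP g1; exact: onz0 h1 bi.
case bi : (gsb g2 i); first exact: leq_b1.
by rewrite (h (inr i)) //=; have [h1 _ _ _] := gsP g2; exact: onz0 h1 bi.
Qed.

Lemma jproj_sqr_le x : dot (jproj x) (jproj x) <=
  4 * (dot (proj g1 x) (proj g1 x) + dot (proj g2 x) (proj g2 x)) +
  2 * dot (jdefect x) (jdefect x).
Proof.
have -> : jproj x = fun t => (proj g1 x t + proj g2 x t) + (-1) * jdefect x t.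
  by apply: funext => t; rewrite /jdefect; ring.
apply: le_trans (dot_add_le _ _) _; rewrite dotZl dotZr.
have := dot_add_le (proj g1 x) (proj g2 x); lra.
Qed.

End TwoProjections.

(** * Matrices with prescribed row spaces or column spaces *)

Definition flip (X : Type) (t : X * X) := (t.2, t.1).

Section RowFamilies.
Variables (R : realType) (X J : finType).
Implicit Types (G : X -> J -> X -> R).

(** The span consists of the matrices whose row [i] is a combination of [G i]; the transposed family
    constrains the columns instead. *)
Definition rowfam G (il : X * J) : X * X -> R :=
  fun jk => (jk.1 == il.1)%:R * G il.1 il.2 jk.2.

Definition colfam G (il : X * J) : X * X -> R := rowfam G il \o (@flip X).

Lemma flip_bij : bijective (@flip X).
Proof. by exists (@flip _) => -[]. Qed.

Lemma proj_rowfam G x :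
  proj (rowfam G) x = fun jk => proj (G jk.1) (fun k => x (jk.1, k)) jk.2.
Proof.
apply: proj_uniq => [|[i l]].
  have /choice[c Hc] : forall i, exists c, proj (G i) (fun k => x (i, k)) = comb (G i) c.
    by move=> i; exact: proj_in.
  exists (fun il => c il.1 il.2); apply: funext => -[j k] /=.
  rewrite Hc /comb -(pair_bigA _ (fun i l => c i l * rowfam G (i, l) (j, k))) /=.
  rewrite (bigD1 j) //= [X in _ + X]big1 ?addr0 => [|i ij].
    by apply: eq_bigr => l _; rewrite /rowfam /= eqxx mul1r.
  by rewrite big1 // => l _; rewrite /rowfam /= eq_sym (negPf ij) mul0r mulr0.
rewrite -(proj_res (G i) (fun k => x (i, k)) l) /dot.
transitivity (\sum_j \sum_k (x (j, k) - proj (G j) (fun k0 => x (j, k0)) k) *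
   rowfam G (i, l) (j, k)).
  by rewrite pair_bigA; apply: eq_bigr => -[].
rewrite (bigD1 i) //= [X in _ + X]big1 ?addr0 => [|j ij].
  by apply: eq_bigr => k _; rewrite /rowfam /= eqxx mul1r.
by rewrite big1 // => k _; rewrite /rowfam /= (negPf ij) mul0r mulr0.
Qed.

Lemma proj_colfam G x : proj (colfam G) x = proj (rowfam G) (x \o (@flip X)) \o (@flip X).
Proof.
rewrite -(proj_reindex (rowfam G) (x \o (@flip X)) flip_bij); congr proj.
by apply: funext => -[].
Qed.

(** Leverage score of the coordinate [j] in the span of [G i]: a diagonal entry of the projection,
    and also the best constant in a bound of [f j ^ 2] by the squared norm of [f], over that
    span. *)
Definition lev G i j : R := proj (G i) (delta R j) j.

Lemma lev_ge0 G i j : 0 <= lev G i j.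
Proof. by rewrite /lev -dot_deltal -dot_proj dot_ge0. Qed.

Lemma lev_le G i j h : 0 <= h ->
  (forall c, comb (G i) c j ^+ 2 <= h * dot (comb (G i) c) (comb (G i) c)) ->
  lev G i j <= h.
Proof.
move=> h0 H; have [c Hc] := proj_in (G i) (delta R j).
have := H c; rewrite -Hc dot_proj dot_deltal -/(lev G i j) expr2.
have := lev_ge0 G i j; rewrite le_eqVlt => /orP[/eqP <- //|l0]; by rewrite ler_pM2r.
Qed.

(** One projection acts inside row [i] and the other inside column [j], so the two images of the
    unit matrix have only the entry [(i, j)] in common. *)
Lemma dot_row_col G i j :
  dot (proj (rowfam G) (delta R (i, j))) (proj (colfam G) (delta R (i, j))) =
  lev G i j * lev G j i.
Proof.
rewrite proj_colfam !proj_rowfam /dot /=.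
have rowE (a b c : X) : (fun k => delta R (a, b) (c, k)) = if c == a then delta R b else fun=> 0.
  apply: funext => k; rewrite /delta xpair_eqE; case: eqP => //=.
have colE (a b c : X) : (fun k => (delta R (a, b) \o (@flip X)) (c, k)) =
  if c == b then delta R a else fun=> 0.
  by apply: funext => k; rewrite /delta /= xpair_eqE andbC; case: eqP.
have p0 c : proj (G c) (fun=> 0) = fun=> 0.
  by apply: proj_orth => l; rewrite dot0l.
rewrite (bigD1 (i, j)) //= big1 => [|[a b] /= ab].
  by rewrite addr0 rowE eqxx colE eqxx.
rewrite rowE colE; move: ab; rewrite xpair_eqE; case: eqP => [->|_ _]; last by rewrite p0 mul0r.
by case: eqP => //= _ _; rewrite p0 mulr0.
Qed.

Definition rdefect G := jdefect (rowfam G) (colfam G).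
Definition rproj G := jproj (rowfam G) (colfam G).

Definition cross (a c : X) : X * X -> R := fun t => delta R (a, c) t + delta R (c, a) t.

(** Measures the failure of orthogonality between row and column spaces as seen from the single
    vertex [c], through the symmetric units of the cross at [c]. *)
Definition crossdef G c := \sum_a dot (rdefect G (cross a c)) (rdefect G (cross a c)).

(** By [jdefect_hs] the total defect is at most twice a sum of products of leverage scores.
    Splitting a cross into its two units, each of which is met twice, costs the remaining factor
    4. *)
Lemma sum_crossdef G h : (forall i j, lev G i j <= h) ->
  \sum_c crossdef G c <= 8 * h ^+ 2 * #|X|%:R ^+ 2.
Proof.
move=> H.
have H1 c a : dot (rdefect G (cross a c)) (rdefect G (cross a c)) <=
    2 * dot (rdefect G (delta R (a, c))) (rdefect G (delta R (a, c))) +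
    2 * dot (rdefect G (delta R (c, a))) (rdefect G (delta R (c, a))).
  by rewrite /rdefect jdefect_sum; exact: dot_add_le.
pose f a c := dot (rdefect G (delta R (a, c))) (rdefect G (delta R (a, c))).
apply: (@le_trans _ _ (\sum_c \sum_a (2 * f a c + 2 * f c a))).
  by apply: ler_sum => c _; apply: ler_sum => a _; exact: H1.
have Hf : \sum_a \sum_c f a c <= 2 * (h ^+ 2 * #|X|%:R ^+ 2).
  rewrite pair_bigA /=.
  have := jdefect_hs (rowfam G) (colfam G).
  have -> : \sum_t dot (jdefect (rowfam G) (colfam G) (delta R t)) (jdefect (rowfam G) (colfam G)
    (delta R t)) = \sum_p f p.1 p.2.
    by apply: eq_bigr => -[a c].
  move=> /le_trans; apply; rewrite ler_pM2l //.
  apply: (@le_trans _ _ (\sum_(t : X * X) h ^+ 2)).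
    apply: ler_sum => -[i j] _; rewrite dot_row_col expr2.
    by apply: ler_pM; rewrite ?lev_ge0.
  by rewrite sumr_const card_prod -[X in X <= _]mulr_natr natrM expr2.
under eq_bigr => c _ do rewrite big_split -!mulr_sumr.
rewrite big_split -!mulr_sumr exchange_big /= -mulrDr.
lra.
Qed.

End RowFamilies.

(** * Transport of the values at one vertex to the pairs of other vertices *)

Section CrossTransport.
Variables (R : realType) (U J : finType).
Notation X := (option U).
Variables (G : X -> J -> X -> R) (h : R).
Hypothesis Gdiag : forall i l, G i l i = 0.
Hypothesis lev_small : forall i j, lev G i j <= h.

Definition hat (y : U -> R) : X * X -> R := fun t =>
  match t with (Some a, None) | (None, Some a) => y a | _ => 0 end.

Lemma sum_XX (f : X * X -> R) : \sum_t f t = f (None, None) +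
  \sum_a (f (Some a, None) + f (None, Some a)) + \sum_a \sum_b f (Some a, Some b).
Proof.
have so (F : X -> R) : \sum_x F x = F None + \sum_a F (Some a).
  rewrite (bigD1 None) //=; congr (_ + _).
  rewrite (reindex_omap Some id) //=; last by case.
  by apply: eq_bigl => a; rewrite eqxx.
have -> : \sum_t f t = \sum_x \sum_y f (x, y).
  by rewrite pair_bigA; apply: eq_bigr => -[].
rewrite (so (fun x => \sum_y f (x, y))) (so (fun y => f (None, y))).
have -> : \sum_a \sum_y f (Some a, y) = \sum_a (f (Some a, None) + \sum_b f (Some a, Some b)).
  by apply: eq_bigr => a _; exact: (so (fun y => f (Some a, y))).
by rewrite !big_split /=; ring.
Qed.

(** Such tests do not see the row of the distinguished vertex [None], so pairing with them isolates
    what the other vertices contribute. *)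
Definition vorth (y : U -> R) := forall l, \sum_a y a * G None l (Some a) = 0.

Lemma hatE y : hat y = fun t => \sum_a y a * cross R (Some a) None t.
Proof.
apply: funext => -[[a|] [b|]]; rewrite /cross /delta /=.
- by rewrite big1 // => c _; rewrite !xpair_eqE /= !andbF addr0 mulr0.
- rewrite (bigD1 a) //= big1 => [|c ca].
    by rewrite !xpair_eqE eqxx /= !addr0 mulr1.
  by rewrite !xpair_eqE /= andbT (inj_eq Some_inj) eq_sym (negPf ca) addr0 mulr0.
- rewrite (bigD1 b) //= big1 => [|c ca].
    by rewrite eqxx add0r addr0 mulr1.
  by rewrite add0r xpair_eqE /= (inj_eq Some_inj) eq_sym (negPf ca) mulr0.
- by rewrite big1 // => c _; rewrite addr0 mulr0.
Qed.

Lemma dot_hat y x : dot (hat y) x = \sum_a y a * (x (Some a, None) + x (None, Some a)).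
Proof.
rewrite /dot sum_XX /= !mul0r add0r [X in _ + X]big1 ?addr0 => [|a _].
  by apply: eq_bigr => a _; rewrite mulrDr.
by rewrite big1 // => b _; rewrite mul0r.
Qed.

(** By linearity [hat y] is a combination of crosses through [None]; Cauchy-Schwarz in the
    coefficients leaves the sum defining [crossdef]. *)
Lemma rdefect_hat y : dot (rdefect G (hat y)) (rdefect G (hat y)) <=
  dot y y * crossdef G None.
Proof.
have E : rdefect G (hat y) = fun t => \sum_a y a * rdefect G (cross R (Some a) None) t.
  rewrite hatE; apply: funext => t.
  rewrite /rdefect /jdefect /jproj /proj /pr /comb.
  under eq_bigr => i _ do rewrite dot_suml mulr_suml.
  rewrite exchange_big /=.
  under [X in _ + X - _]eq_bigr => i _ do rewrite dot_suml mulr_suml.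
  rewrite [X in _ + X - _]exchange_big /=.
  under [X in _ + _ - X]eq_bigr => i _ do rewrite dot_suml mulr_suml.
  rewrite [X in _ + _ - X]exchange_big /= -big_split -sumrB; apply: eq_bigr => a _ /=.
  rewrite mulrBr mulrDr !mulr_sumr; congr (_ + _ - _); apply: eq_bigr => i _;
    by rewrite dotZl mulrA.
rewrite E /dot.
apply: (@le_trans _ _ (\sum_t (dot y y * \sum_a rdefect G (cross R (Some a) None) t ^+ 2))).
  apply: ler_sum => t _; rewrite -expr2.
  apply: le_trans (dot_sqr_le y (fun a => rdefect G (cross R (Some a) None) t)) _.
  by rewrite {2}/dot.
rewrite -mulr_sumr ler_wpM2l ?dot_ge0 // exchange_big /=.
apply: (@le_trans _ _ (\sum_a dot (rdefect G (cross R (Some a) None)) (rdefect G (cross R (Some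
  a) None)))).
  by apply: ler_sum => a _; apply: ler_sum => t _; rewrite expr2.
rewrite /crossdef [leRHS](bigD1 None) //= [X in _ <= _ + X](reindex_omap Some id) /=;
  last by case.
rewrite -[leLHS]add0r lerD ?dot_ge0 //.
by rewrite le_eqVlt; apply/orP; left; apply/eqP/eq_bigl => a; rewrite eqxx.
Qed.

(** The row [None] of [hat y] is killed by [vorth]. Any other row meets [hat y] only in the entry at
    [None], where the projection is governed by a leverage score. *)
Lemma proj_hat y : vorth y ->
  dot (proj (rowfam G) (hat y)) (proj (rowfam G) (hat y)) <= h * dot y y.
Proof.
move=> yo; rewrite dot_proj dot_hat proj_rowfam /=.
have r0 : (fun k => hat y (None, k)) = fun k => if k is Some a then y a else 0.
  by apply: funext => -[].
have ra a : (fun k => hat y (Some a, k)) = fun k => y a * delta R None k.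
  by apply: funext => -[b|]; rewrite /delta /= ?mulr0 ?mulr1.
have -> : proj (G None) (fun k => hat y (None, k)) = fun=> 0.
  apply: proj_orth => l; rewrite r0 -[RHS](yo l) /dot (bigD1 None) //= mul0r add0r.
  rewrite (reindex_omap Some id) /=; last by case.
  by apply: eq_bigl => a; rewrite eqxx.
rewrite /dot mulr_sumr; apply: ler_sum => a _; rewrite addr0 ra projZ.
rewrite -/(lev G (Some a) None) mulrCA mulrA [leRHS]mulrC ler_wpM2l //.
by rewrite -expr2 sqr_ge0.
Qed.

Lemma proj_col_hat y : dot (proj (colfam G) (hat y)) (proj (colfam G) (hat y)) =
  dot (proj (rowfam G) (hat y)) (proj (rowfam G) (hat y)).
Proof.
rewrite proj_colfam; have -> : hat y \o (@flip X) = hat y by apply: funext => -[[a|] [b|]].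
rewrite /dot [RHS](reindex (@flip X)) //.
by exists (@flip _) => -[].
Qed.

Lemma rproj_hat y : vorth y -> dot (rproj G (hat y)) (rproj G (hat y)) <=
  8 * h * dot y y + 2 * dot (rdefect G (hat y)) (rdefect G (hat y)).
Proof.
move=> yo; apply: le_trans (jproj_sqr_le _ _ _) _.
rewrite proj_col_hat; have := proj_hat yo; rewrite /rdefect; lra.
Qed.

Variables (c : X -> J -> R).
Let F i := comb (G i) (c i).

(* The row of F at the vertex None is free, and is chosen so that
   the column [F (Some a) None + F None (Some a)] is orthogonal to its space;
   the smallness condition then makes the projection of that column a
   contraction. *)
Lemma cross_transport y : vorth y -> 8 * h + 2 * crossdef G None <= 1 ->
  (\sum_a y a * F (Some a) None) ^+ 2 <=
  dot (rproj G (hat y)) (rproj G (hat y)) *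
  \sum_a \sum_b (F (Some a) (Some b) + F (Some b) (Some a)) ^+ 2.
Proof.
move=> yo small.
pose D0 k := if k is Some a then F (Some a) None else 0 : R.
have [c0 Hc0] := proj_in (G None) D0.
pose F' i := if i is Some a then F (Some a) else (fun k => - comb (G None) c0 k).
pose D a := F' (Some a) None + F' None (Some a).
have Dorth : vorth D.
  move=> l; rewrite -[RHS](proj_res (G None) D0 l) Hc0 /dot [RHS](bigD1 None) //= Gdiag mulr0
    add0r.
  rewrite [RHS](reindex_omap Some id) /=; last by case.
  by apply: eq_big => [a|a _]; rewrite ?eqxx.
pose M (t : X * X) := F' t.1 t.2.
pose S t := M t + M ((@flip X) t).
have [cM HM] : exists cM, M = comb (rowfam G) cM.
  exists (fun il => if il.1 is Some a then c (Some a) il.2 else - c0 il.2).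
  apply: funext => -[i k]; rewrite /comb /M /=.
  rewrite -(pair_bigA _ (fun i' l =>
    (if i' is Some a then c (Some a) l else - c0 l) * rowfam G (i', l) (i, k))) /=.
  rewrite (bigD1 i) //= [X in _ + X]big1 ?addr0 => [|i' ii].
    case: i => [a|] /=; rewrite /F /comb; last rewrite -sumrN; apply: eq_bigr => l _;
    by rewrite /rowfam /= ?mul1r ?mulNr ?eqxx ?mul1r.
  by rewrite big1 // => l _; rewrite /rowfam /= eq_sym (negPf ii) mul0r mulr0.
have QM : rproj G M = M.
  have <- : proj (rowfam G) M = M by rewrite HM proj_fix_comb.
  by rewrite /rproj jproj1.
have QMt : rproj G (M \o (@flip X)) = M \o (@flip X).
  have <- : proj (colfam G) (M \o (@flip X)) = M \o (@flip X).
    have E : (M \o (@flip X)) \o (@flip X) = M by apply: funext => -[].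
    by rewrite proj_colfam E HM proj_fix_comb.
  by rewrite /rproj jproj2.
(* [S] is the sum of a matrix of the row space and of one of the column space, so the joint
   projection can be moved from [S] to whatever [S] is tested against. *)
have QS : rproj G S = S.
  transitivity (fun t => rproj G M t + rproj G (M \o (@flip X)) t); first exact: projD.
  by rewrite QM QMt.
have SD a : S (Some a, None) + S (None, Some a) = 2 * D a.
  by rewrite /S /M /D /=; ring.
pose SU (t : X * X) := match t with (Some _, Some _) => S t | _ => 0 end.
have Ssplit : S = fun t => SU t + hat D t.
  apply: funext => -[[a|] [b|]]; rewrite /SU /S /M /D /= ?add0r ?addr0 //.
    by rewrite addrC.
  have -> : comb (G None) c0 None = 0 by rewrite /comb big1 // => l _; rewrite Gdiag mulr0.
  by rewrite oppr0 addr0.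
have SU2 : dot SU SU = \sum_a \sum_b (F (Some a) (Some b) + F (Some b) (Some a)) ^+ 2.
  rewrite /dot (sum_XX (fun t => SU t * SU t)).
  have -> : \sum_a (SU (Some a, None) * SU (Some a, None) + SU (None, Some a) * SU (None,
    Some a)) = 0.
    by apply: big1 => a _; rewrite /SU mulr0 addr0.
  have -> : SU (None, None) * SU (None, None) = 0 by rewrite /SU mulr0.
  rewrite !add0r.
  by apply: eq_bigr => a _; apply: eq_bigr => b _; rewrite expr2.
rewrite -SU2.
(* Replacing the row of [None] is invisible to [y], which annihilates the row space of that
   vertex. *)
have -> : \sum_a y a * F (Some a) None = \sum_a y a * D a.
  have : \sum_a y a * - comb (G None) c0 (Some a) = 0.
    transitivity (- \sum_l c0 l * \sum_a y a * G None l (Some a)).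
      rewrite -sumrN; under [RHS]eq_bigr => l _ do rewrite mulr_sumr -sumrN.
      rewrite exchange_big; apply: eq_bigr => a _ /=; rewrite mulrN /comb mulr_sumr -sumrN.
      by apply: eq_bigr => l _; ring.
    by rewrite big1 ?oppr0 // => l _; rewrite yo mulr0.
  rewrite /D => z; under [RHS]eq_bigr => a _ do rewrite mulrDr.
  by rewrite big_split /= z addr0.
set q := rproj G (hat y); set d := rproj G (hat D).
(* Testing [S] against [hat y] and [hat D] expresses both through [SU], the part among the other
   vertices, and the projected [hat D]. *)
have e1 : \sum_a y a * D a * 2 = dot q SU + dot q d.
  transitivity (dot (hat y) S).
    by rewrite dot_hat; apply: eq_bigr => a _; rewrite SD; ring.
  rewrite -QS /rproj -proj_sym -/(rproj G) {1}Ssplit dotDr; congr (_ + _).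
  by rewrite /q /d /rproj /jproj proj_sym [in RHS]proj_sym proj_idem.
have e2 : 2 * dot D D = dot d SU + dot d d.
  transitivity (dot (hat D) S).
    by rewrite dot_hat mulr_sumr; apply: eq_bigr => a _; rewrite SD; ring.
  rewrite -QS /rproj -proj_sym -/(rproj G) {1}Ssplit dotDr; congr (_ + _).
  by rewrite /d /rproj /jproj proj_sym [in RHS]proj_sym proj_idem.
have dd : dot d d <= dot D D.
  apply: le_trans (rproj_hat Dorth) _.
  have := rdefect_hat D; have := dot_ge0 D; nra.
(* From [e2] and the contraction [dd], the norm of [d] is controlled by its pairing with [SU], hence
   by [SU] itself; the unknown column [D] is thereby eliminated. *)
have sd : dot d d <= dot SU SU.
  have h1 : dot d d <= dot d SU by lra.
  have h2 := dot_sqr_le d SU; have := dot_ge0 d; have := dot_ge0 SU; nra.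
have c1 := dot_sqr_le q SU; have c2 := dot_sqr_le q d.
have q0 := dot_ge0 q.
have e3 : (2 * \sum_a y a * D a) ^+ 2 <= 4 * (dot q q * dot SU SU).
  have -> : 2 * \sum_a y a * D a = dot q SU + dot q d by rewrite -e1 mulr_sumr; apply: eq_bigr =>
    a _; ring.
  have c3 : dot q d ^+ 2 <= dot q q * dot SU SU by apply: le_trans c2 _; rewrite ler_wpM2l.
  have := sqr_ge0 (dot q SU - dot q d); nra.
by rewrite exprMn in e3; lra.
Qed.

End CrossTransport.

(** * Scaling down the slots of large leverage *)

Definition nzrows (R : realType) (V J : finType) (G : V -> J -> V -> R) a : nat :=
  #|[set l | G a l != (fun=> 0 : R)]%SET|.

Section Reweighting.
Variables (R : realType) (V J : finType) (M : V -> J -> V -> R) (eta : R).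
Hypothesis eta0 : 0 < eta.
Implicit Types om : V -> V -> R.

Definition wsum om a c := \sum_d om a d * comb (M a) c d ^+ 2.

Definition witness om a b := exists c, 0 < om a b * comb (M a) c b ^+ 2 /\
  eta * wsum om a c <= om a b * comb (M a) c b ^+ 2.

(** A weight may go below 1 only if a witness shows that the slot still has leverage at least [eta]
    in one of its two weighted row spaces. The class is closed under minimum, so its infimum can be
    approached at all slots simultaneously. *)
Definition admissible om := [/\ forall a b, om a b = om b a,
  forall a b, 0 <= om a b <= 1 &
  forall a b, om a b < 1 -> witness om a b \/ witness om b a].

Lemma admissible1 : admissible (fun _ _ => 1).
Proof. by split=> // a b; rewrite ?ltxx // ler01 lexx. Qed.

Lemma wsum_le om om' a c : (forall d, om a d <= om' a d) -> wsum om a c <= wsum om' a c.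
Proof. by move=> h; apply: ler_sum => d _; rewrite ler_wpM2r // sqr_ge0. Qed.

Lemma witness_le om om' a b : (forall d, om' a d <= om a d) -> om' a b = om a b ->
  witness om a b -> witness om' a b.
Proof.
move=> h e [c [c0 hc]]; exists c; rewrite e; split=> //.
by apply: le_trans hc; rewrite ler_pM2l //; exact: wsum_le.
Qed.

(** At each slot the smaller weight keeps its own witness: lowering the other weights of the row
    only decreases the energy that the witness is compared with. *)
Lemma admissible_min om om' : admissible om -> admissible om' ->
  admissible (fun a b => Num.min (om a b) (om' a b)).
Proof.
move=> [s1 b1 w1] [s2 b2 w2]; split=> [a b|a b|a b].
- by rewrite s1 s2.
- by have := b1 a b; have := b2 a b; rewrite /Num.min; case: ifP.
- have l1 x d : Num.min (om x d) (om' x d) <= om x d by rewrite ge_min lexx.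
  have l2 x d : Num.min (om x d) (om' x d) <= om' x d by rewrite ge_min lexx orbT.
  have [le|gt] := leP (om a b) (om' a b).
    by move=> /w1[] w; [left|right]; apply: witness_le w => //; [exact: min_idPl|rewrite s2 s1;
      exact: min_idPl].
  by move=> /w2[] w; [left|right]; apply: witness_le w => //; [exact/min_idPr/ltW|rewrite s2 s1;
    exact/min_idPr/ltW].
Qed.

Definition wrow om a l b := Num.sqrt (om a b) * M a l b.

Lemma comb_wrow om a c b : comb (wrow om a) c b = Num.sqrt (om a b) * comb (M a) c b.
Proof. by rewrite /comb mulr_sumr; apply: eq_bigr => l _; rewrite /wrow; ring. Qed.

Lemma dot_comb_wrow om a c : (forall a b, 0 <= om a b) ->
  dot (comb (wrow om a) c) (comb (wrow om a) c) = wsum om a c.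
Proof.
move=> h; apply: eq_bigr => b _; rewrite !comb_wrow -expr2 exprMn sqr_sqrtr //.
Qed.

Lemma witness_lev om a b : (forall a b, 0 <= om a b) -> witness om a b ->
  eta <= lev (wrow om) a b.
Proof.
move=> h [c [c0 hc]]; set f := comb (wrow om a) c.
have fb : f b ^+ 2 = om a b * comb (M a) c b ^+ 2.
  by rewrite /f comb_wrow exprMn sqr_sqrtr.
rewrite -fb -(dot_comb_wrow _ _ h) -/f in c0 hc.
have : f b ^+ 2 <= dot f f * lev (wrow om) a b.
  have -> : f b = dot f (proj (wrow om a) (delta R b)) by rewrite -proj_sym proj_fix_comb
    dot_deltar.
  apply: le_trans (dot_sqr_le _ _) _.
  by rewrite dot_proj dot_deltal.
have f0 : 0 < dot f f.
  by apply: lt_le_trans c0 _; rewrite /dot (bigD1 b) //= -expr2 lerDl sumr_ge0 // => d _;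
    rewrite -expr2 sqr_ge0.
move=> /(le_trans hc); rewrite [leRHS]mulrC ler_pM2r //.
Qed.

Lemma sum_lev (G : V -> J -> V -> R) a :
  \sum_b lev G a b <= (nzrows G a)%:R.
Proof.
have -> : \sum_b lev G a b = \sum_b dot (proj (G a) (delta R b)) (proj (G a) (delta R b)).
  by apply: eq_bigr => b _; rewrite dot_proj dot_deltal.
rewrite proj_trace ler_nat /nzrows -sum1dep_card [leqRHS]big_mkcond /=.
apply: leq_sum => l _; have [_ _ _ h] := gsP (G a).
have [/eqP/h->//|g0] := boolP (G a l == fun=> 0).
by case: (gsb _ _).
Qed.

(** Each lowered slot carries leverage at least [eta] in one of two orientations, and the total
    leverage at a vertex is a rank, at most its number of nonzero rows. *)
Lemma admissible_card om : admissible om ->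
  #|[set p | om p.1 p.2 < 1]%SET|%:R * eta <=
  2 * (\sum_a nzrows M a)%:R.
Proof.
move=> [s1 b1 w1]; have o0 a b : 0 <= om a b by case/andP: (b1 a b).
have l0 a b : 0 <= lev (wrow om) a b by exact: lev_ge0.
apply: (@le_trans _ _ (\sum_a \sum_b (lev (wrow om) a b + lev (wrow om) b a))).
  rewrite pair_bigA -sum1dep_card natr_sum big_mkcond mulr_suml /=; apply: ler_sum => -[a b] _ /=.
  case: ifP => [/w1[] /(witness_lev o0)|_]; rewrite ?mul1r ?mul0r.
  - by move=> /le_trans; apply; rewrite lerDl.
  - by move=> /le_trans; apply; rewrite lerDr.
  - by rewrite addr_ge0.
rewrite (eq_bigr (fun a => \sum_b lev (wrow om) a b + \sum_b lev (wrow om) b a)) => [|a _];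
  last exact: big_split.
rewrite big_split /= [X in _ + X]exchange_big /= -mulr2n -[leLHS]mulr_natl ler_pM2l // natr_sum.
apply: ler_sum => a _; apply: le_trans (sum_lev _ _) _; rewrite ler_nat.
apply: subset_leq_card; apply/fintype.subsetP => l; rewrite !inE; apply: contraNN => /eqP e.
by apply/eqP/funext => b; rewrite /wrow e mulr0.
Qed.

Let inf_om a b := inf [set om a b | om in admissible].

Lemma inf_om_le om a b : admissible om -> inf_om a b <= om a b.
Proof.
move=> h; apply: ge_inf; last by exists om.
by exists 0 => _ [om' [_ b1 _] <-]; case/andP: (b1 a b).
Qed.

Lemma inf_om_ge0 a b : 0 <= inf_om a b.
Proof.
apply: lb_le_inf; first by exists 1; exists (fun _ _ => 1) => //; exact: admissible1.
by move=> _ [om' [_ b1 _] <-]; case/andP: (b1 a b).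
Qed.

Lemma inf_om_approx (phi : V -> V -> R) : (forall a b, inf_om a b < phi a b) ->
  exists2 om, admissible om & forall a b, om a b < phi a b.
Proof.
move=> h.
suff H (s : seq (V * V)) : exists2 om, admissible om &
    forall p, p \in s -> om p.1 p.2 < phi p.1 p.2.
  have [om h1 h2] := H (enum {: V * V}); exists om => // a b.
  by apply: (h2 (a, b)); rewrite mem_enum.
elim: s => [|[a b] s [om h1 h2]]; first by exists (fun _ _ => 1) => //; exact: admissible1.
have [|_ [om' h1' <-] h2'] := inf_lt _ (h a b).
  by exists 1; exists (fun _ _ => 1) => //; exact: admissible1.
exists (fun a b => Num.min (om a b) (om' a b)); first exact: admissible_min.
by move=> p; rewrite inE gt_min => /orP[/eqP->|/h2->//]; rewrite h2' orbT.
Qed.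

(** The weighting is the infimum of the admissible ones. If some slot had leverage above [2 * eta]
    there, it would also in an admissible weighting close to the infimum; halving that weight leaves
    a witness for [eta], so the result is admissible and lies below the infimum. *)
Lemma reweighting : (forall a l, M a l a = 0) -> exists om : V -> V -> R,
  [/\ forall a b, om a b = om b a, forall a b, 0 <= om a b <= 1,
  forall a b c, om a b * comb (M a) c b ^+ 2 <= 2 * eta * wsum om a c &
  #|[set p | om p.1 p.2 < 1]%SET|%:R * eta <=
  2 * (\sum_a nzrows M a)%:R].
Proof.
move=> Mdiag; exists inf_om.
have le1 a b : inf_om a b <= 1 by exact: (inf_om_le a b admissible1).
split=> [a b|a b|a b c|].
- by rewrite /inf_om; congr inf; apply/seteqP; split=> _ [om h <-]; exists om => //; case: h.
- by rewrite inf_om_ge0 le1.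
- rewrite leNgt; apply/negP => viol.
  set f := comb (M a) c in viol; set W := wsum inf_om a c in viol.
  have W0 : 0 <= W by apply: sumr_ge0 => d _; rewrite mulr_ge0 ?inf_om_ge0 ?sqr_ge0.
  pose F2 := \sum_d f d ^+ 2.
  have F0 : 0 <= F2 by apply: sumr_ge0 => d _; rewrite sqr_ge0.
  have oab0 : 0 < inf_om a b.
    rewrite lt_def inf_om_ge0 andbT; apply/eqP => z; move: viol; rewrite z mul0r.
    by rewrite ltNge mulr_ge0 // mulr_ge0 // ltW.
  pose gap := inf_om a b * f b ^+ 2 - 2 * eta * W.
  have gap0 : 0 < gap by rewrite subr_gt0.
  (* Within [d1] of the infimum the violation persists. The further cap by half of [inf_om a b]
     ensures that a halved weight drops strictly below the infimum. *)
  pose d1 := gap / (2 * eta * F2 + 1).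
  have den0 : 0 < 2 * eta * F2 + 1 by have := ltW eta0; nra.
  have d10 : 0 < d1 by exact: divr_gt0.
  have d1E : d1 * (2 * eta * F2 + 1) = gap by rewrite /d1 divfK // gt_eqF.
  pose dl := Num.min d1 (inf_om a b / 2).
  have dl0 : 0 < dl by rewrite lt_min d10 divr_gt0.
  have [|om [s1 b1 w1] ho] := @inf_om_approx (fun a b => inf_om a b + dl).
    by move=> x y; rewrite ltrDl.
  have geo x y : inf_om x y <= om x y by exact: inf_om_le.
  have Wom : wsum om a c <= W + dl * F2.
    rewrite /wsum mulr_sumr -big_split; apply: ler_sum => d _ /=.
    by rewrite -mulrDl ler_wpM2r ?sqr_ge0 // ltW.
  have viol2 : 2 * eta * wsum om a c < om a b * f b ^+ 2.
    apply: (@lt_le_trans _ _ (inf_om a b * f b ^+ 2)); last by rewrite ler_wpM2r ?sqr_ge0.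
    have dd1 : dl <= d1 by rewrite ge_min lexx.
    have : 2 * eta * wsum om a c <= 2 * eta * (W + d1 * F2).
      rewrite ler_pM2l ?mulr_gt0 //; apply: le_trans Wom _.
      by rewrite lerD2l ler_wpM2r.
    move: d1E; rewrite /gap; nra.
  have neqab : a != b.
    apply/eqP => ab; move: viol; rewrite -ab /f /comb big1 => [|l _]; last by rewrite Mdiag mulr0.
    by rewrite expr0n mulr0 ltNge mulr_ge0 // mulr_ge0 // ltW.
  pose on := [pred p : V * V | (p == (a, b)) || (p == (b, a))].
  pose om' x y := if on (x, y) then om x y / 2 else om x y.
  have om'le x y : om' x y <= om x y.
    by rewrite /om'; case: ifP => // _; have /andP[] := b1 x y; lra.
  have adm' : admissible om'.
    have onC x y : on (x, y) = on (y, x).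
      by rewrite /on /= !xpair_eqE orbC andbC [in X in _ || X]andbC.
    have wab : witness om' a b.
      exists c; have om'ab : om' a b = om a b / 2 by rewrite /om' /on /= eqxx.
      have l1 : wsum om' a c <= wsum om a c by exact: wsum_le.
      have l2 : 0 <= wsum om' a c.
        by apply: sumr_ge0 => d _; rewrite mulr_ge0 ?sqr_ge0 // /om'; case: ifP; have /andP[] :=
          b1 a d => // + _ _; lra.
      have m1 : 0 <= eta * wsum om' a c by rewrite mulr_ge0 // ltW.
      have m2 : eta * wsum om' a c <= eta * wsum om a c by rewrite ler_pM2l.
      rewrite om'ab -/f mulrAC; move: viol2; rewrite -mulrA; split; lra.
    split=> x y.
    - by rewrite /om' onC s1.
    - by rewrite /om'; have /andP[] := b1 x y; case: ifP => _; lra.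
    - have [|noxy] := boolP (on (x, y)).
        by case/orP => /eqP[-> ->]; [left|right].
      have e : om' x y = om x y by rewrite /om' (negPf noxy).
      have e' : om' y x = om y x by rewrite /om' onC (negPf noxy).
      by rewrite e => /w1[] w; [left|right]; apply: witness_le w.
  have := inf_om_le a b adm'; rewrite /om' /on /= eqxx /= => l1.
  have l2 := ho a b; have l3 : dl <= inf_om a b / 2 by rewrite ge_min lexx orbT.
  lra.
(* The count is done on an admissible weighting that is below 1 wherever the infimum is; the
   threshold 2 is vacuous at the other slots. *)
- have [|om adm ho] := @inf_om_approx (fun a b => if inf_om a b < 1 then 1 else 2).
    by move=> a b; case: ifP => // _; apply: le_lt_trans (le1 a b) _; lra.
  apply: le_trans (admissible_card adm); rewrite ler_pM2r // ler_nat.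
  apply: subset_leq_card; apply/fintype.subsetP => -[a b]; rewrite !inE /= => h.
  by have := ho a b; rewrite h.
Qed.

End Reweighting.

(** * Uniform averages, sampling without replacement, concentration *)

Section Averages.
Variables (R : realType).

Definition avg (T : finType) (F : T -> R) := (#|T|%:R)^-1 * \sum_t F t.

Lemma avg_ge0 (T : finType) (F : T -> R) : (forall t, 0 <= F t) -> 0 <= avg F.
Proof. by move=> h; rewrite mulr_ge0 ?invr_ge0 ?sumr_ge0. Qed.

Lemma avg_le (T : finType) (F F' : T -> R) : (forall t, F t <= F' t) -> avg F <= avg F'.
Proof. by move=> h; rewrite ler_wpM2l ?invr_ge0 ?ler_sum. Qed.

Lemma avg_sum (T I : finType) (F : I -> T -> R) :
  avg (fun t => \sum_i F i t) = \sum_i avg (F i).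
Proof. by rewrite /avg exchange_big mulr_sumr. Qed.

Lemma avgD (T : finType) (F F' : T -> R) : avg (fun t => F t + F' t) = avg F + avg F'.
Proof. by rewrite /avg big_split mulrDr. Qed.

Lemma avgZ (T : finType) a (F : T -> R) : avg (fun t => a * F t) = a * avg F.
Proof. by rewrite /avg -mulr_sumr mulrCA. Qed.

Lemma avg_cst (T : finType) a : (0 < #|T|)%N -> avg (fun _ : T => a) = a.
Proof.
move=> h; rewrite /avg sumr_const -[X in _ * X]mulr_natl mulrA mulVf ?mul1r //.
by rewrite pnatr_eq0 -lt0n.
Qed.

Lemma markov_avg (T : finType) (F : T -> R) (a : R) : 0 < a -> (forall t, 0 <= F t) ->
  avg (fun t => (a < F t)%R%:R) <= avg F / a.
Proof.
move=> a0 h; rewrite mulrC -avgZ; apply: avg_le => t.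
case: ltP => [lt|_]; last by rewrite mulr_ge0 // invr_ge0 ltW.
by rewrite mulrC ler_pdivlMr // mul1r ltW.
Qed.

Lemma bernoulli_sub (x : R) m : 0 <= x <= 1 -> 1 - m%:R * x <= (1 - x) ^+ m.
Proof.
move=> /andP[x0 x1]; elim: m => [|m IH]; first by rewrite mul0r subr0 expr0.
rewrite exprS.
apply: (@le_trans _ _ ((1 - x) * (1 - m%:R * x))); last by rewrite ler_wpM2l // subr_ge0.
have := mulr_ge0 (ler0n R m) (mulr_ge0 x0 x0); rewrite -natr1; nra.
Qed.

(** The falling factorial is at least [(n - m) ^ m], and Bernoulli's inequality bounds
    [(1 - m / n) ^ m] below by [1 - m ^ 2 / n], which is at least 1/2. *)
Lemma expn_fact_le n m : (2 * m ^ 2 <= n)%N -> (n ^ m * (n - m)`! <= 2 * n`!)%N.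
Proof.
move=> h; have mn : (m <= n)%N.
  by apply: leq_trans h; case: m => // m; rewrite expnS expn1 mulnA leq_pmull.
case: (posnP n) mn h => [->|n0 mn h]; first by case: m.
rewrite -(ffact_fact mn) mulnA leq_pmul2r ?fact_gt0 //.
apply: (@leq_trans (2 * (n - m) ^ m)); last first.
  rewrite leq_pmul2l // ffact_prod -[X in ((n - m) ^ X <= _)%N]card_ord -prod_nat_const.
  by apply: leq_prod => i _; rewrite leq_sub2l // ltnW.
rewrite -(ler_nat R) natrM !natrX natrB //.
have nr : 0 < n%:R :> R by rewrite ltr0n.
have -> : (n%:R - m%:R : R) = n%:R * (1 - m%:R / n%:R) by field; rewrite gt_eqF.
rewrite exprMn mulrCA ler_peMr ?exprn_ge0 ?ler0n //.
have x1 : 0 <= (m%:R / n%:R : R) <= 1 by rewrite divr_ge0 ?ler0n //= ler_pdivrMr // mul1r ler_nat.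
have := bernoulli_sub m x1.
have : m%:R * (m%:R / n%:R) <= 1 / 2 :> R.
  by rewrite mulrA ler_pdivrMr //; move: h; rewrite -(ler_nat R) natrM natrX expr2; lra.
lra.
Qed.

(* Sampling [m] vertices without replacement costs at most a factor 2 over
   sampling them independently, as long as [m ^ 2] is small against [n]. *)
Lemma perm_avg_le (V I : finType) (iota : I -> V) (F : {ffun I -> V} -> R) :
  injective iota -> (2 * #|I| ^ 2 <= #|V|)%N -> (forall x, 0 <= F x) ->
  avg (fun s : {perm V} => F [ffun i => s (iota i)]) <= 2 * avg F.
Proof.
move=> inj hI F0.
pose fib (x : {ffun I -> V}) := [set s : {perm V} | [ffun i => s (iota i)] == x]%SET.
(* Permutations with prescribed values on the image of [iota] differ from one of them by a
   permutation of the complement of that image. *)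
have fibc x : (#|fib x| <= (#|V| - #|I|)`!)%N.
  have [->|[s0 s0x]] := set_0Vmem (fib x); first by rewrite cards0.
  have := s0x; rewrite inE => /eqP/ffunP e0.
  have -> : (#|V| - #|I| = #|~: (iota @: I)|)%N.
    by rewrite cardsCs finset.setCK card_imset.
  rewrite -card_perm -(card_imset _ (mulIg s0^-1%g)).
  apply: subset_leq_card; apply/fintype.subsetP => t /imsetP[s]; rewrite inE => /eqP/ffunP e ->.
  rewrite unfold_in; apply/fintype.subsetP => v; rewrite !inE; apply: contraNN.
  move=> /imsetP[i _ ->]; have := e i; rewrite -(e0 i) !ffunE => ei.
  by rewrite permM ei permK.
rewrite /avg.
have -> : \sum_(s : {perm V}) F [ffun i => s (iota i)] = \sum_x F x *+ #|fib x|.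
  rewrite (partition_big (fun s : {perm V} => [ffun i => s (iota i)]) xpredT) //=.
  apply: eq_bigr => x _; rewrite -sumr_const; apply: eq_big => [s|s /eqP->//].
  by rewrite inE.
have cV : #|{perm V}| = (#|V|)`!.
  rewrite -(cardsT V) -card_perm; apply: eq_card => s; rewrite inE.
  by apply/esym/fintype.subsetP => v _; rewrite inE.
rewrite cV card_ffun mulrCA mulr_sumr mulrA mulr_sumr; apply: ler_sum => x _.
rewrite -[X in _ * X <= _]mulr_natr mulrCA [leRHS]mulrC ler_wpM2l //.
apply: (@le_trans _ _ ((#|V|)`!%:R^-1 * ((#|V| - #|I|)`!)%:R)).
  by rewrite ler_wpM2l ?invr_ge0 ?ler0n // ler_nat.
have V0 : 0 < (#|V|)`!%:R :> R by rewrite ltr0n fact_gt0.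
have [n0|n0] := posnP (#|V| ^ #|I|).
  move: n0 => /eqP; rewrite expn_eq0 => /andP[/eqP n0 I0].
  by move: hI; rewrite n0 leqn0 muln_eq0 /= expn_eq0 => /andP[/eqP i0]; move: I0; rewrite i0.
have n0' : 0 < (#|V| ^ #|I|)%:R :> R by rewrite ltr0n.
rewrite [leLHS]mulrC ler_pdivrMr // [_^-1 * 2]mulrC mulrAC ler_pdivlMr //.
by rewrite -!natrM ler_nat mulnC expn_fact_le.
Qed.

(** Inverting [1 - y <= expR (- y)] gives [expR y <= 1 / (1 - y)], which the quadratic dominates on
    this interval. *)
Lemma expR_quad (y : R) : `|y| <= 1 / 2 -> expR y <= 1 + y + 2 * y ^+ 2.
Proof.
rewrite ler_norml => /andP[y1 y2].
have p1 : 0 < 1 - y by lra.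
have := expR_ge1Dx (- y); rewrite expRN => h.
have e0 := expR_gt0 y.
have : (1 - y) * expR y <= 1.
  by rewrite -[leRHS](mulVf (lt0r_neq0 e0)) ler_pM2r.
have : 1 <= (1 - y) * (1 + y + 2 * y ^+ 2) by have := sqr_ge0 y; nra.
move=> a b; have := le_trans b a; by rewrite ler_pM2l.
Qed.

(** Chernoff's method: the exponential moment factorizes over the independent coordinates, and the
    linear term of each factor averages to zero. The condition on [lam * B] is the range of
    [expR_quad]. *)
Lemma hoeffding_avg (V I : finType) (X : V -> R) (B lam t : R) :
  \sum_v X v = 0 -> (forall v, `|X v| <= B) -> 0 < lam -> lam * B <= 1 / 2 ->
  avg (fun x : {ffun I -> V} => (t < \sum_i X (x i))%R%:R) <=
  expR (#|I|%:R * (2 * (lam * B) ^+ 2) - lam * t).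
Proof.
move=> X0 XB lam0 lB.
apply: (@le_trans _ _ (avg (fun x : {ffun I -> V} =>
  expR (- (lam * t)) * \prod_i expR (lam * X (x i))))).
  apply: avg_le => x; rewrite -expR_sum -expRD -mulr_sumr.
  case: ltP => [h|_]; last exact: expR_ge0.
  rewrite -[leLHS]expR0 ler_expR addrC subr_ge0 ler_pM2l //; exact: ltW.
rewrite avgZ addrC expRD ler_pM2l ?expR_gt0 //.
rewrite /avg card_ffun -(bigA_distr_bigA (fun (_ : I) v => expR (lam * X v))) /= prodr_const.
rewrite natrX -exprVn -exprMn mulrC expRM_natl.
apply: lerXn2r; rewrite ?nnegrE ?expR_ge0 //.
  by rewrite mulr_ge0 ?invr_ge0 ?sumr_ge0 // => v _; exact: expR_ge0.
have [V0|V0] := posnP #|V|.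
  by rewrite V0 invr0 mulr0 expR_ge0.
apply: le_trans (expR_ge1Dx _).
rewrite ler_pdivrMr ?ltr0n //.
have -> : (1 + 2 * (lam * B) ^+ 2) * #|V|%:R = \sum_(v : V) (1 + lam * X v + 2 * (lam * B) ^+ 2).
  by rewrite !big_split /= -mulr_sumr X0 mulr0 addr0 !sumr_const mulrDl mul1r -[X in _ =
    _ + X]mulr_natr.
apply: ler_sum => v _.
have lX : `|lam * X v| <= lam * B by rewrite normrM (gtr0_norm lam0) ler_pM2l.
apply: le_trans (expR_quad (le_trans lX lB)) _.
by rewrite lerD2l ler_pM2l // -[leLHS]real_normK ?num_real // lerXn2r // ?nnegrE ?normr_ge0 //
  (le_trans _ lX).
Qed.

End Averages.

(** * Random samples see the energy of every row space *)

Section Regularity.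
Variables (R : realType) (V J : finType) (G : V -> J -> V -> R) (K h0 : R).
Hypothesis rowsK : forall a, (nzrows G a)%:R <= K.
Hypothesis K1 : 1 <= K.
Hypothesis levG : forall a c b, comb (G a) c b ^+ 2 <= h0 * dot (comb (G a) c) (comb (G a) c).
Hypothesis h0n : (#|V|%:R)^-1 <= h0.
Hypothesis V0 : (0 < #|V|)%N.

(** Only the lower half of norm preservation is required, for all vertices at once. In particular a
    combination that vanishes on the sample vanishes everywhere. *)
Definition regular (rho : R) (I : finType) (x : I -> V) := forall a c,
  rho * dot (comb (G a) c) (comb (G a) c) <= \sum_i comb (G a) c (x i) ^+ 2.

Section Sample.
Variable I : finType.
Let s : R := #|I|%:R.
Let n : R := #|V|%:R.
Let tau : R := s / (2 * n * K).
Let n0 : 0 < n. Proof. by rewrite ltr0n. Qed.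
Let K0 : 0 < K. Proof. exact: lt_le_trans K1. Qed.

(** Contribution of one sampled vertex to an entry of the Gram matrix of the orthonormal basis,
    centred so that it sums to zero over [V] on nonzero slots. *)
Definition gdev a l m (b : V) : R :=
  gsf (G a) l b * gsf (G a) m b - ((l == m) && gsb (G a) l)%:R / n.

Lemma gsb_card a : (\sum_l gsb (G a) l)%:R <= K.
Proof.
apply: le_trans (rowsK a); rewrite ler_nat /nzrows -sum1dep_card [leqRHS]big_mkcond /=.
apply: leq_sum => l _; have [_ _ _ h] := gsP (G a).
have [/eqP/h->//|g0] := boolP (G a l == fun=> 0).
by case: (gsb _ _).
Qed.

(** The expected sampled Gram matrix is [s / n] times the identity, in dimension at most [K].
    Entrywise errors [tau] change the quadratic form by at most [tau * K] times the squared norm,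
    and [tau] is chosen so that this is half of the mean. *)
Lemma gdev_regular (x : I -> V) :
  (forall a l m, gsb (G a) l -> gsb (G a) m -> `|\sum_i gdev a l m (x i)| <= tau) ->
  regular (s / (2 * n)) x.
Proof.
move=> dev a c; set f := comb (G a) c.
set e := gsf (G a); set b := gsb (G a); have [on _ _ _] := gsP (G a).
rewrite -/e -/b in on.
pose d l := dot f (e l).
have fE : f = fun v => \sum_l d l * e l v by rewrite -[LHS](proj_fix_comb (G a) c).
have ff : dot f f = \sum_l d l ^+ 2.
  rewrite -{1}[f](proj_fix_comb (G a) c) -/f dot_pr; apply: eq_bigr => l _; by rewrite expr2.
pose D l m := \sum_i gdev a l m (x i).
have E : \sum_i f (x i) ^+ 2 = s / n * dot f f + \sum_l \sum_m d l * d m * D l m.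
  transitivity (\sum_l \sum_m d l * d m * (\sum_i e l (x i) * e m (x i))).
    under [RHS]eq_bigr => l _ do under eq_bigr => m _ do rewrite mulr_sumr.
    under [RHS]eq_bigr => l _ do rewrite exchange_big /=.
    rewrite exchange_big /=; apply: eq_bigr => i _.
    rewrite fE expr2 mulr_suml; apply: eq_bigr => l _; rewrite mulr_sumr.
    by apply: eq_bigr => m _; ring.
  rewrite ff mulr_sumr -big_split; apply: eq_bigr => l _ /=.
  have -> : s / n * d l ^+ 2 = \sum_m d l * d m * (s * ((l == m) && b l)%:R / n).
    rewrite (bigD1 l) //= big1 ?addr0 => [|m ml];
      last by rewrite eq_sym (negPf ml) mulr0 mul0r mulr0.
    rewrite eqxx /=; have := onz_coord f l on; rewrite -/(d l) => <-.
    by case: (b l) => /=; ring.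
  rewrite -big_split; apply: eq_bigr => m _ /=; rewrite -mulrDr; congr (_ * _).
  rewrite /D /gdev sumrB sumr_const -/e -/b -mulr_natr -/s; ring.
have bnd : `|\sum_l \sum_m d l * d m * D l m| <= tau * (\sum_l `|d l| * (b l)%:R) ^+ 2.
  apply: le_trans (ler_norm_sum _ _ _) _.
  rewrite expr2 mulr_suml mulr_sumr; apply: ler_sum => l _.
  apply: le_trans (ler_norm_sum _ _ _) _.
  rewrite !mulr_sumr; apply: ler_sum => m _; rewrite !normrM.
  have dl k : `|d k| = `|d k| * (b k)%:R.
    by rewrite /d -(onz_coord f k on); case: (b k); rewrite ?mulr1 // mul0r normr0 mul0r.
  case bl : (b l); last by rewrite (dl l) bl mulr0 !mul0r mulr0.
  case bm : (b m); last by rewrite (dl m) bm !mulr0 mul0r.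
  rewrite !mulr1 mulrC ler_wpM2r ?mulr_ge0 ?normr_ge0 //; exact: dev.
have cs : (\sum_l `|d l| * (b l)%:R) ^+ 2 <= K * dot f f.
  apply: le_trans (dot_sqr_le (fun l => `|d l|) (fun l => (b l)%:R)) _.
  rewrite mulrC; apply: ler_pM; rewrite ?dot_ge0 //.
    apply: le_trans (gsb_card a); rewrite natr_sum; apply: ler_sum => l _.
    by rewrite -/b; case: (b l); rewrite ?mulr1 ?mulr0.
  rewrite ff; apply: ler_sum => l _; by rewrite -normrM -expr2 ger0_norm ?sqr_ge0.
have t0 : 0 <= tau by rewrite /tau divr_ge0 ?ler0n // !mulr_ge0 // ltW.
have tK : tau * K = s / (2 * n) by rewrite /tau; field; rewrite !gt_eqF.
have := le_trans bnd (ler_wpM2l t0 cs); rewrite mulrA tK ler_norml => /andP[lo _].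
rewrite -/f E.
have -> : s / n = s / (2 * n) + s / (2 * n) by field; rewrite gt_eqF.
by rewrite [X in _ <= X + _]mulrDl -addrA lerDl -lerBlDl sub0r.
Qed.

(** Union bound over vertices, pairs of basis vectors and signs, with Hoeffding for each entry,
    bounded by [2 * h0] thanks to the leverage hypothesis. For [h0 = 2 K / n] the exponent is
    [s / (512 K ^ 4)], hence the need for blocks larger than [K ^ 4]. *)
Lemma regular_avg :
  avg (fun x : {ffun I -> V} => (~~ `[< regular (s / (2 * n)) x >])%:R : R) <=
  2 * n * K ^+ 2 * expR (- (s / (128 * n ^+ 2 * K ^+ 2 * h0 ^+ 2))).
Proof.
have h00 : 0 < h0 by apply: lt_le_trans h0n; rewrite invr_gt0.
have [s0|s0] := posnP #|I|.
  have sz : s = 0 by rewrite /s s0.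
  rewrite sz !mul0r oppr0 expR0 mulr1.
  apply: (@le_trans _ _ (avg (fun x : {ffun I -> V} => 1 : R))).
    by apply: avg_le => x; case: (~~ _).
  rewrite avg_cst ?card_ffun ?s0 //.
  have n1 : 1 <= n by rewrite ler1n.
  have : 1 <= K ^+ 2 by rewrite exprn_ege1.
  by move: n1; move: n (K ^+ 2) => n' k n1 k1; nra.
have sp : 0 < s by rewrite ltr0n.
pose bd (sg : bool) a l m (b : V) := (-1) ^+ sg * gdev a l m b.
pose P a l m : bool := gsb (G a) l && gsb (G a) m.
apply: (@le_trans _ _ (avg (fun x : {ffun I -> V} =>
    \sum_a \sum_l \sum_m \sum_(sg : bool) (P a l m)%:R * (tau < \sum_i bd sg a l m (x i))%R%:R))).
  apply: avg_le => x.
  have S0 : 0 <= \sum_a \sum_l \sum_m \sum_(sg : bool) (P a l m)%:R * (tau < \sum_i bd sg a l m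
    (x i))%R%:R :> R.
    by do 4 (apply: sumr_ge0 => ? _); rewrite mulr_ge0 ?ler0n.
  case: asboolP => //= nr.
  have [a [l [m [bl bm dv]]]] : exists a l m, [/\ gsb (G a) l,
    gsb (G a) m & tau < `|\sum_i gdev a l m (x i)|].
    apply: contrapT => H; apply: nr; apply: gdev_regular => a l m bl bm.
    by rewrite leNgt; apply/negP => dv; apply: H; exists a, l, m.
  have [sg hsg] : exists sg : bool, tau < \sum_i bd sg a l m (x i).
    have [lt0|ge0] := ltP (\sum_i gdev a l m (x i)) 0.
      by exists true; rewrite /bd -mulr_sumr expr1 mulN1r -ltr0_norm.
    by exists false; rewrite /bd -mulr_sumr expr0 mul1r -[ltRHS]ger0_norm.
  rewrite (bigD1 a) //= (bigD1 l) //= (bigD1 m) //= (bigD1 sg) //= /P bl bm hsg mul1r -!addrA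
    lerDl.
  rewrite !addr_ge0 //; do 4? (apply: sumr_ge0 => ? _); rewrite ?mulr_ge0 ?ler0n //;
   by do 4? (apply: sumr_ge0 => ? _); rewrite ?mulr_ge0 ?ler0n.
set E := expR _.
have key a l m sg : gsb (G a) l -> gsb (G a) m -> avg (fun x : {ffun I -> V} =>
  (tau < \sum_i bd sg a l m (x i))%R%:R) <= E.
  move=> bl bm.
  have [on _ inG _] := gsP (G a).
  have ebd k v : gsf (G a) k v ^+ 2 <= h0.
    have [ck eck] := inG k; rewrite eck; apply: le_trans (levG _ _ _) _; rewrite -eck on eqxx /=.
    by case: (gsb _ _); rewrite ?mulr1 ?mulr0 // ltW.
  (* Minimizer of the exponent [8 s lam ^ 2 h0 ^ 2 - lam tau], with minimum
     [- tau ^ 2 / (32 s h0 ^ 2)]. *)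
  pose lam := tau / (16 * s * h0 ^+ 2).
  have tau0 : 0 < tau by rewrite /tau divr_gt0 // !mulr_gt0.
  have lamB : lam * (2 * h0) = 1 / (16 * (n * h0) * K).
    by rewrite /lam /tau; field; rewrite !gt_eqF.
  have nh : 1 <= n * h0 by rewrite mulrC -ler_pdivrMr // mul1r.
  apply: le_trans (@hoeffding_avg _ _ _ _ (2 * h0) lam tau _ _ _ _) _.
  - rewrite /bd -mulr_sumr /gdev sumrB sumr_const -[X in _ * (_ - X)]mulr_natr divfK ?gt_eqF //.
    by rewrite -[X in _ * (X - _)]/(dot (gsf (G a) l) (gsf (G a) m)) on subrr mulr0.
  - move=> v; rewrite /bd normrM normrX normrN1 expr1n mul1r /gdev.
    apply: le_trans (ler_normB _ _) _; have -> : 2 * h0 = h0 + h0 by ring.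
    apply: lerD.
      rewrite normrM; have := ebd l v; have := ebd m v.
      rewrite -(real_normK (num_real (gsf (G a) l v))) -(real_normK (num_real (gsf (G a) m v))).
      have := normr_ge0 (gsf (G a) l v); have := normr_ge0 (gsf (G a) m v).
      have := sqr_ge0 (`|gsf (G a) l v| - `|gsf (G a) m v|); nra.
    rewrite ger0_norm ?divr_ge0 ?ler0n //; apply: le_trans h0n.
    by case: (_ && _); rewrite ?mul1r // mul0r invr_ge0 ltW.
  - by rewrite /lam divr_gt0 // !mulr_gt0 // exprn_gt0.
  - rewrite lamB ler_pdivrMr ?mulr_gt0 //.
    have : 1 <= n * h0 * K by rewrite -[leLHS]mulr1 ler_pM.
    lra.
  - rewrite ler_expR -/s le_eqVlt; apply/orP; left; apply/eqP.
    by rewrite /lam /tau; field; rewrite !gt_eqF.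
have E0 : 0 <= E by exact: expR_ge0.
rewrite avg_sum; apply: (@le_trans _ _ (\sum_(a : V) (2 * K ^+ 2 * E))); last first.
  by rewrite sumr_const -[leLHS]mulr_natr -/n le_eqVlt; apply/orP; left; apply/eqP; ring.
apply: ler_sum => a _; rewrite avg_sum.
apply: (@le_trans _ _ (\sum_l \sum_m 2 * ((gsb (G a) l)%:R * (gsb (G a) m)%:R) * E)).
  apply: ler_sum => l _; rewrite avg_sum; apply: ler_sum => m _; rewrite avg_sum.
  rewrite /P; case bl : (gsb (G a) l); case bm : (gsb (G a) m) => /=.
  - rewrite !mulr1; have -> : 2 * E =
    \sum_(sg : bool) E by rewrite sumr_const card_bool mulr_natl.
    by apply: ler_sum => sg _; rewrite avgZ mul1r; exact: key.
  - by rewrite !(mulr0, mul0r) big1 // => sg _; rewrite avgZ mul0r.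
  - by rewrite !(mulr0, mul0r) big1 // => sg _; rewrite avgZ mul0r.
  - by rewrite !(mulr0, mul0r) big1 // => sg _; rewrite avgZ mul0r.
have -> : \sum_l \sum_m 2 * ((gsb (G a) l)%:R * (gsb (G a) m)%:R) * E =
  2 * (\sum_l gsb (G a) l)%:R ^+ 2 * E.
  rewrite natr_sum expr2 mulr_suml mulr_sumr mulr_suml; apply: eq_bigr => l _.
  by rewrite !mulr_sumr mulr_suml; apply: eq_bigr => m _.
rewrite ler_wpM2r // ler_pM2l // lerXn2r ?nnegrE ?ler0n ?gsb_card // ltW //.
Qed.

End Sample.
End Regularity.

(** * Restriction to samples: interpolation and exchangeability *)

Lemma proj_reindex2 (R : realType) (T T' I I' : finType) (g : I -> T -> R)
    (g' : I' -> T' -> R) (h : T' -> T) (k : I' -> I) y :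
  bijective h -> bijective k -> (forall i, g' i = g (k i) \o h) ->
  proj g' (y \o h) = proj g y \o h.
Proof.
move=> hb kb E; apply: proj_uniq => [|i].
  have [c ->] := proj_in g y; exists (c \o k); apply: funext => t.
  rewrite /comb /= (reindex k) /=; last exact: onW_bij.
  by apply: eq_bigr => i _; rewrite E.
rewrite E -(proj_res g y (k i)) /dot [RHS](reindex h) //; exact: onW_bij.
Qed.

Section JoinedFamily.
Variables (R : realType) (T I1 I2 : finType) (g1 : I1 -> T -> R) (g2 : I2 -> T -> R).

Definition sumf (i : I1 + I2) : T -> R := match i with inl i => g1 i | inr i => g2 i end.

(** Gives a form of the joint projection that can be relabelled: [joinf] is built on Gram-Schmidt
    bases, which depend on the enumeration of the indices, while the raw families do not. *)
Lemma jprojE : jproj g1 g2 = proj sumf.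
Proof.
have c1 (f : I1 -> T -> R) (f2 : I2 -> T -> R) c :
   comb f c = comb (fun i => match i with inl i => f i | inr i => f2 i end)
     (fun i => match i with inl i => c i | inr _ => 0 end).
  apply: funext => t; rewrite /comb big_sumType /= [X in _ + X]big1 ?addr0 //.
  by move=> i _; rewrite mul0r.
have c2 (f : I1 -> T -> R) (f2 : I2 -> T -> R) c :
   comb f2 c = comb (fun i => match i with inl i => f i | inr i => f2 i end)
     (fun i => match i with inr i => c i | inl _ => 0 end).
  apply: funext => t; rewrite /comb big_sumType /= [X in X + _]big1 ?add0r //.
  by move=> i _; rewrite mul0r.
apply: proj_eq => -[i|i] /=.
- have [_ _ h _] := gsP g1; have [c ->] := h i; rewrite (c1 _ g2); eexists; reflexivity.
- have [_ _ h _] := gsP g2; have [c ->] := h i; rewrite (c2 g1); eexists; reflexivity.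
- rewrite -(proj_fix g1 i) /proj /pr (c1 _ (gsf g2)); eexists; reflexivity.
- rewrite -(proj_fix g2 i) /proj /pr (c2 (gsf g1)); eexists; reflexivity.
Qed.

End JoinedFamily.

Section Samples.
Variables (R : realType) (V J : finType) (G : V -> J -> V -> R) (h0 rho : R).
Hypothesis Gdiag : forall a l, G a l a = 0.
Hypothesis levG : forall a c b, comb (G a) c b ^+ 2 <= h0 * dot (comb (G a) c) (comb (G a) c).
Hypothesis rho0 : 0 < rho.
Hypothesis h00 : 0 < h0.

Definition sample (X : finType) (x : X -> V) (i : X) (l : J) (k : X) := G (x i) l (x k).

Lemma comb_sample (X : finType) (x : X -> V) i c :
  comb (sample x i) c = comb (G (x i)) c \o x.
Proof. by []. Qed.

Lemma sample_lev (X : finType) (x : X -> V) i j : regular G rho x ->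
  lev (sample x) i j <= h0 / rho.
Proof.
move=> reg; apply: lev_le => [|c]; first by rewrite divr_ge0 ?ltW.
rewrite comb_sample; set f := comb _ _.
apply: le_trans (levG _ _ _) _; rewrite -mulrA ler_pM2l // mulrC ler_pdivlMr // mulrC.
by apply: le_trans (reg _ _) _; rewrite /dot; under eq_bigr => i0 _ do rewrite expr2.
Qed.

(** By regularity the restriction to the sample is injective on the row space of [v]; [beta] is the
    extension kernel obtained by lifting an orthonormal basis of the restrictions. The lift has norm
    at most [rho ^ (- 1 / 2)], which gives the last clause for all [u] together. Regularity comes
    after the existential, so that [beta] can be chosen for every block. *)
Lemma interpolation (I : finType) (x : I -> V) v : exists beta : V -> I -> R,
  regular G rho x ->
  [/\ forall c u, \sum_i beta u i * comb (G v) c (x i) = comb (G v) c u,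
   forall u, dot (beta u) (beta u) <= h0 / rho &
   forall (T : finType) (A : T -> I -> R),
     \sum_u \sum_t dot (beta u) (A t) ^+ 2 <= (\sum_t dot (A t) (A t)) / rho].
Proof.
pose g (l : J) (i : I) := G v l (x i).
have combg c : comb g c = comb (G v) c \o x by [].
have [on _ inq _] := gsP g; set q := gsf g in on inq; set b := gsb g in on.
have [cc Hc] := choice inq.
pose gl l := comb (G v) (cc l).
have glx l i : gl l (x i) = q l i by rewrite Hc.
pose beta u i := \sum_l gl l u * q l i.
exists beta => reg.
have lin (a : J -> R) : exists c, (fun u => \sum_l a l * gl l u) = comb (G v) c.
  exists (fun i => \sum_l a l * cc l i); apply: funext => u; rewrite /comb.
  under [RHS]eq_bigr => i _ do rewrite mulr_suml.
  rewrite exchange_big; apply: eq_bigr => l _ /=.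
  by rewrite /gl /comb mulr_sumr; apply: eq_bigr => i _; rewrite mulrA.
have regl (a : J -> R) : rho * dot (fun u => \sum_l a l * gl l u) (fun u => \sum_l a l * gl l u)
    <= dot (comb q a) (comb q a).
  have [c Ec] := lin a; rewrite Ec; apply: le_trans (reg v c) _; rewrite -Ec /dot.
  apply: ler_sum => i _; rewrite expr2 /comb.
  by under eq_bigr => l _ do rewrite glx.
split.
- move=> c u; set F := comb (G v) c.
  pose a l := dot (F \o x) (q l).
  have Fx i : F (x i) = comb q a i.
    exact: (esym (congr1 (fun f => f i) (proj_fix_comb g c))).
  have F0 : F = fun u => \sum_l a l * gl l u.
    have [c' Ec] := lin a.
    have E : (fun u => F u - \sum_l a l * gl l u) = comb (G v) (fun i => c i - c' i).
      have := congr1 (fun f => f _) Ec => Ec'.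
      by apply: funext => w; rewrite Ec' /F /comb -sumrB; apply: eq_bigr => l _; ring.
    have := reg v (fun i => c i - c' i); rewrite -E.
    rewrite [leRHS]big1 => [h|i _]; last first.
      rewrite Fx /comb; under [X in _ - X]eq_bigr => l _ do rewrite glx.
      by rewrite subrr expr0n.
    have d0 : dot (fun u => F u - \sum_l a l * gl l u) (fun u => F u - \sum_l a l * gl l u) = 0.
      by apply/eqP; rewrite eq_le dot_ge0 andbT -(pmulr_rle0 _ rho0).
    apply: funext => w; have := congr1 (fun f => f w) (dot_eq0 d0) => /= /eqP.
    by rewrite subr_eq0 => /eqP.
  rewrite [RHS](congr1 (fun f => f u) F0) /beta.
  under eq_bigr => i _ do rewrite mulr_suml.
  rewrite exchange_big; apply: eq_bigr => l _ /=; rewrite /a /dot mulr_suml.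
  by apply: eq_bigr => i _ /=; ring.
- move=> u; have bE : beta u = comb q (fun l => gl l u) by [].
  set H := fun w => \sum_l gl l u * gl l w.
  have HH : rho * dot H H <= dot (beta u) (beta u) by exact: regl.
  have gl0 l : b l = false -> gl l = fun=> 0.
    move=> bl; have q0 := onz0 on bl.
    have := reg v (cc l); rewrite -/(gl l) [leRHS]big1 => [h|i _]; last by rewrite glx q0 expr0n.
    by apply: dot_eq0; apply/eqP; rewrite eq_le dot_ge0 andbT -(pmulr_rle0 _ rho0).
  have bb : dot (beta u) (beta u) = H u.
    rewrite bE dot_comb /H; apply: eq_bigr => l _; rewrite dotC (dot_comb_onz _ _ on).
    by case bl : (b l); rewrite ?mul1r // (gl0 _ bl) !mul0r.
  have [c Ec] := lin (fun l => gl l u).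
  have := levG v c u; rewrite -Ec -/H => hH.
  have n0 := dot_ge0 (beta u).
  have : dot (beta u) (beta u) * dot (beta u) (beta u) <= h0 / rho * dot (beta u) (beta u).
    rewrite {1 2}bb -expr2; apply: le_trans hH _; rewrite -mulrA ler_pM2l //.
    by rewrite mulrC ler_pdivlMr // mulrC.
  move: n0; rewrite le_eqVlt => /orP[/eqP<- _|n0]; first by rewrite divr_ge0 // ltW.
  by rewrite ler_pM2r.
- move=> T A; rewrite exchange_big mulr_suml; apply: ler_sum => t _ /=.
  pose a l := dot (A t) (q l).
  have -> : \sum_u dot (beta u) (A t) ^+ 2 = dot (fun u => \sum_l a l * gl l u) (fun u =>
    \sum_l a l * gl l u).
    apply: eq_bigr => u _; rewrite expr2.
    have -> // : dot (beta u) (A t) = \sum_l a l * gl l u.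
    rewrite /beta dot_suml; apply: eq_bigr => l _; by rewrite dotZl /a (dotC (A t)) mulrC.
  rewrite ler_pdivlMr // mulrC; apply: le_trans (regl a) _.
  exact: (proj_le g (A t)).
Qed.

Section Exchange.
Variables (X : finType) (sg : X -> X).
Hypothesis sgb : bijective sg.
Let h (t : X * X) := (sg t.1, sg t.2).

Let hb : bijective h.
Proof. by case: sgb => k k1 k2; exists (fun t => (k t.1, k t.2)) => -[a b];
  rewrite /h /= ?k1 ?k2. Qed.

Let kb : bijective (fun il : X * J => (sg il.1, il.2)).
Proof. by case: sgb => k k1 k2; exists (fun t => (k t.1, t.2)) => -[a b]; rewrite /= ?k1 ?k2. Qed.

Lemma rdefect_exch (x : X -> V) y :
  rdefect (sample (x \o sg)) (y \o h) = rdefect (sample x) y \o h.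
Proof.
have r il : rowfam (sample (x \o sg)) il = rowfam (sample x) (sg il.1, il.2) \o h.
  apply: funext => -[j k]; rewrite /rowfam /h /sample /=.
  by rewrite (inj_eq (bij_inj sgb)).
have c il : colfam (sample (x \o sg)) il = colfam (sample x) (sg il.1, il.2) \o h.
  by rewrite /colfam r; apply: funext => -[].
apply: funext => t; rewrite /rdefect /jdefect /= !jprojE.
rewrite (proj_reindex2 y hb kb r) (proj_reindex2 y hb kb c) /=; congr (_ + _ - _).
rewrite (@proj_reindex2 _ _ _ _ _ (sumf (rowfam (sample x)) (colfam (sample x))) _ h
   (fun i => match i with inl il => inl (sg il.1, il.2) | inr il => inr (sg il.1, il.2) end)) //.
  case: kb => k k1 k2; exists (fun i => match i with inl i => inl (k i) | inr i => inr (k i) end);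
  by case=> [i|i]; rewrite ?k1 ?k2.
by case=> i /=.
Qed.

Lemma crossdef_exch (x : X -> V) c :
  crossdef (sample (x \o sg)) c = crossdef (sample x) (sg c).
Proof.
rewrite /crossdef [RHS](reindex sg) /=; last exact: onW_bij.
apply: eq_bigr => a _.
have -> : cross R a c = cross R (sg a) (sg c) \o h.
  apply: funext => -[j k]; rewrite /cross /delta /h /= !xpair_eqE /=.
  by rewrite !(inj_eq (bij_inj sgb)).
rewrite rdefect_exch /dot [RHS](reindex h) //=; exact: onW_bij.
Qed.

Lemma regular_exch (x : X -> V) : regular G rho x -> regular G rho (x \o sg).
Proof.
move=> H a c; have := H a c; rewrite [leRHS](reindex sg) //; exact: onW_bij.
Qed.

End Exchange.

Lemma crossdef_ge0 (X : finType) (x : X -> V) c : 0 <= crossdef (sample x) c.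
Proof. by apply: sumr_ge0 => a _; exact: dot_ge0. Qed.

(** The positions of a uniform sample are exchangeable, so the average defect at one position is the
    total defect divided by the number of positions. *)
Lemma crossdef_avg (X : finType) (c0 : X) :
  avg (fun x : {ffun X -> V} => `[< regular G rho x >]%:R * crossdef (sample x) c0) <=
  8 * (h0 / rho) ^+ 2 * #|X|%:R.
Proof.
pose F c := avg (fun x : {ffun X -> V} => `[< regular G rho x >]%:R * crossdef (sample x) c).
have Fc c : F c = F c0.
  pose sg := tperm c0 c.
  have sgb : bijective sg by exists sg => i; rewrite /sg tpermK.
  pose re (x : {ffun X -> V}) := [ffun i => x (sg i)].
  rewrite /F /avg; congr (_ * _).
  rewrite [RHS](reindex re) /=; last first.
    by exists re => x _; apply/ffunP => i; rewrite !ffunE /sg tpermK.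
  apply: eq_bigr => x _.
  have E : (re x : X -> V) = x \o sg by apply: funext => i; rewrite ffunE.
  rewrite E (crossdef_exch sgb) /sg tpermL; congr (_%:R * _).
  congr nat_of_bool; apply/idP/idP => /asboolP hx; apply/asboolP; first exact: (regular_exch sgb).
  have := regular_exch sgb hx.
  by have -> : (x \o tperm c0 c) \o sg = x by apply: funext => i /=; rewrite tpermK.
have X0 : (0 < #|X|)%N by apply/card_gt0P; exists c0.
have X0' : 0 < #|X|%:R :> R by rewrite ltr0n.
suff : \sum_c F c <= 8 * (h0 / rho) ^+ 2 * #|X|%:R ^+ 2.
  rewrite (eq_bigr (fun=> F c0)) // sumr_const -[leLHS]mulr_natr.
  have -> : 8 * (h0 / rho) ^+ 2 * #|X|%:R ^+ 2 = 8 * (h0 / rho) ^+ 2 * #|X|%:R * #|X|%:R by ring.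
  by rewrite ler_pM2r.
rewrite -avg_sum.
case: (posnP #|V|) => [v0|v0].
  rewrite /avg big1 ?mulr0 => [|x _]; last by have := fintype0 (x c0); rewrite v0 => /(_ erefl).
  by rewrite mulr_ge0 ?sqr_ge0 // mulr_ge0 ?sqr_ge0.
apply: (@le_trans _ _ (avg (fun _ : {ffun X -> V} => 8 * (h0 / rho) ^+ 2 * #|X|%:R ^+ 2))).
  apply: avg_le => x; rewrite -mulr_sumr; case: asboolP => reg; rewrite ?mul0r ?mul1r.
    by apply: sum_crossdef => i j; exact: sample_lev.
  by rewrite mulr_ge0 ?sqr_ge0 // mulr_ge0 ?sqr_ge0.
by rewrite avg_cst // card_ffun expn_gt0 v0.
Qed.

End Samples.

(** * Averages over independent blocks *)

Section IteratedAverages.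
Variable R : realType.

Lemma avg_bij (T T' : finType) (h : T' -> T) (F : T -> R) :
  bijective h -> avg F = avg (F \o h).
Proof.
move=> hb; rewrite /avg (bij_eq_card hb); congr (_ * _).
by rewrite (reindex h) //; exact: onW_bij.
Qed.

Lemma avg_pair (T T' : finType) (F : T -> T' -> R) :
  avg (fun p : T * T' => F p.1 p.2) = avg (fun t => avg (F t)).
Proof.
rewrite /avg -(pair_bigA _ F) /= card_prod natrM invfM -mulrA mulr_sumr.
by [].
Qed.

Lemma avg_exch (T T' : finType) (F : T -> T' -> R) :
  avg (fun t => avg (F t)) = avg (fun t' => avg (fun t => F t t')).
Proof.
by rewrite /avg -!mulr_sumr exchange_big mulrCA.
Qed.

Variables (V : finType).

Lemma avg_option (A : finType) (F : (option A -> V) -> R) :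
  avg (fun x : {ffun option A -> V} => F x) =
  avg (fun v => avg (fun y : {ffun A -> V} => F (fun o => if o is Some a then y a else v))).
Proof.
rewrite -(avg_pair (fun v (y : {ffun A -> V}) => F (fun o => if o is Some a then y a else v))).
pose h (p : V * {ffun A -> V}) : {ffun option A -> V} :=
  [ffun o => if o is Some a then p.2 a else p.1].
rewrite (@avg_bij _ _ h).
  congr avg; apply: funext => p /=; congr F; apply: funext => o; by rewrite ffunE.
exists (fun x : {ffun option A -> V} => (x None, [ffun a => x (Some a)])) => [[v y]|x].
  by congr pair; [rewrite ffunE|apply/ffunP => a; rewrite !ffunE].
by apply/ffunP => -[a|]; rewrite !ffunE.
Qed.

Definition glue (A B : Type) (y : A -> V) (z : B -> V) (i : A + B) : V :=
  match i with inl a => y a | inr b => z b end.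

Lemma avg_glue (A B : finType) (F : (A + B -> V) -> R) :
  avg (fun x : {ffun A + B -> V} => F x) =
  avg (fun y : {ffun A -> V} => avg (fun z : {ffun B -> V} => F (glue y z))).
Proof.
rewrite -(avg_pair (fun (y : {ffun A -> V}) (z : {ffun B -> V}) => F (glue y z))).
pose h (p : {ffun A -> V} * {ffun B -> V}) : {ffun A + B -> V} := [ffun i => glue p.1 p.2 i].
rewrite (@avg_bij _ _ h).
  congr avg; apply: funext => p /=; congr F; apply: funext => o; by rewrite ffunE.
exists (fun x : {ffun A + B -> V} => ([ffun a => x (inl a)], [ffun a => x (inr a)])) => [[y z]|x].
  by congr pair; apply/ffunP => a; rewrite !ffunE.
by apply/ffunP => -[a|a]; rewrite /h ffunE /= ffunE.
Qed.

Lemma avg_prod (A B : finType) (phi : (B -> V) -> R) :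
  avg (fun z : {ffun A * B -> V} => \prod_a phi (fun b => z (a, b))) =
  avg (fun S : {ffun B -> V} => phi S) ^+ #|A|.
Proof.
pose h (p : {ffun A -> {ffun B -> V}}) : {ffun A * B -> V} := [ffun ab => p ab.1 ab.2].
rewrite (@avg_bij _ _ h); last first.
  exists (fun z : {ffun A * B -> V} => [ffun a => [ffun b => z (a, b)]]) => [p|z].
    by apply/ffunP => a; apply/ffunP => b; rewrite !ffunE.
  by apply/ffunP => -[a b]; rewrite !ffunE.
transitivity (avg (fun p : {ffun A -> {ffun B -> V}} => \prod_a phi (p a))).
  congr avg; apply: funext => p /=; apply: eq_bigr => a _; congr phi.
  by apply: funext => b; rewrite ffunE.
rewrite /avg card_ffun -(bigA_distr_bigA (fun (_ : A) (S : {ffun B -> V}) => phi S)) /=.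
by rewrite prodr_const exprMn natrX exprVn.
Qed.

End IteratedAverages.

(** * Good and bad pairs of blocks *)

Section RandomBlocks.
Variables (R : realType) (V J : finType) (G : V -> J -> V -> R) (h0 rho kap : R) (s : nat).
Hypothesis Gdiag : forall a l, G a l a = 0.
Hypothesis levG : forall a c b, comb (G a) c b ^+ 2 <= h0 * dot (comb (G a) c) (comb (G a) c).
Hypothesis rho0 : 0 < rho.
Hypothesis h00 : 0 < h0.
Hypothesis kap0 : 0 < kap.
Hypothesis V0 : (0 < #|V|)%N.
Notation blk := {ffun 'I_s -> V}.
Implicit Types (v u : V) (S : 'I_s -> V).

Definition trip v S S' (o : option ('I_s + 'I_s)) : V :=
  if o is Some i then glue S S' i else v.

Definition tripdef v S S' : R := crossdef (sample G (trip v S S')) None.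
Definition regb S : bool := `[< regular G rho S >].
(** With the defect at most 1/4, the smallness condition of [cross_transport] follows from
    [16 * eta <= 1]. Irregular blocks are not counted as bad here; a separate event excludes
    them. *)
Definition badb v S S' : bool := [&& regb S, regb S' & (1 / 4 < tripdef v S S')%R].
(** Markov at the threshold 1/4: four times the value of [crossdef_avg] for a vertex and two
    blocks. *)
Definition pbound : R := 32 * (h0 / rho) ^+ 2 * (2 * s + 1)%:R.
Definition badprob v S : R := avg (fun S' : blk => (badb v S S')%:R).
Definition badprob2 v : R := avg (fun S : blk => badprob v S).
(** A block after which too large a share of fresh blocks would be bad. Two successive Markov
    inequalities, at [kap ^ 2] for the vertex and at [kap] for the block, make poor blocks rare. *)
Definition poorb v S : bool := (kap < badprob v S)%R.

Lemma trip_regular v S S' : regular G rho S -> regular G rho (trip v S S').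
Proof.
move=> h a c; apply: le_trans (h a c) _.
rewrite (bigD1 None) //= (reindex_omap Some id) /=; last by case.
under [X in _ + X]eq_bigl => o do rewrite eqxx.
rewrite big_sumType /= addrCA lerDl addr_ge0 ?sqr_ge0 //.
by apply: sumr_ge0 => i _; rewrite sqr_ge0.
Qed.

Lemma tripdef_ge0 v S S' : 0 <= tripdef v S S'.
Proof. exact: crossdef_ge0. Qed.

Lemma tripdef_avg :
  avg (fun v => avg (fun S : blk => avg (fun S' : blk => (regb S)%:R * tripdef v S S'))) <=
  pbound / 4.
Proof.
have := @crossdef_avg R V J G h0 rho levG rho0 h00 (option ('I_s + 'I_s)) None.
rewrite card_option card_sum card_ord.
have -> : 8 * (h0 / rho) ^+ 2 * (s + s).+1%:R = pbound / 4.
  by rewrite /pbound addnn -mul2n addn1; field; rewrite gt_eqF.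
rewrite (avg_option (fun x => `[< regular G rho x >]%:R * crossdef (sample G x) None)).
apply: le_trans; apply: avg_le => v.
rewrite (avg_glue (fun y => `[< regular G rho (fun o => if o is Some a then y a else v) >]%:R *
   crossdef (sample G (fun o => if o is Some a then y a else v)) None)).
apply: avg_le => S; apply: avg_le => S'.
rewrite -/(trip v S S'); rewrite ler_wpM2r ?crossdef_ge0 // ler_nat /regb.
case: asboolP => // h; case: asboolP => //; move=> [].
exact: trip_regular.
Qed.

Lemma badb_le v S S' : (badb v S S')%:R <= 4 * ((regb S)%:R * tripdef v S S').
Proof.
have := tripdef_ge0 v S S'; rewrite /badb; case: (regb S); case: (regb S') => /=;
rewrite ?mul0r ?mul1r ?mulr0 // => t0; try lra.
by case: ltP => h /=; lra.
Qed.

Lemma badprob_ge0 v S : 0 <= badprob v S.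
Proof. by apply: avg_ge0 => S'; rewrite ler0n. Qed.

Lemma badprob2_ge0 v : 0 <= badprob2 v.
Proof. by apply: avg_ge0 => S'; exact: badprob_ge0. Qed.

Lemma badprob2_avg : avg badprob2 <= pbound.
Proof.
have -> : pbound = 4 * (pbound / 4) by field.
apply: (le_trans _ (ler_wpM2l _ tripdef_avg)) => //.
rewrite -avgZ; apply: avg_le => v; rewrite -avgZ; apply: avg_le => S.
rewrite -avgZ; apply: avg_le => S'; exact: badb_le.
Qed.

Lemma poor_vertex_avg : avg (fun v => (kap ^+ 2 < badprob2 v)%R%:R) <= pbound / kap ^+ 2.
Proof.
apply: le_trans (markov_avg _ badprob2_ge0) _; first by rewrite exprn_gt0.
by rewrite ler_wpM2r ?invr_ge0 ?sqr_ge0 // badprob2_avg.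
Qed.

Definition richv v : bool := (badprob2 v <= kap ^+ 2)%R.

Lemma poor_block_avg v : richv v -> avg (fun S : blk => (poorb v S)%:R) <= kap.
Proof.
move=> rv; apply: le_trans (markov_avg kap0 _) _ => [S|]; first exact: badprob_ge0.
by rewrite ler_pdivrMr // -expr2.
Qed.

(** The [r] candidates are independent, and each is bad after [S] or itself poor with probability at
    most [kap + kap]. The choice turns this rate into a power small enough for a union over all
    levels. *)
Lemma dead_end_avg v S r : richv v -> ~~ poorb v S ->
  avg (fun z : {ffun 'I_r * 'I_s -> V} =>
    \prod_i (badb v S (fun k => z (i, k)) || poorb v (fun k => z (i, k)))%:R) <= (2 * kap) ^+ r.
Proof.
move=> rv ps.
rewrite (@avg_prod R V 'I_r 'I_s (fun S' => (badb v S S' || poorb v S')%:R)) card_ord.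
apply: lerXn2r; rewrite ?nnegrE.
- by apply: avg_ge0 => S'; rewrite ler0n.
- by rewrite mulr_ge0 // ltW.
apply: (@le_trans _ _ (avg (fun S' : blk => (badb v S S')%:R + (poorb v S')%:R))).
  by apply: avg_le => S'; rewrite -natrD ler_nat; case: (badb _ _ _); case: (poorb _ _).
rewrite avgD mulr_natl mulr2n lerD ?poor_block_avg //.
by move: ps; rewrite /poorb -leNgt.
Qed.

Definition interp S v : V -> 'I_s -> R :=
  projT1 (cid (interpolation levG rho0 h00 S v)).

Lemma interpP S v : regular G rho S ->
  [/\ forall c u, \sum_i interp S v u i * comb (G v) c (S i) = comb (G v) c u,
   forall u, dot (interp S v u) (interp S v u) <= h0 / rho &
   forall (T : finType) (A : T -> 'I_s -> R),
     \sum_u \sum_t dot (interp S v u) (A t) ^+ 2 <= (\sum_t dot (A t) (A t)) / rho].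
Proof. exact: (projT2 (cid (interpolation levG rho0 h00 S v))). Qed.

Definition hatdef v S S' (y : 'I_s + 'I_s -> R) : R :=
  dot (rdefect (sample G (trip v S S')) (hat y)) (rdefect (sample G (trip v S S')) (hat y)).

Lemma rdefect_hatE (U : finType) (H : option U -> J -> option U -> R) (y : U -> R) :
  rdefect H (hat y) = fun t => \sum_a y a * rdefect H (cross R (Some a) None) t.
Proof.
rewrite hatE; apply: funext => t.
rewrite /rdefect /jdefect /jproj /proj /pr /comb.
under eq_bigr => i _ do rewrite dot_suml mulr_suml.
rewrite exchange_big /=.
under [X in _ + X - _]eq_bigr => i _ do rewrite dot_suml mulr_suml.
rewrite [X in _ + X - _]exchange_big /=.
under [X in _ + _ - X]eq_bigr => i _ do rewrite dot_suml mulr_suml.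
rewrite [X in _ + _ - X]exchange_big /= -big_split -sumrB; apply: eq_bigr => a _ /=.
rewrite mulrBr mulrDr !mulr_sumr; congr (_ + _ - _); apply: eq_bigr => i _;
  by rewrite dotZl mulrA.
Qed.

(** Both blocks interpolate the same value at [u], so with opposite signs the test annihilates the
    row space of [v]. *)
Definition step v S S' u (i : 'I_s + 'I_s) : R :=
  match i with inl k => interp S v u k | inr k => - interp S' v u k end.

(** The average over [u] makes a step cheap: the last clause of [interpolation] bounds the sum over
    all [u] by the defect divided by [rho], so one typical [u] gains the factor
    [1 / (rho * #|V|)]. *)
Lemma step_avg v S S' : regular G rho S -> regular G rho S' ->
  avg (fun u => hatdef v S S' (step v S S' u)) <= 4 / (rho * #|V|%:R) * tripdef v S S'.
Proof.
move=> rS rS'; set H := sample G (trip v S S').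
pose Z k t := rdefect H (cross R (Some k) None) t.
have [_ _ c1] := interpP v rS; have [_ _ c2] := interpP v rS'.
have n0 : 0 < #|V|%:R :> R by rewrite ltr0n.
pose A1 t k := Z (inl k) t; pose A2 t k := Z (inr k) t.
have hE u : hatdef v S S' (step v S S' u) <=
   2 * (\sum_t dot (interp S v u) (A1 t) ^+ 2 + \sum_t dot (interp S' v u) (A2 t) ^+ 2).
  rewrite /hatdef rdefect_hatE /dot -big_split mulr_sumr; apply: ler_sum => t _ /=.
  rewrite big_sumType /= -expr2.
  have -> : \sum_i - interp S' v u i * rdefect (sample G (trip v S S')) (cross R (Some (inr i))
    None) t
    = - dot (interp S' v u) (A2 t).
    by rewrite /dot -sumrN; apply: eq_bigr => k _; rewrite mulNr.
  rewrite -/(dot (interp S v u) (A1 t)) -/(dot (interp S' v u) (A2 t)).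
  set x := dot _ _; set y := dot _ _; have := sqr_ge0 (x + y); nra.
have sumA : \sum_t dot (A1 t) (A1 t) + \sum_t dot (A2 t) (A2 t) <= tripdef v S S'.
  rewrite /tripdef /crossdef (bigD1 None) //= (reindex_omap Some id) /=; last by case.
  under [X in _ <= _ + X]eq_bigl => o do rewrite eqxx.
  rewrite big_sumType /= -[leLHS]add0r lerD ?dot_ge0 //.
  by rewrite /dot exchange_big /= [X in _ + X <= _]exchange_big.
apply: (@le_trans _ _ (avg (fun u =>
  2 * (\sum_t dot (interp S v u) (A1 t) ^+ 2 + \sum_t dot (interp S' v u) (A2 t) ^+ 2)))).
  exact: avg_le.
rewrite avgZ avgD.
have b1 : avg (fun u => \sum_t dot (interp S v u) (A1 t) ^+ 2) <=
  (\sum_t dot (A1 t) (A1 t)) / (rho * #|V|%:R).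
  by rewrite /avg mulrC ler_pdivrMr // invfM mulrA divfK ?gt_eqF //; exact: c1.
have b2 : avg (fun u => \sum_t dot (interp S' v u) (A2 t) ^+ 2) <=
  (\sum_t dot (A2 t) (A2 t)) / (rho * #|V|%:R).
  by rewrite /avg mulrC ler_pdivrMr // invfM mulrA divfK ?gt_eqF //; exact: c2.
have q0 : 0 < (rho * #|V|%:R)^-1 by rewrite invr_gt0 mulr_gt0.
apply: (@le_trans _ _ (2 * (tripdef v S S' / (rho * #|V|%:R)))).
  rewrite ler_pM2l //; apply: le_trans (lerD b1 b2) _.
  by rewrite -mulrDl ler_pM2r.
have := mulr_ge0 (tripdef_ge0 v S S') (ltW q0).
by move: (tripdef v S S') ((rho * #|V|%:R)^-1) => T q; nra.
Qed.

Lemma cost_avg :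
  avg (fun u => avg (fun v => avg (fun S : blk => avg (fun S' : blk =>
    (regb S && regb S')%:R * hatdef v S S' (step v S S' u))))) <=
  pbound / (rho * #|V|%:R).
Proof.
rewrite avg_exch.
have n0 : 0 < rho * #|V|%:R by rewrite mulr_gt0 // ltr0n.
have -> : pbound / (rho * #|V|%:R) = 4 / (rho * #|V|%:R) * (pbound / 4).
  by field; rewrite !gt_eqF // ltr0n.
apply: (le_trans _ (ler_wpM2l _ tripdef_avg)); last by rewrite divr_ge0 // ltW.
rewrite -avgZ; apply: avg_le => v.
rewrite avg_exch -avgZ; apply: avg_le => S.
rewrite avg_exch -avgZ; apply: avg_le => S'.
rewrite avgZ /regb; case: asboolP => rS /=; rewrite ?mul0r ?mulr0 ?mul1r //.
case: asboolP => rS'; rewrite ?mul0r ?mul1r; first exact: step_avg.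
by rewrite mulr_ge0 ?tripdef_ge0 // divr_ge0 // ltW.
Qed.

End RandomBlocks.

(** * Telescoping along a chain of good blocks *)

Lemma sum_sqr_le (R : realType) (I : finType) (a p q : I -> R) :
  (forall i, 0 <= p i) -> (forall i, 0 <= q i) -> (forall i, a i ^+ 2 <= p i * q i) ->
  (\sum_i a i) ^+ 2 <= (\sum_i p i) * (\sum_i q i).
Proof.
move=> p0 q0 h.
have ai i : `|a i| <= Num.sqrt (p i) * Num.sqrt (q i).
  by rewrite -sqrtrM // -[leLHS]sqrtr_sqr ?normr_ge0 // ler_sqrt ?mulr_ge0 // real_normK
    ?num_real.
apply: (@le_trans _ _ ((\sum_i Num.sqrt (p i) * Num.sqrt (q i)) ^+ 2)).
  rewrite -[leLHS]real_normK ?num_real //; apply: lerXn2r; rewrite ?nnegrE ?normr_ge0 //.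
    by apply: sumr_ge0 => i _; rewrite mulr_ge0 ?sqrtr_ge0.
  by apply: le_trans (ler_norm_sum _ _ _) _; apply: ler_sum => i _.
apply: le_trans (dot_sqr_le (fun i => Num.sqrt (p i)) (fun i => Num.sqrt (q i))) _.
have dE f : (forall i, 0 <= f i) -> dot (fun i => Num.sqrt (f i)) (fun i : I => Num.sqrt (f i)) =
  \sum_i f i.
  by move=> f0; apply: eq_bigr => i _; rewrite -expr2 sqr_sqrtr.
by rewrite !dE.
Qed.

Section Chain.
Variables (R : realType) (V J : finType) (G : V -> J -> V -> R) (h0 rho : R) (s : nat).
Hypothesis Gdiag : forall a l, G a l a = 0.
Hypothesis levG : forall a c b, comb (G a) c b ^+ 2 <= h0 * dot (comb (G a) c) (comb (G a) c).
Hypothesis rho0 : 0 < rho.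
Hypothesis h00 : 0 < h0.
Variable eta : R.
Hypothesis etaE : eta = h0 / rho.
Hypothesis eta_small : 16 * eta <= 1.
Variables (u v : V) (S : nat -> 'I_s -> V) (L : nat) (k0 : 'I_s).
Hypothesis uE : S 0 k0 = u.
Hypothesis L1 : (0 < L)%N.
Hypothesis reg : forall j, (j <= L)%N -> regular G rho (S j).
Hypothesis good : forall j, (j < L)%N -> tripdef G v (S j) (S j.+1) <= 1 / 4.
Variable c : V -> J -> R.

Let F a b := comb (G a) (c a) b.
Let D a := F a v + F v a.
Let interp' S := @interp R V J G h0 rho s levG rho0 h00 S v u.

(** Weights on block [j] that reproduce the value at [u]. Block 0 contains [u], so a point mass
    serves there. *)
Definition wt j : 'I_s -> R := if j is 0%N then delta R k0 else interp' (S j).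
Definition yv j (i : 'I_s + 'I_s) : R :=
  match i with inl k => wt j k | inr k => - wt j.+1 k end.
(** The value on the slot [uv] as represented on level [j]: it is [D u] for [j = 0], and for [j = L]
    it involves only edges of the layered graph, since [v] is adjacent to level [L]. *)
Definition Lam j := \sum_k wt j k * D (S j k).
Definition EU j := \sum_(a : 'I_s + 'I_s) \sum_(b : 'I_s + 'I_s)
  (F (glue (S j) (S j.+1) a) (glue (S j) (S j.+1) b) +
   F (glue (S j) (S j.+1) b) (glue (S j) (S j.+1) a)) ^+ 2.

Let eta0 : 0 <= eta. Proof. by rewrite etaE divr_ge0 // ltW. Qed.

Lemma wt_eval j c' : (j <= L)%N ->
  \sum_k wt j k * comb (G v) c' (S j k) = comb (G v) c' u.
Proof.
case: j => [|j] jL; first by rewrite /= -[LHS]/(dot (delta R k0) (fun k =>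
  comb (G v) c' (S 0 k))) dot_deltal uE.
by have [h _ _] := interpP levG rho0 h00 v (reg jL); exact: h.
Qed.

Lemma wt_norm j : (0 < j <= L)%N -> dot (wt j) (wt j) <= eta.
Proof.
case: j => // j jL; rewrite etaE; have [_ h _] := interpP levG rho0 h00 v (reg jL); exact: h.
Qed.

Lemma yv_norm j : dot (yv j) (yv j) = dot (wt j) (wt j) + dot (wt j.+1) (wt j.+1).
Proof.
rewrite /dot big_sumType /=; congr (_ + _).
by apply: eq_bigr => k _; rewrite mulrNN.
Qed.

Lemma yv_eval j c' : (j < L)%N ->
  \sum_i yv j i * comb (G v) c' (glue (S j) (S j.+1) i) = 0.
Proof.
move=> jL.
transitivity (\sum_k wt j k * comb (G v) c' (S j k) - \sum_k wt j.+1 k * comb (G v) c' (S j.+1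
  k)).
  rewrite big_sumType -sumrN; congr (_ + _); apply: eq_bigr => k _; exact: mulNr.
by rewrite !wt_eval ?subrr // ltnW.
Qed.

(** The test [yv j] annihilates the row of [v], so only the values [F a v] remain in the difference,
    and [cross_transport] applies to [v] with the two blocks. *)
Lemma Lam_step j : (j < L)%N -> (Lam j - Lam j.+1) ^+ 2 <=
  (8 * eta * dot (yv j) (yv j) + 2 * hatdef G v (S j) (S j.+1) (yv j)) * EU j.
Proof.
move=> jL; set x := trip v (S j) (S j.+1).
have rx : regular G rho x by apply: trip_regular; apply: reg; exact: ltnW.
have lv i k : lev (sample G x) i k <= eta by rewrite etaE; exact: sample_lev.
have gd i l : sample G x i l i = 0 by exact: Gdiag.
have vo : vorth (sample G x) (yv j).
  move=> l; rewrite -[RHS](yv_eval (delta R l) jL); apply: eq_bigr => i _; congr (_ * _).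
  by rewrite -[RHS]/(dot (delta R l) (fun l => G v l (glue (S j) (S j.+1) i))) dot_deltal.
have sm : 8 * eta + 2 * crossdef (sample G x) None <= 1.
  by have gj := good jL; have es := eta_small; rewrite /tripdef -/x in gj; lra.
have := cross_transport gd lv (fun i => c (x i)) vo sm.
have -> : \sum_a yv j a * comb (sample G x (Some a)) (c (x (Some a))) None = Lam j - Lam j.+1.
  have -> : Lam j - Lam j.+1 = \sum_i yv j i * D (glue (S j) (S j.+1) i).
    rewrite /Lam big_sumType /=; congr (_ + _).
    by rewrite -sumrN; apply: eq_bigr => k _; rewrite mulNr.
  under [RHS]eq_bigr => i _ do rewrite mulrDr.
  by rewrite big_split /= yv_eval // addr0.
move=> /le_trans; apply; rewrite ler_wpM2r //.
  by apply: sumr_ge0 => a _; apply: sumr_ge0 => b _; rewrite sqr_ge0.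
exact: rproj_hat.
Qed.

(** [D u] is the telescoping sum of the steps plus the last representation; Cauchy-Schwarz over all
    these terms lets costs and energies add up separately. *)
Lemma chain_bound :
  D u ^+ 2 <= (\sum_(j < L) (8 * eta * dot (yv j) (yv j) + 2 * hatdef G v (S j) (S j.+1) (yv j))
    + eta) *
   (\sum_(j < L) EU j + \sum_k D (S L k) ^+ 2).
Proof.
have Du : D u = \sum_(o : option 'I_L) if o is Some j then Lam j - Lam j.+1 else Lam L.
  rewrite (bigD1 None) //= (reindex_omap Some id) /=; last by case.
  under [X in _ + X]eq_bigl => o do rewrite eqxx.
  rewrite -(big_mkord xpredT (fun j => Lam j - Lam j.+1)).
  under [X in _ + X]eq_bigr => j _ do rewrite -opprB.
  rewrite sumrN telescope_sumr // opprB addrC subrK /Lam /=.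
  by rewrite -[RHS]/(dot (delta R k0) (fun k => D (S 0 k))) dot_deltal uE.
have so (f : option 'I_L -> R) : \sum_o f o = \sum_(j < L) f (Some j) + f None.
  rewrite (bigD1 None) //= (reindex_omap Some id) /=; last by case.
  by under eq_bigl => o do rewrite eqxx; rewrite addrC.
rewrite Du.
apply: le_trans (@sum_sqr_le _ _ _
  (fun o : option 'I_L => if o is Some j then 8 * eta * dot (yv j) (yv j) + 2 * hatdef G v (S j)
    (S j.+1) (yv j) else eta)
  (fun o : option 'I_L => if o is Some j then EU j else \sum_k D (S L k) ^+ 2) _ _ _) _.
- by case=> [j|//]; rewrite addr_ge0 // mulr_ge0 ?dot_ge0 // mulr_ge0.
- by case=> [j|]; do 2? (apply: sumr_ge0 => ? _); rewrite ?sqr_ge0.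
- case=> [j|]; first exact: Lam_step.
  apply: le_trans (dot_sqr_le (wt L) (fun k => D (S L k))) _.
  rewrite ler_pM ?dot_ge0 //; first by apply: wt_norm; rewrite L1 leqnn.
- by rewrite !so.
Qed.

(** The first step is charged separately: its point mass has norm 1 rather than about [eta], so it
    pays the whole defect [tau2]. The other steps contribute [8 eta * 2 eta] each, whence
    [16 * eta ^+ 2 * L%:R]; the term [17 * eta] covers the rest of the first step and the final
    one. *)
Lemma chain_bound' tau1 tau2 :
  (\sum_(j < L | (0 < j)%N) hatdef G v (S j) (S j.+1)
     (@step R V J G h0 rho s levG rho0 h00 v (S j) (S j.+1) u) <= tau1) ->
  tripdef G v (S 0) (S 1) <= tau2 ->
  D u ^+ 2 <= (17 * eta + 16 * eta ^+ 2 * L%:R + 2 * tau1 + 4 * tau2) *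
   (\sum_(j < L) EU j + \sum_k D (S L k) ^+ 2).
Proof.
move=> h1 h2; apply: le_trans chain_bound _; apply: ler_wpM2r.
  by rewrite addr_ge0 ?sumr_ge0 // => ? _; do 2? (apply: sumr_ge0 => ? _); rewrite ?sqr_ge0.
have w0 : dot (wt 0) (wt 0) = 1 by rewrite dot_deltal /wt /delta eqxx.
have e1 : eta <= 1 / 16 by have es := eta_small; lra.
have y0 : dot (yv 0) (yv 0) <= 1 + eta.
  by rewrite yv_norm w0 lerD2l wt_norm // L1.
have hd0 : hatdef G v (S 0) (S 1) (yv 0) <= 2 * tau2.
  apply: le_trans (rdefect_hat _ _) _; rewrite -/(tripdef G v (S 0) (S 1)).
  have t0 := tripdef_ge0 G v (S 0) (S 1); have d0 := dot_ge0 (yv 0).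
  by nra.
have -> : \sum_(j < L) (8 * eta * dot (yv j) (yv j) + 2 * hatdef G v (S j) (S j.+1) (yv j)) =
  (8 * eta * dot (yv 0) (yv 0) + 2 * hatdef G v (S 0) (S 1) (yv 0)) +
  \sum_(j < L | (0 < j)%N) (8 * eta * dot (yv j) (yv j) + 2 * hatdef G v (S j) (S j.+1) (yv j)).
  rewrite (bigD1 (Ordinal L1)) //=; congr (_ + _); apply: eq_bigl => j.
  by rewrite -val_eqE /= lt0n.
have h3 : \sum_(j < L | (0 < j)%N) (8 * eta * dot (yv j) (yv j) + 2 * hatdef G v (S j) (S j.+1)
  (yv j)) <=
    16 * eta ^+ 2 * L%:R + 2 * tau1.
  rewrite big_split /=; apply: lerD.
    apply: (@le_trans _ _ (\sum_(j < L) 16 * eta ^+ 2)); last first.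
      by rewrite sumr_const card_ord -[leLHS]mulr_natr.
    rewrite big_mkcond; apply: ler_sum => j _; case: ifP => j0; last by rewrite mulr_ge0 ?sqr_ge0.
    have : dot (yv j) (yv j) <= 2 * eta.
      by rewrite yv_norm mulr_natl mulr2n lerD // wt_norm // ?j0 ?ltn_ord // ltnW.
    by move=> y2; have e0 := eta0; nra.
  rewrite -mulr_sumr ler_pM2l //; apply: le_trans h1; rewrite le_eqVlt; apply/orP; left;
    apply/eqP.
  apply: eq_bigr => j j0; congr hatdef; apply: funext => -[k|k] //=.
  by case: (nat_of_ord j) j0.
move: h3 y0 hd0; set A := \sum_(j < L | _) _; have := eta0.
move: (dot (yv 0) (yv 0)) (hatdef _ _ _ _ _) => a b; nra.
Qed.

End Chain.

(** * The layered graph and its energy *)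

Lemma sum_inj_le (R : realType) (A T : finType) (h : A -> T) (P : pred T) (f : T -> R) :
  injective h -> (forall a, P (h a)) -> (forall p, 0 <= f p) ->
  \sum_a f (h a) <= \sum_(p | P p) f p.
Proof.
move=> hi hP f0.
have -> : \sum_a f (h a) = \sum_(p in h @: A) f p.
  rewrite big_imset /=; last by move=> a b _ _; exact: hi.
  by apply: eq_bigl.
rewrite big_mkcond [leRHS]big_mkcond; apply: ler_sum => p _.
case: ifP => [/imsetP[a _ ->]|_]; first by rewrite hP.
by case: ifP.
Qed.

Lemma term_le_sum (R : realType) (I : finType) (f : I -> R) i :
  (forall i, 0 <= f i) -> f i <= \sum_i f i.
Proof. by move=> f0; rewrite (bigD1 i) //= lerDl sumr_ge0. Qed.

(** Positions of the layered graph: level, block, place in the block. The extra position [None] is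
    [v], alone on level [L.+1]. *)
Definition slot L r s := option ('I_L.+1 * 'I_r.+1 * 'I_s.+1).

Definition slev L r s (p : slot L r s) : nat := if p is Some (j, _, _) then j else L.+1.

Definition close L r s (p q : slot L r s) : bool :=
  (slev p <= (slev q).+1)%N && (slev q <= (slev p).+1)%N.

Definition uslot L r s : slot L r s := Some (ord0, ord0, ord0).

Section Energy.
Variables (R : realType) (L r s : nat) (rt : nat -> 'I_r.+1).
Notation slot := (slot L r s).
Variable e : slot -> slot -> R.
Hypothesis e0 : forall p q, 0 <= e p q.

Definition rslot j (i : 'I_s.+1 + 'I_s.+1) : slot :=
  match i with inl k => Some (inord j, rt j, k) | inr k => Some (inord j.+1, rt j.+1, k) end.

Lemma rslot_inj j : (j < L)%N -> injective (rslot j).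
Proof.
move=> jL.
have ne : (inord j : 'I_L.+1) <> inord j.+1.
  by move=> /(congr1 (fun i : 'I_L.+1 => i : nat)); rewrite !inordK ?ltnS // 1?ltnW // => /eqP;
    rewrite ltn_eqF.
by move=> [k|k] [k'|k'] //= [] => [->|/ne|/esym/ne|->].
Qed.

(** A level lies in at most two of the windows [{j, j.+1}], so an ordered pair is counted at most
    twice along the route; pairs ending in [v] occur only in the last term. *)
Lemma route_energy :
  \sum_(j < L) \sum_a \sum_b e (rslot j a) (rslot j b) +
  \sum_k e (Some (inord L, rt L, k)) None <= 2 * \sum_p \sum_(q | close p q) e p q.
Proof.
pose P (j : nat) (p : slot) := (slev p == j) || (slev p == j.+1).
have PP j i : (j < L)%N -> P j (rslot j i).
  by move=> jL; case: i => k; rewrite /P /= inordK ?eqxx ?orbT // ltnS // ltnW.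
have h1 (j : 'I_L) : \sum_a \sum_b e (rslot j a) (rslot j b) <=
    \sum_p \sum_q (P j p && P j q)%:R * e p q.
  apply: (@le_trans _ _ (\sum_a \sum_(q | P j q) e (rslot j a) q)).
    apply: ler_sum => a _; apply: (@sum_inj_le _ _ _ _ _ (e (rslot j a))) => //.
    + exact: rslot_inj.
    + by move=> b; exact: PP.
  apply: le_trans (@sum_inj_le _ _ _ (rslot j) (P j) (fun p => \sum_(q | P j q) e p q) _ _ _) _.
  - exact: rslot_inj.
  - by move=> b; exact: PP.
  - by move=> p; exact: sumr_ge0.
  rewrite big_mkcond; apply: ler_sum => p _; case: ifP => _.
    by rewrite big_mkcond; apply: ler_sum => q _; case: ifP; rewrite ?mul1r ?mul0r.
  by apply: sumr_ge0 => q _; rewrite mul0r.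
have h2 : \sum_k e (Some (inord L, rt L, k)) None <=
    \sum_p \sum_q ((slev p == L) && (q == None))%:R * e p q.
  apply: (@le_trans _ _ (\sum_(p | slev p == L) e p None)).
    apply: (@sum_inj_le _ _ _ (fun k => Some (inord L, rt L, k)) _ (fun p => e p None)) => //.
    + by move=> k k' [].
    + by move=> k /=; rewrite inordK.
  rewrite big_mkcond; apply: ler_sum => p _; rewrite (bigD1 None) //= eqxx andbT.
  rewrite -[leLHS]addr0; apply: lerD; first by case: ifP; rewrite ?mul1r ?mul0r.
  by apply: sumr_ge0 => q _; rewrite mulr_ge0.
apply: (@le_trans _ _ (\sum_p \sum_q ((\sum_(j < L) (P j p && P j q)) + ((slev p == L) && (q ==
  None)))%:R * e p q)).
  apply: (@le_trans _ _ (\sum_p \sum_q \sum_(j < L) (P j p && P j q)%:R * e p q + \sum_p \sum_q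
    ((slev p == L) && (q == None))%:R * e p q)).
    apply: lerD h2; rewrite (eq_bigr (fun p =>
      \sum_(j < L) \sum_q (P j p && P j q)%:R * e p q)) => [|p _]; last by rewrite exchange_big.
    by rewrite [leRHS]exchange_big /=; apply: ler_sum => j _; exact: h1.
  rewrite -big_split; apply: ler_sum => p _; rewrite -big_split; apply: ler_sum => q _ /=.
  by rewrite natrD mulrDl natr_sum mulr_suml.
rewrite mulr_sumr; apply: ler_sum => p _; rewrite mulr_sumr [leRHS]big_mkcond; apply: ler_sum =>
  q _.
have cnt l : (\sum_(j < L) ((l == j :> nat) || (l == j.+1)) <= 2)%N.
  apply: (@leq_trans (\sum_(j < L) (l == j :> nat) + \sum_(j < L) (l == j.+1))).
    by rewrite -big_split; apply: leq_sum => j _ /=; case: (_ == _); case: (_ == _).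
  have one (f : nat -> nat) : injective f -> (\sum_(j < L) (l == f j) <= 1)%N.
    move=> fi; have [j0 /eqP lj|nj] := pickP (fun j : 'I_L => l == f j).
      rewrite (bigD1 j0) //= big1 ?addn0 ?leq_b1 // => j jj.
      by apply/eqP; rewrite eqb0 lj (inj_eq fi) eq_sym (inj_eq val_inj).
    by rewrite big1 // => j _; rewrite nj.
  exact: (leq_add (one id (fun _ _ => id)) (one succn succn_inj)).
have -> : (if close p q then 2 * e p q else 0) = (2 * close p q)%:R * e p q.
  by case: ifP => _; rewrite ?muln0 ?mul0r // muln1.
rewrite ler_wpM2r // ler_nat.
case: q => [q|]; last first.
  rewrite eqxx andbT big1 => [|j _]; last first.
    have -> : P j None = false by rewrite /P /= eqSS !gtn_eqF ?ltnS ?(ltnW (ltn_ord j)).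
    by rewrite andbF.
  rewrite add0n; case: eqP => // pL.
  have -> : close p None by rewrite /close /= pL leqnn (leq_trans (leqnSn L) (leqnSn _)).
  by [].
rewrite andbF addn0.
have [cl|ncl] := boolP (close p (Some q)).
  rewrite muln1; apply: leq_trans (cnt (slev p)); apply: leq_sum => j _.
  by rewrite /P; case: (_ || _) => //=; exact: leq_b1.
rewrite big1 // => j _; apply/eqP; rewrite eqb0; apply: contraNN ncl.
rewrite /P /close => /andP[/orP[]/eqP-> /orP[]/eqP->];
  rewrite ?leqnn ?leqnSn ?(leq_trans (leqnSn j) (leqnSn _)) //.
Qed.

End Energy.

Lemma sum2_const (R : realType) a b (x : R) : \sum_(j < a) \sum_(i < b) x = a%:R * b%:R * x.
Proof.
have e k (y : R) : \sum_(j < k) y = k%:R * y by rewrite sumr_const card_ord -[LHS]mulr_natl.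
by rewrite e e mulrA.
Qed.

(** * Random placement of the layered graph *)

Section Placement.
Variables (R : realType) (V J : finType) (G : V -> J -> V -> R) (h0 rho kap tau1 tau2 : R).
Variables (L r s : nat) (pg : V -> V -> bool).
Hypothesis Gdiag : forall a l, G a l a = 0.
Hypothesis levG : forall a c b, comb (G a) c b ^+ 2 <= h0 * dot (comb (G a) c) (comb (G a) c).
Hypothesis rho0 : 0 < rho.
Hypothesis h00 : 0 < h0.
Hypothesis kap0 : 0 < kap.
Hypothesis tau10 : 0 < tau1.
Hypothesis tau20 : 0 < tau2.
Hypothesis L1 : (0 < L)%N.
Notation slot := (slot L r s).
Implicit Types x : slot -> V.

Definition bx x j i (k : 'I_s.+1) : V := x (Some (inord j, i, k)).
Definition ux x := x (uslot L r s).
Definition vx x := x None.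

Let bad := @badb R V J G rho s.+1.
Let poor := @poorb R V J G rho kap s.+1.
Let rich := @richv R V J G rho kap s.+1.
Let reg := @regb R V J G rho s.+1.
Let cost v S S' u := hatdef G v S S' (@step R V J G h0 rho s.+1 levG rho0 h00 v S S' u).

Definition fail_pair x : R := (~~ pg (ux x) (vx x))%:R.
Definition fail_reg x : R := \sum_(j < L.+1) \sum_i (~~ reg (bx x j i))%:R.
Definition fail_rich x : R := (~~ rich (vx x))%:R.
(** The condition [rich] is part of the event, here and in [fail_dead], so that averages can be
    bounded for each vertex [v] separately. *)
Definition fail_start x : R := (rich (vx x) && poor (vx x) (bx x 0 ord0))%:R.
Definition fail_dead x : R := \sum_(j < L) \sum_i
  (rich (vx x) && ~~ poor (vx x) (bx x j i))%:R *
  \prod_i' (bad (vx x) (bx x j i) (bx x j.+1 i') || poor (vx x) (bx x j.+1 i'))%:R.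
Definition fail_cost x : R := \sum_(j < L | (0 < j)%N) \sum_i \sum_i'
  (reg (bx x j i) && reg (bx x j.+1 i'))%:R * cost (vx x) (bx x j i) (bx x j.+1 i') (ux x).
Definition fail_first x : R := \sum_i'
  (reg (bx x 0 ord0))%:R * tripdef G (vx x) (bx x 0 ord0) (bx x 1 i').

(** Indicators are summed as they are and costs are divided by their thresholds, so a value below 1
    excludes every failure and the average is a union bound. *)
Definition failure x : R := fail_pair x + fail_reg x + fail_rich x + fail_start x +
  fail_dead x + fail_cost x / tau1 + fail_first x / tau2.

Lemma cost_ge0 v S S' u : 0 <= cost v S S' u.
Proof. exact: dot_ge0. Qed.

Lemma fail_dead_ge0 x : 0 <= fail_dead x.
Proof. by do 2 (apply: sumr_ge0 => ? _); rewrite mulr_ge0 ?prodr_ge0. Qed.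
Lemma fail_cost_ge0 x : 0 <= fail_cost x.
Proof. by do 3 (apply: sumr_ge0 => ? _); rewrite mulr_ge0 ?cost_ge0. Qed.
Lemma fail_first_ge0 x : 0 <= fail_first x.
Proof. by apply: sumr_ge0 => ? _; rewrite mulr_ge0 ?tripdef_ge0. Qed.
Lemma fail_reg_ge0 x : 0 <= fail_reg x.
Proof. by do 2 (apply: sumr_ge0 => ? _); rewrite ler0n. Qed.

(** Greedy choice: without dead ends, a block that is not poor has a successor that is neither bad
    nor poor, which is exactly what the next choice needs. *)
Lemma route_exists x : rich (vx x) -> ~~ poor (vx x) (bx x 0 ord0) -> fail_dead x < 1 ->
  exists2 rt : nat -> 'I_r.+1, rt 0%N = ord0 & forall j, (j < L)%N ->
    ~~ bad (vx x) (bx x j (rt j)) (bx x j.+1 (rt j.+1)).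
Proof.
move=> rv ps fd; set v := vx x in rv ps *.
have step_ex (j : nat) i : (j < L)%N -> ~~ poor v (bx x j i) ->
    exists i', ~~ (bad v (bx x j i) (bx x j.+1 i') || poor v (bx x j.+1 i')).
  move=> jL pi; apply: contrapT => /forallNP H.
  suff : 1 <= fail_dead x by rewrite leNgt fd.
  pose f (j : 'I_L) i := (rich v && ~~ poor v (bx x j i))%:R *
    \prod_i' (bad v (bx x j i) (bx x j.+1 i') || poor v (bx x j.+1 i'))%:R : R.
  have f0 j' i' : 0 <= f j' i' by rewrite mulr_ge0 ?prodr_ge0.
  have f1 : f (Ordinal jL) i = 1.
    rewrite /f rv pi mul1r big1 // => i' _.
    by have /negP := H i'; rewrite negbK => ->.
  rewrite -f1; apply: le_trans (term_le_sum i (f0 (Ordinal jL))) _.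
  by apply: (term_le_sum (f := fun j => \sum_i f j i)) => j'; exact: sumr_ge0.
pose nxt j i := odflt ord0 [pick i' | ~~ (bad v (bx x j i) (bx x j.+1 i') || poor v (bx x j.+1
  i'))].
have nxtP (j : nat) i : (j < L)%N -> ~~ poor v (bx x j i) ->
    ~~ bad v (bx x j i) (bx x j.+1 (nxt j i)) /\ ~~ poor v (bx x j.+1 (nxt j i)).
  move=> jL pi; rewrite /nxt; case: pickP => [i' /=|no]; first by rewrite negb_or => /andP[].
  by have [i' hi'] := step_ex j i jL pi; have := no i'; rewrite hi'.
pose rt := fix rt j := if j is j'.+1 then nxt j' (rt j') else ord0.
have np j : (j <= L)%N -> ~~ poor v (bx x j (rt j)).
  by elim: j => // j IH jL; have [] := nxtP j (rt j) jL (IH (ltnW jL)).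
by exists rt => // j jL; have [] := nxtP j (rt j) jL (np j (ltnW jL)).
Qed.

Lemma placement_bound eta x (c : V -> J -> R) : eta = h0 / rho -> 16 * eta <= 1 ->
  failure x < 1 ->
  pg (ux x) (vx x) /\
  (comb (G (ux x)) (c (ux x)) (vx x) + comb (G (vx x)) (c (vx x)) (ux x)) ^+ 2 <=
  (17 * eta + 16 * eta ^+ 2 * L%:R + 2 * tau1 + 4 * tau2) *
   (2 * \sum_(p : slot) \sum_(q | close p q)
      (comb (G (x p)) (c (x p)) (x q) + comb (G (x q)) (c (x q)) (x p)) ^+ 2).
Proof.
move=> etaE es fx.
have d0 := fail_dead_ge0 x; have c0 := fail_cost_ge0 x; have f0 := fail_first_ge0 x.
have r0 := fail_reg_ge0 x.
have c0' : 0 <= fail_cost x / tau1 by rewrite divr_ge0 // ltW.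
have f0' : 0 <= fail_first x / tau2 by rewrite divr_ge0 // ltW.
have b0 (b : bool) : 0 <= b%:R :> R by rewrite ler0n.
have p0 : 0 <= fail_pair x by exact: b0.
have i0 : 0 <= fail_rich x by exact: b0.
have s0 : 0 <= fail_start x by exact: b0.
move: fx; rewrite /failure => fx.
have [e1 e2 e3 e4 e5] : [/\ fail_pair x < 1, fail_reg x < 1, fail_rich x < 1,
  fail_start x < 1 & fail_dead x < 1] by split; lra.
have e6 : fail_cost x <= tau1 by rewrite -[leRHS]mul1r -ler_pdivrMr //; lra.
have e7 : fail_first x <= tau2 by rewrite -[leRHS]mul1r -ler_pdivrMr //; lra.
have blt (b : bool) : (b%:R : R) < 1 -> ~~ b by case: b; rewrite ?ltxx.
have pgx : pg (ux x) (vx x) by move: (blt _ e1); rewrite negbK.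
have rv : rich (vx x) by move: (blt _ e3); rewrite negbK.
have ps : ~~ poor (vx x) (bx x 0 ord0) by move: (blt _ e4); rewrite rv.
have regx (j : nat) i : (j <= L)%N -> reg (bx x j i).
  move=> jL; apply: contraTT e2 => nr; rewrite -leNgt.
  have jL' : (j < L.+1)%N by [].
  pose f (j : 'I_L.+1) i := (~~ reg (bx x j i))%:R : R.
  have -> : 1 = f (Ordinal jL') i by rewrite /f nr.
  apply: le_trans (term_le_sum (f := f (Ordinal jL')) i _) _; first by move=> i'; exact: ler0n.
  by apply: (term_le_sum (f := fun j => \sum_i f j i)) => j'; apply: sumr_ge0 => i' _;
    exact: ler0n.
split=> //.
have [rt rt0 good] := route_exists rv ps e5.
pose S j := bx x j (rt j).
have regS j : (j <= L)%N -> regular G rho (S j) by move=> jL; apply/asboolP;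
  exact: (regx j (rt j)).
have goodS j : (j < L)%N -> tripdef G (vx x) (S j) (S j.+1) <= 1 / 4.
  move=> jL; have : ~~ bad (vx x) (S j) (S j.+1) := good j jL.
  have rj : regb G rho (S j) := regx j (rt j) (ltnW jL).
  have rj1 : regb G rho (S j.+1) := regx j.+1 (rt j.+1) jL.
  by rewrite /bad /badb rj rj1 !andTb -leNgt.
have uE : S 0 ord0 = ux x.
  by rewrite /S rt0 /bx /ux /uslot; congr (x (Some (_, _, _))); apply: val_inj; rewrite /= inordK.
have h1 : \sum_(j < L | (0 < j)%N) cost (vx x) (S j) (S j.+1) (ux x) <= tau1.
  apply: le_trans e6; rewrite /fail_cost; apply: ler_sum => j j0.
  pose f i i' := (reg (bx x j i) && reg (bx x j.+1 i'))%:R * cost (vx x) (bx x j i) (bx x j.+1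
    i') (ux x).
  have ff0 i i' : 0 <= f i i' by rewrite mulr_ge0 ?cost_ge0.
  have -> : cost (vx x) (S j) (S j.+1) (ux x) = f (rt j) (rt j.+1).
    by rewrite /f (regx j (rt j) (ltnW (ltn_ord j))) (regx j.+1 (rt j.+1) (ltn_ord j)) mul1r.
  apply: le_trans (term_le_sum (rt j.+1) (ff0 (rt j))) _.
  by apply: (term_le_sum (f := fun i => \sum_i' f i i')) => i; exact: sumr_ge0.
have h2 : tripdef G (vx x) (S 0) (S 1) <= tau2.
  apply: le_trans e7.
  pose f i' := (reg (bx x 0 ord0))%:R * tripdef G (vx x) (bx x 0 ord0) (bx x 1 i').
  have -> : tripdef G (vx x) (S 0) (S 1) = f (rt 1).
    by rewrite /f (regx 0%N ord0 (leq0n L)) mul1r /S rt0.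
  by apply: term_le_sum => i; rewrite mulr_ge0 ?tripdef_ge0.
apply: le_trans (chain_bound' Gdiag etaE es uE L1 regS goodS c h1 h2) _.
have eta0 : 0 <= eta by rewrite etaE divr_ge0 // ltW.
apply: ler_wpM2l.
  rewrite !addr_ge0 ?mulr_ge0 ?sqr_ge0 // ltW //.
pose e (p q : slot) := (comb (G (x p)) (c (x p)) (x q) + comb (G (x q)) (c (x q)) (x p)) ^+ 2.
apply: le_trans (@route_energy _ L r s rt e _); last by move=> p q; rewrite sqr_ge0.
apply: lerD => //; apply: ler_sum => j _; rewrite /EU le_eqVlt; apply/orP; left; apply/eqP.
have gE a : glue (S j) (S j.+1) a = x (rslot L rt j a) by case: a.
by apply: eq_bigr => a _; apply: eq_bigr => b _; rewrite /e !gE.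
Qed.

Section Probability.
Variables (emb : slot -> V) (theta er : R).
Hypothesis emb_inj : injective emb.
Hypothesis few : (2 * (s.+1 * (r + 3) + 2) ^ 2 <= #|V|)%N.
Hypothesis pg_avg : avg (fun u => avg (fun v => (~~ pg u v)%:R)) <= theta.
Hypothesis reg_avg : avg (fun S : {ffun 'I_s.+1 -> V} => (~~ reg S)%:R) <= er.

Let V0 : (0 < #|V|)%N.
Proof. by apply: leq_trans few; rewrite muln_gt0 expn_gt0 addn2. Qed.

Let fewE : (s.+1 * (r + 3) + 2 = s.+1 * r.+1 + s.+1 * 2 + 2)%N.
Proof. by rewrite -mulnDr; congr (_ * _ + _)%N; lia. Qed.

(** The factor 2 is only available for about the square root of [#|V|] positions, fewer than a
    placement has for the intended parameters. Each failure term reads few of them;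
    [s.+1 * (r + 3) + 2] covers a block, a full level, [u] and [v]. *)
Lemma place_avg (I : finType) (iota : I -> slot) (F : (I -> V) -> R) :
  injective iota -> (#|I| <= s.+1 * (r + 3) + 2)%N -> (forall y, 0 <= F y) ->
  avg (fun sg : {perm V} => F (fun i => sg (emb (iota i)))) <=
  2 * avg (fun y : {ffun I -> V} => F y).
Proof.
move=> ii cI F0.
have := @perm_avg_le R V I (emb \o iota) (fun y => F y) (inj_comp emb_inj ii) _ (fun y => F0 y).
have -> : (fun sg : {perm V} => F (fun i => sg (emb (iota i)))) =
   (fun s0 : {perm V} => F [ffun i => s0 ((emb \o iota) i)]).
  by apply: funext => sg; congr F; apply: funext => i; rewrite ffunE.
apply; apply: leq_trans few; rewrite leq_pmul2l // leq_exp2r //.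
Qed.

Let pl (sg : {perm V}) (p : slot) := sg (emb p).

Lemma fail_pair_avg : avg (fun sg => fail_pair (pl sg)) <= 2 * theta.
Proof.
pose io (b : option unit) : slot := if b is None then uslot L r s else None.
apply: le_trans (@place_avg (option unit) io (fun y =>
  (~~ pg (y None) (y (Some tt)))%:R) _ _ _) _.
- by move=> [[]|] [[]|].
- by rewrite card_option card_unit addnC.
- by move=> y; rewrite ler0n.
rewrite ler_pM2l // (avg_option (fun y => (~~ pg (y None) (y (Some tt)))%:R)).
apply: le_trans pg_avg; apply: avg_le => u.
rewrite (@avg_bij _ _ _ (fun v : V => [ffun _ : unit => v])).
  by apply: avg_le => v; rewrite /= ffunE.
exists (fun y : {ffun unit -> V} => y tt) => [v|y]; first by rewrite ffunE.
by apply/ffunP => -[]; rewrite ffunE.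
Qed.

Lemma fail_rich_avg : avg (fun sg => fail_rich (pl sg)) <= 2 * (pbound h0 rho s.+1 / kap ^+ 2).
Proof.
pose io (b : unit) : slot := None.
apply: le_trans (@place_avg unit io (fun y => (~~ rich (y tt))%:R) _ _ _) _.
- by move=> [] [].
- by rewrite card_unit addn2.
- by move=> y; rewrite ler0n.
rewrite ler_pM2l //; apply: le_trans (poor_vertex_avg s.+1 levG rho0 h00 kap0).
rewrite (@avg_bij _ _ _ (fun v : V => [ffun _ : unit => v])).
  by apply: avg_le => v; rewrite /= ffunE /rich /richv -ltNge.
exists (fun y : {ffun unit -> V} => y tt) => [v|y]; first by rewrite ffunE.
by apply/ffunP => -[]; rewrite ffunE.
Qed.

Lemma fail_reg_avg : avg (fun sg => fail_reg (pl sg)) <= 2 * (L.+1%:R * r.+1%:R * er).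
Proof.
rewrite avg_sum; under eq_bigr => j _ do rewrite avg_sum.
apply: (@le_trans _ _ (\sum_(j < L.+1) \sum_(i < r.+1) 2 * er)).
  apply: ler_sum => j _; apply: ler_sum => i _.
  apply: le_trans (@place_avg 'I_s.+1 (fun k => Some (inord j, i, k)) (fun S =>
    (~~ reg S)%:R) _ _ _) _.
  - by move=> k k' [].
  - by rewrite card_ord fewE; lia.
  - by move=> y; rewrite ler0n.
  by rewrite ler_pM2l.
by rewrite sum2_const le_eqVlt; apply/orP; left; apply/eqP; ring.
Qed.

Lemma fail_start_avg : avg (fun sg => fail_start (pl sg)) <= 2 * kap.
Proof.
pose io (o : option 'I_s.+1) : slot := if o is Some k then Some (inord 0, ord0, k) else None.
apply: le_trans (@place_avg _ io (fun y => (rich (y None) && poor (y None) (fun k =>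
  y (Some k)))%:R) _ _ _) _.
- by move=> [k|] [k'|] //= [->].
- by rewrite card_option card_ord fewE; lia.
- by move=> y; rewrite ler0n.
rewrite ler_pM2l // (avg_option (fun y => (rich (y None) && poor (y None) (fun k =>
  y (Some k)))%:R)).
rewrite -[leRHS](@avg_cst R V) //; apply: avg_le => v.
case rv : (rich v) => /=; first exact: poor_block_avg.
rewrite avg_cst ?ltW // card_ffun expn_gt0 V0 //.
Qed.

Let ne j : (j < L)%N -> (inord j : 'I_L.+1) <> inord j.+1.
Proof.
move=> jL /(congr1 (fun i : 'I_L.+1 => i : nat)).
by rewrite !inordK ?ltnS // 1?ltnW // => /eqP; rewrite ltn_eqF.
Qed.

Lemma fail_dead_avg : avg (fun sg => fail_dead (pl sg)) <=
  2 * (L%:R * r.+1%:R * (2 * kap) ^+ r.+1).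
Proof.
rewrite avg_sum; under eq_bigr => j _ do rewrite avg_sum.
apply: (@le_trans _ _ (\sum_(j < L) \sum_(i < r.+1) 2 * (2 * kap) ^+ r.+1)); last first.
  by rewrite sum2_const le_eqVlt; apply/orP; left; apply/eqP; ring.
apply: ler_sum => j _; apply: ler_sum => i _.
pose io (o : option ('I_s.+1 + 'I_r.+1 * 'I_s.+1)) : slot :=
  match o with None => None | Some (inl k) => Some (inord j, i, k)
  | Some (inr (i', k)) => Some (inord j.+1, i', k) end.
pose F (y : option ('I_s.+1 + 'I_r.+1 * 'I_s.+1) -> V) : R :=
  (rich (y None) && ~~ poor (y None) (fun k => y (Some (inl k))))%:R *
  \prod_i' (bad (y None) (fun k => y (Some (inl k))) (fun k => y (Some (inr (i', k)))) ||
     poor (y None) (fun k => y (Some (inr (i', k)))))%:R.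
apply: le_trans (@place_avg _ io F _ _ _) _.
- by move=> [[k|[i1 k]]|] [[k'|[i2 k']]|] //= [] =>
  [->|/(ne (ltn_ord j))|/esym/(ne (ltn_ord j))|-> ->].
- by rewrite card_option card_sum card_prod !card_ord fewE mulnC; lia.
- by move=> y; rewrite mulr_ge0 ?prodr_ge0.
rewrite ler_pM2l // (avg_option F).
rewrite -[leRHS](@avg_cst R V) //; apply: avg_le => v.
rewrite (avg_glue (fun y => F (fun o => if o is Some a then y a else v))).
rewrite -[leRHS](@avg_cst R {ffun 'I_s.+1 -> V}) ?card_ffun ?expn_gt0 ?V0 //; apply: avg_le => S.
rewrite /F /= avgZ.
case rv : (rich v && ~~ poor v S); last by rewrite mul0r exprn_ge0 // mulr_ge0 // ltW.
rewrite mul1r; move/andP: rv => [rv pS]; exact: dead_end_avg.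
Qed.

Lemma fail_first_avg : avg (fun sg => fail_first (pl sg)) <=
  2 * (r.+1%:R * (pbound h0 rho s.+1 / 4)).
Proof.
rewrite avg_sum.
apply: (@le_trans _ _ (\sum_(i < r.+1) 2 * (pbound h0 rho s.+1 / 4))); last first.
  by rewrite sumr_const card_ord -[leLHS]mulr_natl le_eqVlt; apply/orP; left; apply/eqP; ring.
apply: ler_sum => i _.
pose io (o : option ('I_s.+1 + 'I_s.+1)) : slot :=
  match o with None => None | Some (inl k) => Some (inord 0, ord0, k)
  | Some (inr k) => Some (inord 1, i, k) end.
pose F (y : option ('I_s.+1 + 'I_s.+1) -> V) : R :=
  (reg (fun k => y (Some (inl k))))%:R *
  tripdef G (y None) (fun k => y (Some (inl k))) (fun k => y (Some (inr k))).
apply: le_trans (@place_avg _ io F _ _ _) _.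
- by move=> [[k|k]|] [[k'|k']|] //= [] => [->|/(ne L1)|/esym/(ne L1)|->].
- by rewrite card_option card_sum !card_ord fewE; lia.
- by move=> y; rewrite mulr_ge0 ?tripdef_ge0.
rewrite ler_pM2l // (avg_option F).
apply: le_trans (tripdef_avg s.+1 levG rho0 h00); apply: avg_le => v.
by rewrite (avg_glue (fun y => F (fun o => if o is Some a then y a else v))).
Qed.

Lemma fail_cost_avg : avg (fun sg => fail_cost (pl sg)) <=
  2 * (L%:R * r.+1%:R ^+ 2 * (pbound h0 rho s.+1 / (rho * #|V|%:R))).
Proof.
set Q := pbound _ _ _ / _.
have Q0 : 0 <= Q.
  by rewrite /Q /pbound !mulr_ge0 ?sqr_ge0 ?invr_ge0 ?mulr_ge0 // ltW.
have -> : (fun sg => fail_cost (pl sg)) = fun sg => \sum_(j < L) (0 < j)%:R *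
   \sum_i \sum_i' (reg (bx (pl sg) j i) && reg (bx (pl sg) j.+1 i'))%:R *
     cost (vx (pl sg)) (bx (pl sg) j i) (bx (pl sg) j.+1 i') (ux (pl sg)).
  apply: funext => sg; rewrite /fail_cost big_mkcond; apply: eq_bigr => j _.
  by case: ifP; rewrite ?mul1r ?mul0r.
rewrite avg_sum.
apply: (@le_trans _ _ (\sum_(j < L) \sum_(i < r.+1) \sum_(i < r.+1) 2 * Q)); last first.
  rewrite (eq_bigr (fun=> r.+1%:R * r.+1%:R * (2 * Q))) => [|j _]; last exact: sum2_const.
  by rewrite sumr_const card_ord -[leLHS]mulr_natl le_eqVlt; apply/orP; left; apply/eqP; ring.
apply: ler_sum => j _; rewrite avgZ.
case j0 : (0 < j)%N; last by rewrite mul0r; do 2 (apply: sumr_ge0 => ? _); rewrite mulr_ge0.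
rewrite mul1r avg_sum; apply: ler_sum => i _; rewrite avg_sum; apply: ler_sum => i' _.
pose io (o : option (option ('I_s.+1 + 'I_s.+1))) : slot :=
  match o with None => uslot L r s | Some None => None | Some (Some (inl k)) => Some (inord j, i,
    k)
  | Some (Some (inr k)) => Some (inord j.+1, i', k) end.
pose F (y : option (option ('I_s.+1 + 'I_s.+1)) -> V) : R :=
  (reg (fun k => y (Some (Some (inl k)))) && reg (fun k => y (Some (Some (inr k)))))%:R *
  cost (y (Some None)) (fun k => y (Some (Some (inl k)))) (fun k =>
    y (Some (Some (inr k)))) (y None).
(* For [0 < j] the vertex [u], which lies on level 0, is outside both blocks and can be averaged
   independently of them. This is why [fail_cost] omits [j = 0]. *)
have n1 : (inord j : 'I_L.+1) <> ord0.
  move=> /(congr1 (fun i : 'I_L.+1 => i : nat)); rewrite inordK ?ltnS 1?ltnW //= => z.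
  by rewrite z in j0.
have n2 : (inord j.+1 : 'I_L.+1) <> ord0.
  by move=> /(congr1 (fun i : 'I_L.+1 => i : nat)); rewrite inordK ?ltnS.
apply: le_trans (@place_avg _ io F _ _ _) _.
- by move=> [[[k|k]|]|] [[[k'|k']|]|] //= [] =>
  [->|/(ne (ltn_ord j))|/n1|/esym/(ne (ltn_ord j))|->|/n2|/esym/n1|/esym/n2].
- by rewrite !card_option card_sum !card_ord fewE; lia.
- by move=> y; rewrite mulr_ge0 ?cost_ge0.
rewrite ler_pM2l // (avg_option F).
apply: le_trans (cost_avg s.+1 levG rho0 h00 V0); apply: avg_le => u.
rewrite (avg_option (fun y => F (fun o => if o is Some a then y a else u))); apply: avg_le => v.
by rewrite (avg_glue (fun y => F (fun o =>
  if o is Some a then (if a is Some b then y b else v) else u))).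
Qed.

Lemma failure_avg : avg (fun sg => failure (pl sg)) <=
  2 * (theta + L.+1%:R * r.+1%:R * er + pbound h0 rho s.+1 / kap ^+ 2 + kap +
   L%:R * r.+1%:R * (2 * kap) ^+ r.+1 +
   L%:R * r.+1%:R ^+ 2 * (pbound h0 rho s.+1 / (rho * #|V|%:R)) / tau1 +
   r.+1%:R * (pbound h0 rho s.+1 / 4) / tau2).
Proof.
have -> : (fun sg => failure (pl sg)) = fun sg => fail_pair (pl sg) + (fail_reg (pl sg) +
  (fail_rich (pl sg) + (fail_start (pl sg) + (fail_dead (pl sg) +
   (tau1^-1 * fail_cost (pl sg) + tau2^-1 * fail_first (pl sg)))))).
  by apply: funext => sg; rewrite /failure; ring.
rewrite 6!avgD 2!avgZ !mulrDr -!addrA.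
rewrite lerD ?fail_pair_avg // lerD ?fail_reg_avg // lerD ?fail_rich_avg // lerD ?fail_start_avg
  //.
rewrite lerD ?fail_dead_avg // lerD //.
  by rewrite mulrC mulrA ler_pdivlMr // divfK ?gt_eqF // fail_cost_avg.
by rewrite mulrC mulrA ler_pdivlMr // divfK ?gt_eqF // fail_first_avg.
Qed.

End Probability.
End Placement.

(** * Duality, and the inequality for a fixed sketching matrix *)

(** Riesz representation: the bound makes [phi] a well defined functional on the span of [g], and
    its representative in that span has squared norm at most [C]. *)
Lemma riesz_bound (R : realType) (I T : finType) (g : I -> T -> R) (phi : I -> R) (C : R) : 0 <=
  C ->
  (forall y, (\sum_i y i * phi i) ^+ 2 <= C * dot (comb g y) (comb g y)) ->
  exists2 y0, forall i, dot (g i) (comb g y0) = phi i & dot (comb g y0) (comb g y0) <= C.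
Proof.
move=> C0 H; have [on _ inq _] := gsP g; set q := gsf g in on inq; set b := gsb g in on.
have [c Hc] := choice inq.
pose t l := \sum_i c l i * phi i.
pose y0 i := \sum_l t l * c l i.
have zE : comb g y0 = comb q t.
  apply: funext => x; rewrite /comb /y0.
  under eq_bigr => i _ do rewrite mulr_suml.
  rewrite exchange_big; apply: eq_bigr => l _ /=.
  by rewrite Hc /comb mulr_sumr; apply: eq_bigr => i _; rewrite mulrA.
exists y0 => [i|].
  rewrite zE dotC dot_comb.
  (* Coefficients of [g i] minus its projection, which is zero; the hypothesis then forces the
     functional to vanish on them. *)
  pose y k := (k == i)%:R - \sum_l dot (g i) (q l) * c l k.
  have yg : comb g y = fun=> 0.
    have E : comb g y = fun x => g i x - proj g (g i) x.
      apply: funext => x; rewrite /comb /y.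
      under eq_bigr => k _ do rewrite mulrBl mulr_suml.
      rewrite sumrB; congr (_ - _).
        rewrite (bigD1 i) //= eqxx mul1r big1 ?addr0 // => k /negPf->; by rewrite mul0r.
      rewrite exchange_big; apply: eq_bigr => l _ /=; rewrite -/q.
      have -> : q l x = \sum_k c l k * g k x by rewrite Hc.
      by rewrite mulr_sumr; apply: eq_bigr => k _; rewrite mulrA.
    by rewrite E proj_fix; apply: funext => x; rewrite subrr.
  have := H y; rewrite yg dot0l mulr0 => h.
  have /eqP : (\sum_k y k * phi k) ^+ 2 = 0 by apply/eqP; rewrite eq_le h sqr_ge0.
  rewrite sqrf_eq0 /y; under eq_bigr => k _ do rewrite mulrBl.
  rewrite sumrB subr_eq0 (bigD1 i) //= eqxx mul1r big1 ?addr0 => [/eqP->|k /negPf->];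
    last by rewrite mul0r.
  under [RHS]eq_bigr => k _ do rewrite mulr_suml.
  rewrite exchange_big; apply: eq_bigr => l _ /=.
  by rewrite /t mulr_suml dotC; apply: eq_bigr => k _; ring.
have tt : \sum_i y0 i * phi i = \sum_l t l ^+ 2.
  rewrite /y0; under eq_bigr => i _ do rewrite mulr_suml.
  rewrite exchange_big; apply: eq_bigr => l _ /=.
  by rewrite expr2 {2}/t mulr_sumr; apply: eq_bigr => i _; rewrite mulrA.
have zz : dot (comb g y0) (comb g y0) <= \sum_l t l ^+ 2.
  rewrite zE dot_comb; apply: ler_sum => l _; rewrite dotC (dot_comb_onz _ _ on) expr2.
  by rewrite mulrCA; case: (b l); rewrite ?mul1r // mul0r -expr2 sqr_ge0.
have := H y0; rewrite tt.
move: zz (dot_ge0 (comb g y0)); move: (dot _ _) (\sum_l _) => z w zw z0 h.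
have : z * w <= C * z.
  apply: le_trans (_ : w ^+ 2 <= _) => //.
  by rewrite expr2 ler_wpM2r // (le_trans z0).
move: z0; rewrite le_eqVlt => /orP[/eqP z0|z0]; last first.
  by rewrite mulrC ler_pM2r // => /(le_trans zw).
by move=> _; rewrite -z0.
Qed.

Section FiniteTheorem.
Variables (R : realType) (V : finType) (N : nat) (M : V -> 'I_N -> V -> R) (nu : 'I_N -> V).
Variables (K kap tau1 tau2 : R) (L r s : nat).
Hypothesis Mdiag : forall a l, M a l a = 0.
Hypothesis Mnu : forall a l b, M a l b != 0 -> nu l = a.
Hypothesis K1 : 1 <= K.
Hypothesis kap0 : 0 < kap.
Hypothesis tau10 : 0 < tau1.
Hypothesis tau20 : 0 < tau2.
Hypothesis L1 : (0 < L)%N.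
Variable emb : slot L r s -> V.
Hypothesis emb_inj : injective emb.
Hypothesis few : (2 * (s.+1 * (r + 3) + 2) ^ 2 <= #|V|)%N.

Let n : R := #|V|%:R.
Let etaX : R := 4 * K / s.+1%:R.
Let pb : R := 32 * etaX ^+ 2 * (2 * s.+1 + 1)%:R.

Definition failure_bound : R :=
  2 * (4 * N%:R / (K * n) +
   L.+1%:R * r.+1%:R * (2 * n * K ^+ 2 * expR (- (s.+1%:R / (512 * K ^+ 4)))) +
   pb / kap ^+ 2 + kap + L%:R * r.+1%:R * (2 * kap) ^+ r.+1 +
   L%:R * r.+1%:R ^+ 2 * (pb / (s.+1%:R / 2)) / tau1 +
   r.+1%:R * (pb / 4) / tau2).

Definition energy_const : R := 2 * (17 * etaX + 16 * etaX ^+ 2 * L%:R + 2 * tau1 + 4 * tau2).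

Let V0 : (0 < #|V|)%N.
Proof. by apply: leq_trans few; rewrite muln_gt0 expn_gt0 addn2. Qed.
Let n0 : 0 < n. Proof. by rewrite ltr0n. Qed.
Let K0 : 0 < K. Proof. exact: lt_le_trans K1. Qed.
Let s0 : 0 < s.+1%:R :> R. Proof. by rewrite ltr0n. Qed.

Lemma sum_nzrows : (\sum_a nzrows M a <= N)%N.
Proof.
apply: (@leq_trans (\sum_a \sum_(l : 'I_N) (nu l == a))).
  apply: leq_sum => a _; rewrite /nzrows -sum1dep_card big_mkcond /=; apply: leq_sum => l _.
  case: ifP => // /eqP ne; have [b hb] : exists b, M a l b != 0.
    apply: contrapT => /forallNP H; apply: ne; apply: funext => b; apply/eqP.
    by have /negP := H b; rewrite negbK.
  by rewrite (Mnu hb) eqxx.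
rewrite exchange_big /= (eq_bigr (fun=> 1%N)) ?sum1_card ?card_ord // => l _.
by rewrite (bigD1 (nu l)) //= eqxx big1 // => a /negPf; rewrite eq_sym => ->.
Qed.

Definition heavy a : bool := (K < (nzrows M a)%:R)%R.
Definition light2 a b : bool := ~~ heavy a && ~~ heavy b.
Let M' a l b : R := if light2 a b then M a l b else 0.

Lemma nzrows_le (G : V -> 'I_N -> V -> R) a :
  (forall l b, M a l b = 0 -> G a l b = 0) -> (nzrows G a <= nzrows M a)%N.
Proof.
move=> H; apply: subset_leq_card; apply/fintype.subsetP => l; rewrite !inE; apply: contraNN =>
  /eqP e.
by apply/eqP/funext => b; rewrite H // e.
Qed.

Lemma heavy_card : #|[set a | heavy a]%SET|%:R * K <= N%:R.
Proof.
apply: (@le_trans _ _ (\sum_a (nzrows M a)%:R)); last by rewrite -natr_sum ler_nat sum_nzrows.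
rewrite -sum1dep_card natr_sum mulr_suml big_mkcond /=; apply: ler_sum => a _.
by case: ifP => // /ltW; rewrite mul1r.
Qed.

Definition rowsum (y : 'I_N -> R) a b := \sum_l y l * M a l b.

(** Dropping heavy vertices and reweighting gives row spaces of leverage at most [2 K / n], to which
    the placement argument applies. The squared value on a slot is multiplied by a factor in
    [[0, 1]], so energies only decrease, while the factor on [uv] is 1 when [pg] holds. *)
Theorem finite_theorem : 16 * etaX <= 1 ->
  exists good : {perm V} -> bool,
    avg (fun sg : {perm V} => (~~ good sg)%:R) <= failure_bound /\
    forall sg, good sg -> forall y : 'I_N -> R,
      (rowsum y (sg (emb (uslot L r s))) (sg (emb None)) +
       rowsum y (sg (emb None)) (sg (emb (uslot L r s)))) ^+ 2 <=
      energy_const * (2 * \sum_p \sum_(q | close p q)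
        (rowsum y (sg (emb p)) (sg (emb q)) + rowsum y (sg (emb q)) (sg (emb p))) ^+ 2).
Proof.
move=> esm.
have eta0 : 0 < K / n by rewrite divr_gt0.
have M'diag a l : M' a l a = 0 by rewrite /M' Mdiag if_same.
have [om [omC om01 omlev omc]] := reweighting eta0 M'diag.
have om0 a b : 0 <= om a b by case/andP: (om01 a b).
pose G := wrow M' om.
pose h0 : R := 2 * (K / n); pose rho : R := s.+1%:R / (2 * n).
have h00 : 0 < h0 by rewrite mulr_gt0.
have rho0 : 0 < rho by rewrite divr_gt0 // mulr_gt0.
have etaE : etaX = h0 / rho.
  have fE (k m t : R) : m != 0 -> t != 0 -> 4 * k / t = 2 * (k / m) / (t / (2 * m)).
    by move=> m0 t0; field; rewrite m0 t0.
  by apply: fE; rewrite gt_eqF.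
have Gdiag a l : G a l a = 0 by rewrite /G /wrow M'diag mulr0.
have levG a c b : comb (G a) c b ^+ 2 <= h0 * dot (comb (G a) c) (comb (G a) c).
  rewrite (@dot_comb_wrow R V _ M' om a c om0) /G comb_wrow exprMn sqr_sqrtr //; exact: omlev.
have rowsK a : (nzrows G a)%:R <= K.
  have [hv|nh] := boolP (heavy a).
    rewrite /nzrows (_ : [set _ | _]%SET = finset.set0) ?cards0 ?ltW //.
    apply/setP => l; rewrite !inE; apply/negbTE; rewrite negbK; apply/eqP/funext => b.
    by rewrite /G /wrow /M' /light2 hv mulr0.
  apply: (@le_trans _ _ (nzrows M a)%:R); last by move: nh; rewrite /heavy -leNgt.
  by rewrite ler_nat; apply: nzrows_le => l b z; rewrite /G /wrow /M' z if_same mulr0.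
pose pg a b := (1 <= om a b)%R && light2 a b.
(* A pair fails if its weight was lowered, for at most [2 N n / K] pairs, or if one endpoint is
   heavy, for at most [N n / K] pairs each. *)
have pgavg : avg (fun u => avg (fun v => (~~ pg u v)%:R)) <= 4 * N%:R / (K * n).
  rewrite -(avg_pair (fun u v => (~~ pg u v)%:R)).
  rewrite /avg card_prod natrM invfM -/n.
  have -> : 4 * N%:R / (K * n) = n^-1 / n * (4 * N%:R * n / K) by field; rewrite !gt_eqF.
  rewrite ler_pM2l ?divr_gt0 ?invr_gt0 //.
  apply: (@le_trans _ _ (\sum_(p : V * V) ((om p.1 p.2 < 1)%R%:R + (heavy p.1)%:R + (heavy
    p.2)%:R))).
    apply: ler_sum => p _; rewrite /pg /light2 -!natrD ler_nat [(om _ _ < 1)%R]ltNge.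
    by case: (1 <= om _ _)%R; case: (heavy p.1); case: (heavy p.2).
  rewrite !big_split /=.
  have c1 : \sum_(p : V * V) ((om p.1 p.2 < 1)%R%:R : R) <= 2 * N%:R * n / K.
    have -> : \sum_(p : V * V) ((om p.1 p.2 < 1)%R%:R : R) = #|[set p | om p.1 p.2 < 1]%SET|%:R.
      by rewrite -sum1dep_card natr_sum [RHS]big_mkcond /=; apply: eq_bigr => p _; case: ifP.
    rewrite ler_pdivlMr // -ler_pdivrMr // -mulrA; apply: le_trans omc _.
    rewrite ler_pM2l // ler_nat; apply: leq_trans sum_nzrows; apply: leq_sum => a _.
    by apply: nzrows_le => l b z; rewrite /M' z if_same.
  have ch : \sum_a ((heavy a)%:R : R) = #|[set a | heavy a]%SET|%:R.
    by rewrite -sum1dep_card natr_sum [RHS]big_mkcond /=; apply: eq_bigr => a _; case: ifP.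
  have ce (x : R) : \sum_(b : V) x = x * n by rewrite sumr_const -[LHS]mulr_natr.
  have c2 : \sum_(p : V * V) ((heavy p.1)%:R : R) <= N%:R * n / K.
    rewrite -(pair_bigA _ (fun a b => (heavy a)%:R)) /=.
    under eq_bigr => a _ do rewrite ce.
    rewrite -mulr_suml ch -/n mulrAC ler_pM2r // ler_pdivlMr //; exact: heavy_card.
  have c3 : \sum_(p : V * V) ((heavy p.2)%:R : R) <= N%:R * n / K.
    rewrite -(pair_bigA _ (fun a b => (heavy b)%:R)) /= exchange_big /=.
    under eq_bigr => a _ do rewrite ce.
    rewrite -mulr_suml ch -/n mulrAC ler_pM2r // ler_pdivlMr //; exact: heavy_card.
  apply: le_trans (lerD (lerD c1 c2) c3) _.
  by rewrite le_eqVlt; apply/orP; left; apply/eqP; ring.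
have h0n : (#|V|%:R)^-1 <= h0.
  by rewrite /h0 -/n mulrA ler_pMl ?invr_gt0 //; have := K1; lra.
have regavg := regular_avg rowsK K1 levG h0n V0 'I_s.+1.
rewrite card_ord -/n -/rho in regavg.
have eE : s.+1%:R / (128 * n ^+ 2 * K ^+ 2 * h0 ^+ 2) = s.+1%:R / (512 * K ^+ 4) :> R.
  by rewrite /h0; field; rewrite !gt_eqF.
rewrite eE in regavg.
pose fl (sg : {perm V}) := failure kap tau1 tau2 pg levG rho0 h00 (fun p : slot L r s =>
  sg (emb p)).
exists (fun sg : {perm V} => (fl sg < 1)%R); split.
  apply: le_trans (_ : avg fl <= _).
    apply: avg_le => sg; rewrite -leNgt.
    have fl0 : 0 <= fl sg.
      rewrite /fl /failure !addr_ge0 ?fail_reg_ge0 ?fail_dead_ge0 ?ler0n //.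
        by rewrite divr_ge0 ?fail_cost_ge0 // ltW.
      by rewrite divr_ge0 ?fail_first_ge0 // ltW.
    by case: (leP 1 (fl sg)).
  apply: le_trans (failure_avg levG rho0 h00 kap0 tau10 tau20 L1 emb_inj few pgavg regavg) _.
  have pbE : pbound h0 rho s.+1 = pb by rewrite /pbound /pb etaE.
  have rn : rho * #|V|%:R = s.+1%:R / 2 by rewrite /rho -/n; field; rewrite gt_eqF.
  by rewrite pbE rn /failure_bound.
move=> sg gsg y; pose f := rowsum y; pose x (p : slot L r s) := sg (emb p).
have [pgx bnd] := placement_bound Gdiag tau10 tau20 L1 (fun=> y) etaE esm gsg.
have cG a b : comb (G a) y b = (Num.sqrt (om a b) * (light2 a b)%:R) * f a b.
  rewrite /G comb_wrow -mulrA; congr (_ * _); rewrite /comb /f /rowsum mulr_sumr;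
    apply: eq_bigr => l _.
  by rewrite /M'; case: ifP; rewrite ?mul1r // mul0r mulr0.
have l2C a b : light2 a b = light2 b a by rewrite /light2 andbC.
(* Both factors are symmetric in [a] and [b], so the two parts of a slot value are scaled alike. *)
have sumG a b : (comb (G a) y b + comb (G b) y a) ^+ 2 =
    (om a b * (light2 a b)%:R) * (f a b + f b a) ^+ 2.
  rewrite !cG (omC b a) (l2C b a) -mulrDr !exprMn sqr_sqrtr //.
  by case: (light2 a b); rewrite ?expr1n // expr0n.
move: bnd; rewrite /= sumG -/(x _) -/(x _).
have -> : om (x (uslot L r s)) (x None) * (light2 (x (uslot L r s)) (x None))%:R = 1.
  move: pgx; rewrite /pg => /andP[hom1 ->]; rewrite mulr1; apply/eqP; rewrite eq_le hom1 andbT.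
  by case/andP: (om01 (x (uslot L r s)) (x None)).
rewrite mul1r => /le_trans; apply.
have eX : 0 <= etaX by rewrite etaE divr_ge0 // ltW.
have gen (e t1 t2 l : R) : 0 <= e -> 0 <= t1 -> 0 <= t2 -> 0 <= l ->
    0 <= 17 * e + 16 * e ^+ 2 * l + 2 * t1 + 4 * t2.
  by move=> a b c d; have := mulr_ge0 (sqr_ge0 e) d; nra.
have A0 := gen _ _ _ _ eX (ltW tau10) (ltW tau20) (ler0n R L).
rewrite /energy_const; move: A0; move: (17 * etaX + _ + _ + _) => A A0.
rewrite -[leRHS]mulrA [leLHS]mulrCA ler_pM2l //; apply: ler_wpM2l => //.
apply: (@le_trans _ _ (\sum_(p : slot L r s) \sum_(q | close p q) (f (x p) (x q) + f (x q) (x p))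
  ^+ 2)).
  apply: ler_sum => p _; apply: ler_sum => q _; rewrite sumG ler_piMl ?sqr_ge0 //.
  by case: (light2 _ _); rewrite ?mulr1 ?mulr0 //; case/andP: (om01 (x p) (x q)).
rewrite ler_peMl //; last by lra.
by apply: sumr_ge0 => p _; apply: sumr_ge0 => q _; rewrite sqr_ge0.
Qed.

End FiniteTheorem.

(** * A Lipschitz density and its overlap with its translates *)

Section LineIntegrals.
Variable R : realType.
Implicit Types (f g : R -> R).

Definition lint f : \bar R := (\int[@lebesgue_measure R]_t (f t)%:E)%E.
Arguments lint f%_ring_scope.

Lemma lint_ge0 f : (forall t, 0 <= f t) -> (0 <= lint f)%E.
Proof. by move=> h; apply: integral_ge0 => t _; rewrite lee_fin. Qed.

Lemma lint_add f g : measurable_fun setT f -> measurable_fun setT g ->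
  (forall t, 0 <= f t) -> (forall t, 0 <= g t) ->
  lint (fun t => f t + g t) = (lint f + lint g)%E.
Proof.
move=> mf mg f0 g0; rewrite /lint -ge0_integralD //; try by move=> t _; rewrite lee_fin.
- exact/measurable_EFinP.
- exact/measurable_EFinP.
Qed.

Lemma lint_scale f k : measurable_fun setT f -> (forall t, 0 <= f t) -> 0 <= k ->
  lint (fun t => k * f t) = (k%:E * lint f)%E.
Proof.
move=> mf f0 k0; rewrite /lint -ge0_integralZl_EFin //; first by move=> t _; rewrite lee_fin.
exact/measurable_EFinP.
Qed.

Lemma lint_le f g : measurable_fun setT f -> measurable_fun setT g ->
  (forall t, 0 <= f t) -> (forall t, f t <= g t) -> (lint f <= lint g)%E.
Proof.
move=> mf mg f0 fg; apply: ge0_le_integral => //; try by move=> t _; rewrite lee_fin.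
- exact/measurable_EFinP.
- exact/measurable_EFinP.
Qed.

Definition shiftR (a t : R) : R := t - a.

Lemma measurable_shiftR (a : R) :
  measurable_fun [set: measurableTypeR R] (shiftR a : _ -> measurableTypeR R).
Proof. by apply: measurable_funB => //; exact: measurable_cst. Qed.

HB.instance Definition _ (a : R) := isMeasurableFun.Build _ _ _ _
  (shiftR a : measurableTypeR R -> measurableTypeR R) (measurable_shiftR a).

Lemma lebesgue_measure_shift (a : R) (A : set R) : measurable A ->
  pushforward (@lebesgue_measure R) (shiftR a : _ -> measurableTypeR R) A = lebesgue_measure A.
Proof.
move=> mA; apply/esym/lebesgue_measure_unique => //= _ [[x y]] _ <-.
rewrite /pushforward.
have -> : shiftR a @^-1` (`]x, y]%classic : set R) = `]x + a, y + a]%classic.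
  by apply/seteqP; split => t /=; rewrite !in_itv /= /shiftR ltrBrDr lerBlDr.
rewrite /= !lebesgue_measure_itv /= !lte_fin ltrD2r.
by case: ifP => // _; rewrite -!EFinD; congr (_%:E); ring.
Qed.

Lemma measurable_shift (a : R) : measurable_fun setT (fun t : R => t - a).
Proof. exact: measurable_shiftR. Qed.

Lemma lint_shift f a : measurable_fun setT f -> (forall t, 0 <= f t) ->
  lint (fun t => f (t - a)) = lint f.
Proof.
move=> mf f0; rewrite /lint.
transitivity (\int[pushforward (@lebesgue_measure R) (shiftR a : _ ->
  measurableTypeR R)]_t (f t)%:E)%E.
  rewrite ge0_integral_pushforward //.
  - exact/measurable_EFinP.
  - by move=> t _; rewrite lee_fin.
by apply: eq_measure_integral => //= A mA _; exact: lebesgue_measure_shift.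
Qed.

Lemma lint_indic (a b : R) : a <= b -> lint (\1_(`[a, b]%classic : set R)) = (b - a)%:E.
Proof.
move=> ab; rewrite /lint integral_indic // setIT /= lebesgue_measure_itv /= lte_fin.
by case: ltP => // ba; rewrite (_ : b = a) ?subrr //; apply/eqP; rewrite eq_le ab ba.
Qed.

Definition tent (t : R) : R := Num.max 0 (Num.min (t - 1) (2 - t)).

Lemma tent_ge0 t : 0 <= tent t.
Proof. by rewrite le_max lexx. Qed.

Lemma tent_le1 t : tent t <= 1.
Proof. by rewrite /tent ge_max ge_min ler01 /=; lra. Qed.

Lemma tent_supp t : tent t != 0 -> 1 <= t <= 2.
Proof.
rewrite /tent; case: (leP (Num.min (t - 1) (2 - t)) 0) => h; first by rewrite eqxx.
by move: h; rewrite lt_min => /andP[h1 h2] _; lra.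
Qed.

Lemma tent_mid t : 5 / 4 <= t <= 7 / 4 -> 1 / 4 <= tent t.
Proof. by move=> /andP[a b]; rewrite /tent le_max le_min; apply/orP; right; apply/andP; split;
  lra. Qed.

Lemma tent_lip t t' : (tent t - tent t') ^+ 2 <= (t - t') ^+ 2.
Proof.
have H a b : tent a - tent b <= `|a - b|.
  have := ler_norm (a - b); have := ler_norm (b - a); rewrite (distrC b a) => n1 n2.
  have n0 := normr_ge0 (a - b).
  rewrite lerBlDr /tent ge_max addr_ge0 ?normr_ge0 ?le_max ?lexx //=.
  rewrite -lerBlDl le_max; apply/orP; right; rewrite le_min lerBlDl lerBlDl.
  by apply/andP; split; rewrite ge_min; apply/orP; [left|right]; lra.
rewrite -[leRHS]real_normK ?num_real // -[leLHS]real_normK ?num_real //.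
rewrite lerXn2r ?nnegrE ?normr_ge0 //.
by rewrite ler_norml H lerNl opprB distrC H.
Qed.

Lemma measurable_tent : measurable_fun setT tent.
Proof.
apply: measurable_maxr; first exact: measurable_cst.
apply: measurable_minr; first exact: measurable_shift.
by apply: measurable_funB => //; exact: measurable_cst.
Qed.

(** The tent function, normalized. It is at least 1/4 on an interval of length 1/2, so its square
    has mass at least 1/32; this is the origin of the constant 32. *)
Lemma density_exists : exists g, [/\ measurable_fun setT g, forall t, 0 <= g t,
  forall t, g t != 0 -> 1 <= t <= 2, lint (fun t => g t ^+ 2) = 1%E &
  forall t t', (g t - g t') ^+ 2 <= 32 * (t - t') ^+ 2].
Proof.
have mt2 : measurable_fun setT (fun t => tent t ^+ 2) by apply: measurable_funX;
  exact: measurable_tent.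
have m1 (a b : R) : measurable_fun setT (\1_(`[a, b]%classic : set R) : R ->
  R) by exact: measurable_indic.
have c0 : (0 <= lint (fun t : R => tent t ^+ 2)%R)%E by apply: lint_ge0 => t; exact: sqr_ge0.
have c1 : (lint (fun t : R => tent t ^+ 2)%R <= 1%:E)%E.
  have <- : lint (\1_(`[1, 2]%classic : set R)) = 1%:E by rewrite lint_indic; [congr (_%:E)|];
    lra.
  apply: lint_le => // t; first exact: sqr_ge0.
  have [z|/tent_supp s] := eqVneq (tent t) 0; first by rewrite z expr0n /= indicE ler0n.
  rewrite indicE mem_set /= ?in_itv //=.
  by rewrite expr2; have := tent_ge0 t; have := tent_le1 t; nra.
have c2 : ((1 / 32 : R)%R%:E <= lint (fun t : R => tent t ^+ 2)%R)%E.
  have -> : (1 / 32 : R)%:E = lint (fun t => (1 / 16) * (\1_(`[5 / 4,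
    7 / 4]%classic : set R) : R -> R) t).
    rewrite lint_scale; [|exact: m1|by move=> t; rewrite indicE ler0n|by lra].
    rewrite lint_indic; [|by lra].
    by rewrite -EFinM; congr (_%:E); lra.
  apply: lint_le; [by apply: measurable_funM => //; exact: measurable_cst|exact: mt2| |] => t.
    by rewrite mulr_ge0 // indicE ler0n.
  rewrite indicE; case: (boolP (t \in _)) => [|_]; last by rewrite mulr0 sqr_ge0.
  rewrite inE /= in_itv /= => /tent_mid h; rewrite mulr1 expr2; have := tent_ge0 t; nra.
have fc : lint (fun t : R => tent t ^+ 2) \is a fin_num.
  by rewrite ge0_fin_numE //; apply: le_lt_trans c1 _; rewrite ltry.
pose c := fine (lint (fun t : R => tent t ^+ 2)).
have cE : lint (fun t : R => tent t ^+ 2) = c%:E by rewrite fineK.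
rewrite cE lee_fin in c2.
have cp : 0 < c by lra.
exists (fun t => (Num.sqrt c)^-1 * tent t); split.
- by apply: measurable_funM; [exact: measurable_cst|exact: measurable_tent].
- by move=> t; rewrite mulr_ge0 ?tent_ge0 // invr_ge0 sqrtr_ge0.
- by move=> t h; apply: tent_supp; apply: contraNneq h => ->; rewrite mulr0.
- have -> : (fun t : R => ((Num.sqrt c)^-1 * tent t) ^+ 2) = fun t => c^-1 * tent t ^+ 2.
    by apply: funext => t; rewrite exprMn exprVn sqr_sqrtr // ltW.
  rewrite lint_scale //; [|by move=> t; exact: sqr_ge0|by rewrite invr_ge0 ltW].
  by rewrite cE -EFinM mulVf // gt_eqF.
- move=> t t'; rewrite -mulrBr exprMn exprVn sqr_sqrtr ?(ltW cp) //.
  apply: ler_pM; rewrite ?sqr_ge0 ?invr_ge0 ?(ltW cp) ?tent_lip //.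
  by rewrite -[leLHS]mul1r ler_pdivrMr //; lra.
Qed.

Section Overlap.
Variable g : R -> R.
Hypothesis mg : measurable_fun setT g.
Hypothesis g0 : forall t, 0 <= g t.
Hypothesis gsupp : forall t, g t != 0 -> 1 <= t <= 2.
Hypothesis g1 : lint (fun t => g t ^+ 2) = 1%E.
Hypothesis glip : forall t t', (g t - g t') ^+ 2 <= 32 * (t - t') ^+ 2.

Let mg2 : measurable_fun setT (fun t : R => g t ^+ 2).
Proof. exact: measurable_funX. Qed.

Let mgs z : measurable_fun setT (fun t : R => g (t - z)).
Proof. by apply: (measurableT_comp mg); exact: measurable_shift. Qed.

Let mgg z : measurable_fun setT (fun t : R => g t * g (t - z)).
Proof. exact: measurable_funM. Qed.

Let mgs2 z : measurable_fun setT (fun t : R => g (t - z) ^+ 2).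
Proof. exact: measurable_funX. Qed.

Let g1s z : lint (fun t : R => g (t - z) ^+ 2) = 1%E.
Proof. by rewrite (lint_shift z (f := fun t => g t ^+ 2)) // => t; exact: sqr_ge0. Qed.

(** For [z ^ 2 < 1] both supports lie in [[0, 3]]; integrating the Lipschitz bound there gives 2
    minus twice the overlap at most [96 z ^ 2]. For larger [z] the left side is negative. *)
Lemma overlap_ge z : ((1 - 48 * z ^+ 2)%R%:E <= lint (fun t : R => g t * g (t - z))%R)%E.
Proof.
have gg0 t : 0 <= g t * g (t - z) by rewrite mulr_ge0.
have [z1|z1] := leP 1 (z ^+ 2).
  by apply: (@le_trans _ _ 0%E); [rewrite lee_fin; lra|exact: lint_ge0].
have zz : -1 <= z <= 1 by apply/andP; split; nra.
have m1 : measurable_fun setT (\1_(`[0, 3]%classic : set R) : R -> R) by exact: measurable_indic.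
have i0 t : 0 <= (\1_(`[0, 3]%classic : set R) : R -> R) t by rewrite indicE ler0n.
have k0 : 0 <= 32 * z ^+ 2 by rewrite mulr_ge0 ?sqr_ge0.
have : (lint (fun t : R => g t ^+ 2 + g (t - z) ^+ 2)%R <=
   lint (fun t : R => 2 * (g t * g (t - z)) + 32 * z ^+ 2 * (\1_(`[0, 3]%classic : set R) : R ->
     R) t)%R)%E.
  apply: lint_le.
  - exact: measurable_funD.
  - by apply: measurable_funD; apply: measurable_funM => //; exact: measurable_cst.
  - by move=> t; rewrite addr_ge0 ?sqr_ge0.
  - move=> t; rewrite indicE; case: (boolP (t \in _)) => [_|].
      have := glip t (t - z); have -> : t - (t - z) = z by ring.
      by rewrite mulr1; nra.
    rewrite notin_setE /= in_itv /= => /negP nt.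
    have z1' : g t = 0 by apply/eqP; apply: contraNT nt => /gsupp; case/andP: zz =>
      ? ? /andP[? ?]; apply/andP; split; lra.
    have z2' : g (t - z) = 0 by apply/eqP; apply: contraNT nt => /gsupp; case/andP: zz =>
      ? ? /andP[? ?]; apply/andP; split; lra.
    by rewrite z1' z2' expr0n /= !mulr0 addr0.
rewrite lint_add //; try by move=> t; exact: sqr_ge0.
rewrite g1 g1s lint_add //; last 4 first.
- by apply: measurable_funM => //; exact: measurable_cst.
- by apply: measurable_funM => //; exact: measurable_cst.
- by move=> t; rewrite mulr_ge0.
- by move=> t; rewrite mulr_ge0.
rewrite !lint_scale // lint_indic; last by lra.
have := lint_ge0 gg0; case: (lint _) => [x| |] // _; last first.
  by move=> _; rewrite leey.
by rewrite -!EFinM -!EFinD !lee_fin; lra.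
Qed.

Definition rint (a : R -> R) : R := fine (lint (fun t => a t * g t ^+ 2)).

Lemma rint_bounds (a : R -> R) : measurable_fun setT a -> (forall t, 0 <= a t <= 1) ->
  lint (fun t => a t * g t ^+ 2) = (rint a)%:E /\ 0 <= rint a <= 1.
Proof.
move=> ma a01.
have ag0 t : 0 <= a t * g t ^+ 2 by rewrite mulr_ge0 ?sqr_ge0 //; case/andP: (a01 t).
have l0 := lint_ge0 ag0.
have l1 : (lint (fun t : R => a t * g t ^+ 2)%R <= 1%E)%E.
  rewrite -g1; apply: lint_le => // [|t]; first exact: measurable_funM.
  by rewrite ler_piMl ?sqr_ge0 //; case/andP: (a01 t).
have fn : lint (fun t => a t * g t ^+ 2) \is a fin_num.
  by rewrite ge0_fin_numE //; apply: le_lt_trans l1 _; rewrite ltry.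
have E : lint (fun t => a t * g t ^+ 2) = (rint a)%:E by rewrite /rint fineK.
by move: l0 l1; rewrite E !lee_fin => -> ->.
Qed.

(** Multiply the pointwise hypothesis by [g t * g (t - z)], integrate, and use Cauchy-Schwarz on
    each term against a factor of mass 1. The left side becomes the overlap. *)
Lemma hellinger_step (a b : R -> R) (kap z : R) : measurable_fun setT a ->
  measurable_fun setT b ->
  (forall t, 0 <= a t <= 1) -> (forall t, 0 <= b t <= 1) -> 0 <= kap ->
  (forall t, kap <= Num.sqrt (a t) + Num.sqrt (b (t - z))) ->
  kap * (1 - 48 * z ^+ 2) <= Num.sqrt (rint a) + Num.sqrt (rint b).
Proof.
move=> ma mb a01 b01 k0 H.
have [aE /andP[A0 A1]] := rint_bounds ma a01.
have [bE /andP[B0 B1]] := rint_bounds mb b01.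
set A := rint a in aE A0 A1 *; set B := rint b in bE B0 B1 *.
have a0 t : 0 <= a t by case/andP: (a01 t).
have b0 t : 0 <= b t by case/andP: (b01 t).
have ag0 t : 0 <= a t * g t ^+ 2 by rewrite mulr_ge0 ?sqr_ge0.
have bg0 t : 0 <= b t * g t ^+ 2 by rewrite mulr_ge0 ?sqr_ge0.
(* Cauchy-Schwarz is obtained from weighted AM-GM with the weights [l] and [m]; the margin [e] keeps
   them positive when [A] or [B] vanishes. *)
apply/ler_addgt0Pr => e e0.
pose l := Num.sqrt A + e; pose m := Num.sqrt B + e.
have sA := sqrtr_ge0 A; have sB := sqrtr_ge0 B.
have l0 : 0 < l by rewrite /l; lra.
have m0 : 0 < m by rewrite /m; lra.
have mbs : measurable_fun setT (fun t : R => b (t - z)).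
  by apply: measurableT_comp => //; exact: measurable_shift.
have main : (lint (fun t : R => kap * (g t * g (t - z)))%R <=
   lint (fun t : R => ((2 * l)^-1 * (a t * g t ^+ 2) + (l / 2) * g (t - z) ^+ 2) +
     ((2 * m)^-1 * (b (t - z) * g (t - z) ^+ 2) + (m / 2) * g t ^+ 2))%R)%E.
  apply: lint_le.
  - by apply: measurable_funM => //; exact: measurable_cst.
  - by apply: measurable_funD; apply: measurable_funD; apply: measurable_funM;
      try exact: measurable_cst; rewrite //; exact: measurable_funM.
  - by move=> t; rewrite !mulr_ge0.
  - move=> t.
    apply: (@le_trans _ _ ((Num.sqrt (a t) + Num.sqrt (b (t - z))) * (g t * g (t - z)))).
      by rewrite ler_wpM2r ?mulr_ge0.
    have amgm (al ga gb k : R) : 0 <= al -> 0 < k ->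
        Num.sqrt al * (ga * gb) <= (2 * k)^-1 * (al * ga ^+ 2) + k / 2 * gb ^+ 2.
      move=> al0 kk; rewrite -[in leRHS](sqr_sqrtr al0); set q := Num.sqrt al.
      rewrite -subr_ge0.
      have -> : (2 * k)^-1 * (q ^+ 2 * ga ^+ 2) + k / 2 * gb ^+ 2 - q * (ga * gb) =
         (2 * k)^-1 * (q * ga - k * gb) ^+ 2 by field; rewrite gt_eqF.
      by rewrite mulr_ge0 ?sqr_ge0 // invr_ge0 mulr_ge0 // ltW.
    rewrite mulrDl; apply: lerD; first exact: amgm.
    by rewrite [g t * _]mulrC; exact: amgm.
move: main; rewrite lint_scale // => [|t]; last by rewrite mulr_ge0.
have p1 t : 0 <= (2 * l)^-1 * (a t * g t ^+ 2) by rewrite mulr_ge0 // invr_ge0 mulr_ge0 // ltW.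
have p2 t : 0 <= l / 2 * g (t - z) ^+ 2 by rewrite mulr_ge0 ?sqr_ge0 // divr_ge0 // ltW.
have p3 t : 0 <= (2 * m)^-1 * (b (t - z) * g (t - z) ^+ 2) by rewrite mulr_ge0 // invr_ge0
  mulr_ge0 // ltW.
have p4 t : 0 <= m / 2 * g t ^+ 2 by rewrite mulr_ge0 ?sqr_ge0 // divr_ge0 // ltW.
have q1 : measurable_fun setT (fun t : R => a t * g t ^+ 2) by exact: measurable_funM.
have q3 : measurable_fun setT (fun t : R => b (t - z) * g (t - z) ^+ 2) by exact: measurable_funM.
have q3' : measurable_fun setT (fun t : R => b t * g t ^+ 2) by exact: measurable_funM.
have r1 : measurable_fun setT (fun t : R =>
  (2 * l)^-1 * (a t * g t ^+ 2)) by apply: measurable_funM => //; exact: measurable_cst.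
have r2 : measurable_fun setT (fun t : R => l / 2 * g (t - z) ^+ 2) by apply: measurable_funM =>
  //; exact: measurable_cst.
have r3 : measurable_fun setT (fun t : R =>
  (2 * m)^-1 * (b (t - z) * g (t - z) ^+ 2)) by apply: measurable_funM => //;
  exact: measurable_cst.
have r4 : measurable_fun setT (fun t : R => m / 2 * g t ^+ 2) by apply: measurable_funM => //;
  exact: measurable_cst.
rewrite lint_add; last 4 first.
- exact: measurable_funD.
- exact: measurable_funD.
- by move=> t; rewrite addr_ge0.
- by move=> t; rewrite addr_ge0.
rewrite !lint_add //.
rewrite (lint_scale q1) ?invr_ge0 ?mulr_ge0 ?(ltW l0) // aE.
rewrite (lint_scale (mgs2 z)) ?divr_ge0 ?(ltW l0) //; last by move=> t; exact: sqr_ge0.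
rewrite (lint_scale q3) ?invr_ge0 ?mulr_ge0 ?(ltW m0) //.
rewrite (lint_scale mg2) ?divr_ge0 ?(ltW m0) //; last by move=> t; exact: sqr_ge0.
rewrite g1s g1 (lint_shift z (f := fun t => b t * g t ^+ 2)) // bE.
rewrite !mule1 -!EFinM -!EFinD => main.
have := le_trans (lee_wpmul2l _ (overlap_ge z)) main.
rewrite lee_fin => /(_ k0); rewrite -EFinM lee_fin => /le_trans; apply.
have half (x y k : R) : 0 <= x -> k = Num.sqrt x + y -> 0 < y -> (2 * k)^-1 * x + k / 2 <=
  Num.sqrt x + y / 2.
  move=> x0 kE y0; have sx := sqrtr_ge0 x; rewrite -[X in _ * X + _](sqr_sqrtr x0).
  have k0' : 0 < k by rewrite kE; lra.
  rewrite -lerBrDr mulrC ler_pdivrMr ?mulr_gt0 // kE; nra.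
have hA := half A e l A0 erefl e0; have hB := half B e m B0 erefl e0.
lra.
Qed.

End Overlap.
End LineIntegrals.

(** * Independent random weights and tensorization *)

Section IteratedIntegrals.
Variables (R : realType) (E : eqType) (g : R -> R).
Hypothesis mg : measurable_fun setT g.
Hypothesis g0 : forall t, 0 <= g t.
Hypothesis gsupp : forall t, g t != 0 -> 1 <= t <= 2.
Hypothesis g1 : lint (fun t => g t ^+ 2) = 1%E.
Hypothesis glip : forall t t', (g t - g t') ^+ 2 <= 32 * (t - t') ^+ 2.
Implicit Types (F G : (E -> R) -> R) (w : E -> R).

Definition upd w e (t : R) : E -> R := fun e' => if e' == e then t else w e'.

Fixpoint iint (es : seq E) F w : R :=
  if es is e :: es' then rint g (fun t => iint es' F (upd w e t)) else F w.

Definition unit_valued F := forall w, 0 <= F w <= 1.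

Section Joint.
Variables (d0 : measure_display) (Om : measurableType d0).
Implicit Type (H : Om -> (E -> R) -> R).

(* Functions of finitely many real coordinates and of a sample: measurability
   is tested along measurable families, so that no sigma-algebra on [E -> R]
   is needed. *)
Definition jmeas H := forall (d : measure_display) (T : measurableType d)
  (phi : T -> Om) (x : T -> E -> R), measurable_fun setT phi ->
  (forall e, measurable_fun setT (fun t => x t e)) ->
  measurable_fun setT (fun t => H (phi t) (x t)).

Lemma jmeas_line H om w e : jmeas H -> measurable_fun setT (fun t : R => H om (upd w e t)).
Proof.
move=> hH; apply: (hH _ _ (fun=> om) (fun t => upd w e t)); first exact: measurable_cst.
by move=> e'; rewrite /upd; case: eqP => _; [exact: measurable_id|exact: measurable_cst].
Qed.

Lemma jmeas_iint H es : jmeas H -> (forall om, unit_valued (H om)) ->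
  jmeas (fun om => iint es (H om)) /\ forall om, unit_valued (iint es (H om)).
Proof.
move=> hH bH; elim: es => [//|e es [IH1 IH2]]; split; last first.
  move=> om w /=; have [] // := rint_bounds mg g1 (jmeas_line om w e IH1).
  by move=> t; exact: IH2.
move=> d T phi x mphi mx /=.
pose f (p : T * R) : \bar R := (iint es (H (phi p.1)) (upd (x p.1) e p.2) * g p.2 ^+ 2)%:E.
have mf : measurable_fun setT f.
  apply/measurable_EFinP; apply: measurable_funM.
    apply: (IH1 _ _ (fun p : T * R => phi p.1) (fun p : T * R => upd (x p.1) e p.2)).
      exact: (measurableT_comp mphi measurable_fst).
    move=> e'; rewrite /upd; case: eqP => _; first exact: measurable_snd.
    exact: (measurableT_comp (mx e') measurable_fst).
  apply: measurable_funX; exact: (measurableT_comp mg measurable_snd).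
have f0 p : (0 <= f p)%E.
  by rewrite lee_fin mulr_ge0 ?sqr_ge0 //; case/andP: (IH2 (phi p.1) (upd (x p.1) e p.2)).
have := measurable_fun_fubini_tonelli_F (m2 := @lebesgue_measure R) f mf f0.
move=> mF; rewrite /rint /lint.
exact: (measurableT_comp (fine_measurable measurableT) mF).
Qed.

Variable P : probability Om R.

(** Exchanges the randomness of the sketch with that of the weights, so a failure bound valid for
    every input passes to random inputs. Only weights in [[1, 2]] matter, as [g] vanishes
    elsewhere. *)
Lemma iint_fubini H es w (delta : R) : jmeas H -> (forall om, unit_valued (H om)) -> 0 <= delta ->
  (forall w', (forall e, e \in es -> 1 <= w' e <= 2) -> (forall e, e \notin es -> w' e = w e) ->
     (\int[P]_om (H om w')%:E <= delta%:E)%E) ->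
  (\int[P]_om (iint es (H om) w)%:E <= delta%:E)%E.
Proof.
move=> hH bH d0'; elim: es w => [|e es IH] w hyp /=; first exact: hyp.
have [I1 I2] := jmeas_iint es hH bH.
pose f (p : Om * R) : \bar R := (iint es (H p.1) (upd w e p.2) * g p.2 ^+ 2)%:E.
have mf : measurable_fun setT f.
  apply/measurable_EFinP; apply: measurable_funM.
    apply: (I1 _ _ (fun p : Om * R => p.1) (fun p : Om * R => upd w e p.2)).
      exact: measurable_fst.
    move=> e'; rewrite /upd; case: eqP => _; first exact: measurable_snd.
    exact: measurable_cst.
  apply: measurable_funX; exact: (measurableT_comp mg measurable_snd).
have f0 p : (0 <= f p)%E.
  by rewrite lee_fin mulr_ge0 ?sqr_ge0 //; case/andP: (I2 p.1 (upd w e p.2)).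
have -> : (\int[P]_om (rint g (fun t => iint es (H om) (upd w e t)))%:E =
   \int[P]_om \int[@lebesgue_measure R]_t f (om, t))%E.
  apply: eq_integral => om _.
  by have [<- _] := rint_bounds mg g1 (jmeas_line om w e I1) (fun t => I2 om (upd w e t)).
rewrite fubini_tonelli //.
have inner t : (\int[P]_om f (om, t) <= (delta * g t ^+ 2)%:E)%E.
  have -> : (\int[P]_om f (om, t) =
    \int[P]_om ((g t ^+ 2)%:E * (iint es (H om) (upd w e t))%:E))%E.
    by apply: eq_integral => om _; rewrite /f /= mulrC EFinM.
  rewrite ge0_integralZl_EFin ?sqr_ge0 //; last 2 first.
  - by move=> om _; rewrite lee_fin; case/andP: (I2 om (upd w e t)).
  - apply/measurable_EFinP; apply: (I1 _ _ id (fun=> upd w e t)); first exact: measurable_id.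
    by move=> e'; exact: measurable_cst.
  have [z|/gsupp gt] := eqVneq (g t) 0; first by rewrite z expr0n /= mul0e mulr0.
  have -> : ((delta * g t ^+ 2)%:E = (g t ^+ 2)%:E * delta%:E)%E by rewrite -EFinM mulrC.
  apply: lee_wpmul2l; first by rewrite lee_fin sqr_ge0.
  apply: IH => w' h1 h2; apply: hyp => e'.
    rewrite inE => /orP[/eqP->|/h1//].
    have [/h1//|/h2->] := boolP (e \in es).
    by rewrite /upd eqxx.
  rewrite inE negb_or => /andP[ne /h2->]; by rewrite /upd (negPf ne).
apply: (@le_trans _ _ (lint (fun t => delta * g t ^+ 2))).
  apply: ge0_le_integral => //.
  - by move=> t _; exact: integral_ge0.
  - exact: (measurable_fun_fubini_tonelli_G (m1 := P) f mf f0).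
  - apply/measurable_EFinP; apply: measurable_funM; first exact: measurable_cst.
    exact: measurable_funX.
rewrite lint_scale //; first by rewrite g1 mule1.
- exact: measurable_funX.
- by move=> t; exact: sqr_ge0.
Qed.

(** Each integrated coordinate costs the overlap of its density with the translate by [z e];
    [hellinger_step] is applied with the product of the remaining overlaps as its constant. *)
Lemma iint_hellinger H H' om es (z : E -> R) (kap : R) : jmeas H -> jmeas H' ->
  (forall om, unit_valued (H om)) -> (forall om, unit_valued (H' om)) -> 0 <= kap ->
  (forall e, 48 * z e ^+ 2 <= 1) ->
  (forall w w', (forall e, w' e = w e - z e) -> kap <= Num.sqrt (H om w) + Num.sqrt (H' om w')) ->
  forall w w', (forall e, e \notin es -> w' e = w e - z e) ->
  kap * \prod_(e <- es) (1 - 48 * z e ^+ 2) <=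
    Num.sqrt (iint es (H om) w) + Num.sqrt (iint es (H' om) w').
Proof.
move=> hH hH' bH bH' k0 zs hyp; elim: es => [|e es IH] w w' ww'.
  by rewrite big_nil mulr1; apply: hyp => e; exact: ww'.
have [I1 I2] := jmeas_iint es hH bH; have [I1' I2'] := jmeas_iint es hH' bH'.
rewrite big_cons mulrCA mulrC /=.
apply: (hellinger_step mg g0 gsupp g1 glip (z := z e)).
- exact: (jmeas_line om w e I1).
- exact: (jmeas_line om w' e I1').
- by move=> t; exact: I2.
- by move=> t; exact: I2'.
- by rewrite mulr_ge0 // prodr_ge0 // => e' _; rewrite subr_ge0.
- move=> t; apply: IH => e' ne; rewrite /upd; case: eqP => [->//|/eqP ne'].
  by apply: ww'; rewrite inE negb_or ne' ne.
Qed.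

End Joint.
End IteratedIntegrals.

(** * Spanners, levels and measurability of distances *)

Section GraphFacts.
Variables (R : realType) (n : nat).
Implicit Types (w h : vpair n -> R) (u v a b : 'I_n) (p : seq 'I_n).

Lemma weightC w a b : weight w a b = weight w b a.
Proof. by rewrite /weight finset.setUC. Qed.

Lemma weight_diag w a : weight w a a = 0.
Proof. by rewrite /weight insubF //= finset.setUid cards1. Qed.

Lemma weight_edge w (e : vpair n) a b : val e = [set a; b]%SET -> weight w a b = w e.
Proof. by move=> E; rewrite /weight -E valK. Qed.

Lemma weight_cases a b : (forall w, weight w a b = 0) \/
  exists2 e : vpair n, val e = [set a; b]%SET & forall w, weight w a b = w e.
Proof.
have [e _ E|ns] := insubP {e : {set 'I_n} | #|e| == 2} [set a; b]%SET.
  by right; exists e => // w; exact: weight_edge.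
by left => w; rewrite /weight insubN.
Qed.

Lemma path_length_cons w u b p : path_length w u (b :: p) = weight w u b + path_length w b p.
Proof. by rewrite /path_length /= big_cons. Qed.

Lemma path_length_nil w u : path_length w u [::] = 0.
Proof. by rewrite /path_length big_nil. Qed.

Lemma size_le_length h u p : (forall a b, adj h a b -> 1 <= weight h a b) ->
  path (adj h) u p -> (size p)%:R <= path_length h u p.
Proof.
move=> H; elim: p u => [|b p IH] u /=; first by rewrite path_length_nil.
move=> /andP[ab pp]; rewrite path_length_cons -natr1 addrC lerD ?IH //; exact: H.
Qed.

Lemma level_path (lv : 'I_n -> nat) h u p : (forall a b, adj h a b -> (lv b <= (lv a).+1)%N) ->
  path (adj h) u p -> (lv (last u p) <= lv u + size p)%N.
Proof.
move=> H; elim: p u => [|b p IH] u /=; first by rewrite addn0.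
move=> /andP[ab pp]; apply: leq_trans (IH _ pp) _.
by rewrite addnS -addSn leq_add2r; exact: H.
Qed.

Lemma dist_le_edge w a b : a != b -> adj w a b -> (dist w a b <= (weight w a b)%:E)%E.
Proof.
move=> ab wab; apply: ereal_inf_lbound; exists [:: b]; last first.
  by rewrite path_length_cons path_length_nil addr0.
by rewrite /is_path /= wab /= inE ab eqxx.
Qed.

Lemma dist_ge1 w a b : (forall a b, adj w a b -> 1 <= weight w a b) -> a != b ->
  (1%:E <= dist w a b)%E.
Proof.
move=> H ab; apply: le_ereal_inf_tmp => _ [p pp <-]; rewrite lee_fin.
move: pp => /and3P[pp _ /eqP lp].
apply: le_trans (size_le_length H pp); rewrite ler1n.
by case: p lp {pp} => //= ab'; rewrite ab' eqxx in ab.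
Qed.

(** The weights of [h] are free, but distances in [h] are no smaller than in [w], so its edges weigh
    at least 1. A path that avoids [uv] climbs at most one level per edge and is therefore longer
    than [t]. *)
Lemma spanner_needs_edge (t : R) w h (lv : 'I_n -> nat) u v :
  spanner t w h -> 0 <= t -> (forall a b, adj w a b -> 1 <= weight w a b) ->
  u != v -> weight w u v = 1 ->
  (forall a b, adj w a b -> [set a; b]%SET != [set u; v]%SET -> (lv b <= (lv a).+1)%N) ->
  t < (lv v - lv u)%N%:R -> weight h u v != 0.
Proof.
move=> [h0 hw sp] t0 w1 uv wuv lvw tL; apply/negP => /eqP huv.
have ahw a b : adj h a b -> adj w a b.
  rewrite /adj; case: (weight_cases a b) => [->|[e Ee eqe]]; first by rewrite eqxx.
  by rewrite !eqe; exact: hw.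
have h1 a b : adj h a b -> 1 <= weight h a b.
  move=> ab; have ne : a != b by apply: contraTneq ab => ->; rewrite /adj weight_diag eqxx.
  have := dist_ge1 w1 ne; have [le _] := sp a b => /le_trans/(_ le).
  by move=> /le_trans/(_ (dist_le_edge ne ab)); rewrite lee_fin.
have hl a b : adj h a b -> (lv b <= (lv a).+1)%N.
  move=> ab; apply: lvw; first exact: ahw.
  apply/eqP => E; move: ab; rewrite /adj; have -> : weight h a b =
    weight h u v by rewrite /weight E.
  by rewrite huv eqxx.
have auv : adj w u v by rewrite /adj wuv oner_neq0.
have duv : (dist w u v <= 1%:E)%E by have := dist_le_edge uv auv; rewrite wuv.
have dh : (dist h u v <= t%:E)%E.
  have [_ le] := sp u v; apply: le_trans le _.
  by rewrite -[leRHS]mule1; apply: lee_wpmul2l; rewrite ?lee_fin.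
have : (dist h u v < ((lv v - lv u)%N%:R : R)%:E)%E by apply: le_lt_trans dh _; rewrite lte_fin.
move=> /ereal_inf_lt[_ [p /and3P[pp _ /eqP lp] <-]]; rewrite lte_fin ltNge => /negP; apply.
apply: le_trans (size_le_length h1 pp); rewrite ler_nat leq_subLR.
by have := level_path hl pp; rewrite lp.
Qed.

Lemma ratio_le2 w : (forall e, is_edge w e -> 1 <= w e <= 2) -> (exists e, is_edge w e) ->
  ratio_le 2 w.
Proof.
move=> H [e0 He0]; split; first by exists e0.
have mx2 : wmax w <= 2.
  rewrite /wmax; elim/big_ind: _ => // [x y x2 y2|e _]; first by rewrite ge_max x2.
  have [z|/H/andP[]//] := eqVneq (w e) 0; by rewrite z.
have mx1 : 1 <= wmax w.
  have /andP[w1 _] := H _ He0; apply: le_trans w1 _; rewrite /wmax (bigD1 e0) //= le_max lexx //.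
have mn : 1 <= wmin w.
  rewrite /wmin; elim/big_ind: _ => // [x y x2 y2|e /H/andP[]//]; by rewrite le_min x2.
rewrite ler_pdivrMr ?(lt_le_trans ltr01) //; lra.
Qed.

Lemma enum_paths : exists f : nat -> option (seq 'I_n), forall p, exists k, f k = Some p.
Proof. by exists unpickle => p; exists (pickle p); exact: pickleK. Qed.

Section Measurability.
Variables (d : measure_display) (T : measurableType d) (h : T -> vpair n -> R).
Hypothesis mh : forall e, measurable_fun setT (fun om => h om e).

Lemma measurable_weight a b : measurable_fun setT (fun om => weight (h om) a b).
Proof.
case: (weight_cases a b) => [z|[e _ E]].
  by under eq_fun => om do rewrite z; exact: measurable_cst.
by rewrite (_ : (fun om => _) = (fun om => h om e)) //; apply: funext => om; exact: E.
Qed.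

Lemma measurable_neq0 (f : T -> R) : measurable_fun setT f -> measurable [set om | f om != 0].
Proof.
move=> mf; have -> : [set om | f om != 0] = f @^-1` (~` [set 0]).
  by apply/seteqP; split => om /= => [/eqP|/eqP].
rewrite -[X in measurable X]setTI; apply: mf => //; exact: measurableC.
Qed.

Lemma measurable_forall (I : finType) (A : I -> set T) : (forall i, measurable (A i)) ->
  measurable [set om | forall i, A i om].
Proof.
move=> mA; have -> : [set om | forall i, A i om] = \bigcap_(i in [set: I]) A i.
  by apply/seteqP; split => om /= H i; [move=> _|]; exact: H.
by apply: fin_bigcap_measurable => //; exact: finite_finset.
Qed.

Lemma measurable_path u p : measurable [set om | path (adj (h om)) u p].
Proof.
elim: p u => [|b p IH] u /=.
  by rewrite (_ : [set _ | _] = setT) //; apply/seteqP; split.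
have -> : [set om | adj (h om) u b && path (adj (h om)) b p] =
   [set om | weight (h om) u b != 0] `&` [set om | path (adj (h om)) b p].
  apply/seteqP; split => om /=; rewrite /adj; first by move=> /andP[].
  by move=> [? ?]; apply/andP.
by apply: measurableI => //; apply: measurable_neq0; exact: measurable_weight.
Qed.

Lemma measurable_is_path u v p : measurable [set om | is_path (h om) u v p].
Proof.
rewrite /is_path; case: (uniq (u :: p)); case: (last u p == v) => /=.
- rewrite (_ : [set _ | _] = [set om | path (adj (h om)) u p]); first exact: measurable_path.
  by apply/seteqP; split => om /=; rewrite andbT.
- by rewrite (_ : [set _ | _] = set0) //; apply/seteqP; split => om //=; rewrite andbF.
- by rewrite (_ : [set _ | _] = set0) //; apply/seteqP; split => om //=; rewrite andbF.
- by rewrite (_ : [set _ | _] = set0) //; apply/seteqP; split => om //=; rewrite andbF.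
Qed.

Lemma measurable_path_length u p : measurable_fun setT (fun om => path_length (h om) u p).
Proof.
elim: p u => [|b p IH] u.
  by under eq_fun => om do rewrite path_length_nil; exact: measurable_cst.
under eq_fun => om do rewrite path_length_cons.
by apply: measurable_funD; [exact: measurable_weight|exact: IH].
Qed.

(** An infimum is below [c] when some path is, and vertex sequences are countable. The other
    comparisons are derived from this form or from its complement for a single path. *)
Lemma measurable_dist_lt u v (c : R) : measurable [set om | (dist (h om) u v < c%:E)%E].
Proof.
have [f fp] := enum_paths.
have -> : [set om | (dist (h om) u v < c%:E)%E] = \bigcup_(k : nat)
   (if f k is Some p then [set om | is_path (h om) u v p] `&` [set om | path_length (h om) u p <
     c] else set0).
  apply/seteqP; split => om /=.
    move=> /ereal_inf_lt[_ [p pp <-]]; rewrite lte_fin => lt.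
    by have [k fk] := fp p; exists k => //; rewrite fk.
  move=> [k _]; case: (f k) => // p [pp lt].
  apply: le_lt_trans (_ : ((path_length (h om) u p)%:E < c%:E)%E); last by rewrite lte_fin.
  by apply: ereal_inf_lbound; exists p.
apply: bigcupT_measurable => k; case: (f k) => // p.
apply: measurableI; first exact: measurable_is_path.
have -> : [set om | path_length (h om) u p < c] = (fun om => path_length (h om) u p) @^-1` `]-oo,
  c[%classic.
  by apply/seteqP; split => om /=; rewrite in_itv.
by rewrite -[X in measurable X]setTI; exact: measurable_path_length.
Qed.

Lemma measurable_dist_le u v (c : \bar R) : measurable [set om | (dist (h om) u v <= c)%E].
Proof.
case: c => [r| |].
- have -> : [set om | (dist (h om) u v <= r%:E)%E] =
     \bigcap_(k : nat) [set om | (dist (h om) u v < (r + k.+1%:R^-1)%:E)%E].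
    apply/seteqP; split => om /=.
      by move=> le k _; apply: le_lt_trans le _; rewrite lte_fin ltrDl invr_gt0.
    move=> H; apply/lee_addgt0Pr => e e0.
    have [k ke] : exists k, k.+1%:R^-1 <= e.
      exists (Num.truncn e^-1); rewrite -[leRHS]invrK lef_pV2 ?posrE ?invr_gt0 //.
      by rewrite ltW // truncnS_gt // invr_ge0 ltW.
    by apply: ltW; apply: lt_le_trans (H k I) _; rewrite -EFinD lee_fin lerD2l.
  by apply: bigcapT_measurable => k; exact: measurable_dist_lt.
- by rewrite (_ : [set _ | _] = setT) //; apply/seteqP; split => om //= _; rewrite leey.
- have -> : [set om | (dist (h om) u v <= -oo)%E] =
     \bigcap_(k : nat) [set om | (dist (h om) u v < (- k%:R)%:E)%E].
    apply/seteqP; split => om /=.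
      by rewrite leeNy_eq => /eqP E k _ /=; rewrite E ltNyr.
    move=> H; rewrite leNgt; apply/negP.
    case E : (dist (h om) u v) => [r| |] // _.
      have := H (Num.truncn `|r|).+1 I; rewrite /= E lte_fin ltNge => /negP; apply.
      rewrite lerNl; apply: le_trans (_ : `|r| <= _); first by rewrite -normrN ler_norm.
      by rewrite ltW // truncnS_gt.
    by have := H 0%N I; rewrite /= E.
  by apply: bigcapT_measurable => k; exact: measurable_dist_lt.
Qed.

Lemma measurable_dist_ge u v (c : \bar R) : measurable [set om | (c <= dist (h om) u v)%E].
Proof.
have [f fp] := enum_paths.
have -> : [set om | (c <= dist (h om) u v)%E] = \bigcap_(k : nat)
   (if f k is Some p then ~` [set om | is_path (h om) u v p] `|` [set om | (c <=
     (path_length (h om) u p)%:E)%E] else setT).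
  apply/seteqP; split => om /=.
    move=> le k _; case: (f k) => // p /=; have [pp|npp] := boolP (is_path (h om) u v p);
      last by left.
    by right; apply: le_trans le _; apply: ereal_inf_lbound; exists p.
  move=> H; apply: le_ereal_inf_tmp => _ [p pp <-].
  by have [k fk] := fp p; have := H k I; rewrite fk => -[].
apply: bigcapT_measurable => k; case: (f k) => // p.
apply: measurableU; first by apply: measurableC; exact: measurable_is_path.
case: c => [r| |].
- have -> : [set om | (r%:E <= (path_length (h om) u p)%:E)%E] = (fun om =>
  path_length (h om) u p) @^-1` `[r, +oo[%classic.
    by apply/seteqP; split => om /=; rewrite in_itv /= andbT lee_fin.
  by rewrite -[X in measurable X]setTI; exact: measurable_path_length.
- by rewrite (_ : [set _ | _] = set0) //; apply/seteqP; split => om //=; rewrite leye_eq.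
- by rewrite (_ : [set _ | _] = setT) //; apply/seteqP; split => om //= _; rewrite leNye.
Qed.

Lemma measurable_spanner (t : R) w : measurable [set om | spanner t w (h om)].
Proof.
have -> : [set om | spanner t w (h om)] =
   [set om | forall e, [set om | 0 <= h om e] om] `&`
   ([set om | forall e, [set om | is_edge (h om) e -> is_edge w e] om] `&`
    [set om | forall u, [set om | forall v, ([set om | (dist w u v <= dist (h om) u v)%E] `&`
       [set om | (dist (h om) u v <= t%:E * dist w u v)%E]) om] om]).
  by apply/seteqP; split => om /= [] // a [b c]; split.
apply: measurableI; first apply: measurable_forall => e.
  have -> : [set om | 0 <= h om e] = (fun om => h om e) @^-1` `[0, +oo[%classic.
    by apply/seteqP; split => om /=; rewrite in_itv /= andbT.
  by rewrite -[X in measurable X]setTI; exact: mh.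
apply: measurableI; [apply: measurable_forall => e|apply: measurable_forall => u].
  case we : (is_edge w e).
    by rewrite [X in measurable X](_ : _ = setT); [exact: measurableT|apply/seteqP; split].
  have -> : [set om | is_edge (h om) e -> false] = ~` [set om | h om e != 0].
    by apply/seteqP; split => om /= H; [move=> /H|move=> /H].
  by apply: measurableC; exact: measurable_neq0.
apply: measurable_forall => v; apply: measurableI;
  [exact: measurable_dist_ge|exact: measurable_dist_le].
Qed.

End Measurability.
End GraphFacts.

(** * One placement: graphs with and without the edge uv *)

Lemma weight_lin (R : realType) (n N : nat) (Phi : 'I_N -> vpair n -> R) (y : 'I_N -> R) a b :
  weight (fun e => \sum_l y l * Phi l e) a b = \sum_l y l * weight (Phi l) a b.
Proof.
case: (weight_cases R a b) => [z|[e _ E]].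
  by rewrite z big1 // => l _; rewrite z mulr0.
by rewrite E; apply: eq_bigr => l _; rewrite E.
Qed.

Lemma prod_ge1B (R : realType) (E : eqType) (es : seq E) (f : E -> R) :
  (forall e, 0 <= f e <= 1) -> 1 - \sum_(e <- es) f e <= \prod_(e <- es) (1 - f e).
Proof.
move=> f01; have p1 s : 0 <= \prod_(e <- s) (1 - f e) <= 1.
  elim: s => [|e s IH]; first by rewrite big_nil ler01 lexx.
  rewrite big_cons; have /andP[a b] := f01 e; have /andP[c d] := IH.
  apply/andP; split; first by rewrite mulr_ge0 // subr_ge0.
  by rewrite mulr_ile1 // ?subr_ge0 //; lra.
elim: es => [|e s IH]; first by rewrite !big_nil subr0.
rewrite !big_cons; have /andP[a b] := f01 e; have /andP[c d] := p1 s; nra.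
Qed.

Section PerPlacement.
Variables (R : realType) (n N : nat) (Sk : linear_sketch R n N).
Variables (L r s : nat) (x : slot L r s -> 'I_n) (est : vpair n).
Hypothesis xinj : injective x.
Hypothesis estE : val est = [set x (uslot L r s); x None]%SET.
Hypothesis L1 : (0 < L)%N.

Definition block_edge (e : vpair n) : bool :=
  [exists p, exists q, close p q && (val e == [set x p; x q]%SET)].

Definition W0 (w : vpair n -> R) (e : vpair n) : R := if block_edge e then w e else 0.
Definition W1 (w : vpair n -> R) (e : vpair n) : R := if e == est then 1 else W0 w e.
(** [F0] and [F1] are the two errors: reporting the edge [uv] when it is absent, and omitting it
    when it is present. *)
Definition F0 (om : sk_space Sk) w : R := (output om (W0 w) est != 0)%:R.
Definition F1 (om : sk_space Sk) w : R := (output om (W1 w) est == 0)%:R.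
Definition bes : seq (vpair n) := [seq e <- enum {: vpair n} | block_edge e].

Lemma mem_bes e : (e \in bes) = block_edge e.
Proof. by rewrite mem_filter mem_enum andbT. Qed.

Lemma pair_eq (a b c d : slot L r s) : [set x a; x b]%SET = [set x c; x d]%SET ->
  #|[set x a; x b]%SET| = 2 -> (a = c /\ b = d) \/ (a = d /\ b = c).
Proof.
move=> E c2.
have ab : a != b by apply: contra_eqN c2 => /eqP->; rewrite finset.setUid cards1.
have : x a \in [set x c; x d]%SET by rewrite -E !inE eqxx.
have : x b \in [set x c; x d]%SET by rewrite -E !inE eqxx orbT.
rewrite !inE !(inj_eq xinj) => /orP[]/eqP bE /orP[]/eqP aE; subst.
- by rewrite eqxx in ab.
- by right.
- by left.
- by rewrite eqxx in ab.
Qed.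

Lemma est_notin : block_edge est = false.
Proof.
apply/negbTE/negP => /existsP[p /existsP[q /andP[cl /eqP E]]].
have c2 := eqP (valP est); rewrite estE in E c2.
have nc : close (uslot L r s) None = false by rewrite /close /= ltnS leqNgt L1 ?andbF.
have nc' : close None (uslot L r s) = false 
  by apply/negbTE/negP; rewrite /close => /andP[] /= h1 h2; move: L1 h1 h2; lia.
by case: (pair_eq E c2) => -[eu ev]; move: cl; rewrite -eu -ev ?nc ?nc'.
Qed.

(** The vector [z] reproduces the column of [uv] on the layered graph, so subtracting it from the
    weights compensates exactly for the added edge of weight 1. *)
Lemma W0_diff om (w w' z : vpair n -> R) :
  (forall l, \sum_e (if block_edge e then sk_mx om l e else 0) * z e = sk_mx om l est) ->
  (forall e, w' e = w e - z e) ->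
  @measurements R n N Sk om (W0 w) = measurements om (W1 w').
Proof.
move=> hz ww; rewrite /measurements; congr [tuple _ | _ < _]; apply: funext => l.
have -> : \sum_e sk_mx om l e * W1 w' e = \sum_e sk_mx om l e * W0 w' e + sk_mx om l est.
  have e1 : W1 w' est = 1 by rewrite /W1 eqxx.
  have e0 : W0 w' est = 0 by rewrite /W0 est_notin.
  rewrite (bigD1 est) //= [in RHS](bigD1 est) //= e1 e0 mulr1 mulr0 add0r addrC.
  by congr (_ + _); apply: eq_bigr => e /negPf ne; rewrite /W1 ne.
rewrite -hz -big_split; apply: eq_bigr => e _ /=; rewrite /W0 ww.
by case: ifP => _; rewrite ?mulr0 ?mul0r ?addr0 //; ring.
Qed.

(** As [x] is injective, an edge comes from at most two ordered pairs of positions. *)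
Lemma energy_edges (Y : vpair n -> R) :
  \sum_p \sum_(q | close p q) weight Y (x p) (x q) ^+ 2 <=
  2 * \sum_e (if block_edge e then Y e else 0) ^+ 2.
Proof.
have sq a b : weight Y a b ^+ 2 = \sum_(e : vpair n) (val e == [set a; b]%SET)%:R * Y e ^+ 2.
  have [e _ E|ns] := insubP {e : {set 'I_n} | #|e| == 2} [set a; b]%SET.
    rewrite (weight_edge Y E) (bigD1 e) //= E eqxx mul1r big1 ?addr0 // => e' ne.
    by rewrite -E (inj_eq val_inj) (negPf ne) mul0r.
  rewrite /weight insubN // expr0n big1 // => e _.
  case: eqP => [E|_]; last by rewrite mul0r.
  by move: ns; rewrite -E (valP e).
under eq_bigr => p _ do under eq_bigr => q _ do rewrite sq.
rewrite (eq_bigr (fun p => \sum_e \sum_(q | close p q) (val e == [set x p;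
  x q]%SET)%:R * Y e ^+ 2)) => [|p _]; last first.
  by rewrite exchange_big.
rewrite exchange_big mulr_sumr; apply: ler_sum => e _ /=.
under eq_bigr => p _ do rewrite -mulr_suml.
rewrite -mulr_suml.
have [be|nbe] := boolP (block_edge e); last first.
  rewrite expr0n mulr0 big1 ?mul0r // => p _; rewrite big1 // => q cl.
  case: eqP => // E; case/negP: nbe; apply/existsP; exists p; apply/existsP; exists q.
  by apply/andP; split => //; exact/eqP.
rewrite ler_wpM2r ?sqr_ge0 //.
move: be => /existsP[p0 /existsP[q0 /andP[_ /eqP E0]]].
have c2 : #|[set x p0; x q0]%SET| = 2 by rewrite -E0; exact/eqP/(valP e).
apply: (@le_trans _ _ (\sum_p \sum_q (((p, q) == (p0, q0)) + ((p, q) == (q0, p0)))%:R)).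
  apply: ler_sum => p _; rewrite big_mkcond; apply: ler_sum => q _.
  case: ifP => _; last by rewrite ler0n.
  rewrite ler_nat; case: eqP => // E; rewrite E0 in E.
  by case: (pair_eq E c2) => -[-> ->]; rewrite eqxx // addn1.
rewrite pair_bigA /= (eq_bigr (fun p => ((p == (p0, q0))%:R + (p == (q0, p0))%:R : R))) =>
  [|[p q] _]; last by rewrite natrD.
rewrite big_split /=.
have one (c : slot L r s * slot L r s) : \sum_p ((p == c)%:R : R) = 1.
  by rewrite (bigD1 c) //= eqxx big1 ?addr0 // => p /negPf->.
by rewrite !one.
Qed.

(** The value 0 off the placement is a dummy: such vertices carry no edge. *)
Definition vlev (a : 'I_n) : nat := if [pick p | x p == a] is Some p then slev p else 0.

Lemma vlevE p : vlev (x p) = slev p.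
Proof.
rewrite /vlev; case: pickP => [q /eqP/xinj->//|/(_ p)]; by rewrite eqxx.
Qed.

Lemma block_edge_exists : exists e, block_edge e.
Proof.
pose p1 : slot L r s := Some (inord 1, ord0, ord0).
have ne : x (uslot L r s) != x p1.
  rewrite (inj_eq xinj); apply/eqP => -[] /(congr1 (fun i : 'I_L.+1 => i : nat)).
  by rewrite /= inordK.
have c2 : #|[set x (uslot L r s); x p1]%SET| == 2 by rewrite cards2 ne.
exists (exist (fun e : {set 'I_n} => #|e| == 2) [set x (uslot L r s); x p1]%SET c2);
  apply/existsP; exists (uslot L r s); apply/existsP; exists p1.
by rewrite eqxx andbT /close /= inordK.
Qed.

Lemma weight_W1 w : (forall e, e \in bes -> 1 <= w e <= 2) -> forall e, is_edge (W1 w) e -> 1 <=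
  W1 w e <= 2.
Proof.
move=> hw e; rewrite /is_edge /W1 /W0; case: (e == est); first by move=> _; apply/andP; split =>
  //; rewrite ler1n.
by case: ifP => [be _|_]; [apply: hw; rewrite mem_bes|rewrite eqxx].
Qed.

Lemma weight_W0 w : (forall e, e \in bes -> 1 <= w e <= 2) -> forall e, is_edge (W0 w) e -> 1 <=
  W0 w e <= 2.
Proof.
move=> hw e; rewrite /is_edge /W0.
by case: ifP => [be _|_]; [apply: hw; rewrite mem_bes|rewrite eqxx].
Qed.

Lemma edge_nonneg (w : vpair n -> R) : (forall e, is_edge w e -> 1 <= w e <= 2) -> nonneg w.
Proof.
move=> H e; have [->//|/H/andP[h _]] := eqVneq (w e) 0; exact: le_trans ler01 h.
Qed.

Lemma measurable_output (d : measure_display) (T : measurableType d)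
    (phi : T -> sk_space Sk) (y : T -> vpair n -> R) e :
  measurable_fun setT phi -> (forall e, measurable_fun setT (fun t => y t e)) ->
  measurable_fun setT (fun t => output (phi t) (y t) e).
Proof.
move=> mphi my; rewrite /output.
apply: (measurableT_comp (@sk_recover_measurable R n N Sk e)
   (g := fun t => (phi t, measurements (phi t) (y t)))).
apply: measurable_fun_pair => //.
apply/measurable_fun_tnthP => l; rewrite /measurements.
rewrite (_ : _ \o _ = fun t => \sum_e sk_mx (phi t) l e * y t e); last first.
  by apply: funext => t /=; rewrite tnth_mktuple.
apply: measurable_sum => e'; apply: measurable_funM => //.
exact: (measurableT_comp (@sk_mx_measurable R n N Sk l e') mphi).
Qed.

Lemma measurable_bool (d : measure_display) (T : measurableType d) (b : T -> bool) :
  measurable [set t | b t] -> measurable_fun setT (fun t => (b t)%:R : R).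
Proof.
move=> mb; rewrite (_ : (fun t => _) = \1_[set t | b t]); first exact: measurable_indic.
apply: funext => t; rewrite indicE; congr (_%:R).
by have [bt|nbt] := boolP (b t); [rewrite mem_set|rewrite memNset //; exact/negP].
Qed.

Lemma measurable_W0 (d : measure_display) (T : measurableType d) (y : T -> vpair n -> R) :
  (forall e, measurable_fun setT (fun t => y t e)) ->
  forall e, measurable_fun setT (fun t => W0 (y t) e).
Proof. by move=> my e; rewrite /W0; case: (block_edge e) => //; exact: measurable_cst. Qed.

Lemma measurable_W1 (d : measure_display) (T : measurableType d) (y : T -> vpair n -> R) :
  (forall e, measurable_fun setT (fun t => y t e)) ->
  forall e, measurable_fun setT (fun t => W1 (y t) e).
Proof. by move=> my e; rewrite /W1; case: (e == est);
  [exact: measurable_cst|exact: measurable_W0]. Qed.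

Lemma jmeas_F0 : jmeas F0.
Proof.
move=> d T phi y mphi my; apply: measurable_bool; apply: measurable_neq0.
by apply: measurable_output => //; exact: measurable_W0.
Qed.

Lemma jmeas_F1 : jmeas F1.
Proof.
move=> d T phi y mphi my; apply: measurable_bool.
rewrite (_ : [set t | _] = ~` [set t | output (phi t) (W1 (y t)) est != 0]).
  by apply: measurableC; apply: measurable_neq0; apply: measurable_output => //;
    exact: measurable_W1.
by apply/seteqP; split => t /=; [move=> ->|move=> /negP; rewrite negbK].
Qed.

Lemma unit_F0 om : unit_valued (F0 om).
Proof. by move=> w; rewrite /F0; case: (_ != _); rewrite ?ler01 ?lexx. Qed.

Lemma unit_F1 om : unit_valued (F1 om).
Proof. by move=> w; rewrite /F1; case: (_ == _); rewrite ?ler01 ?lexx. Qed.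

Lemma event_le (delta : R) (A : set (sk_space Sk)) (b : sk_space Sk -> bool) :
  measurable A -> measurable [set om | b om] -> (forall om, A om -> ~~ b om) ->
  ((1 - delta)%:E <= sk_prob Sk A)%E -> (\int[sk_prob Sk]_om ((b om)%:R)%:E <= delta%:E)%E.
Proof.
move=> mA mb Ab pA.
have -> : (\int[sk_prob Sk]_om ((b om)%:R : R)%:E = sk_prob Sk [set om | b om])%E.
  rewrite -[X in sk_prob Sk X]setIT -integral_indic //; apply: eq_integral => om _;
    rewrite indicE; congr ((_%:R)%:E).
  by have [bt|nbt] := boolP (b om); [rewrite mem_set|rewrite memNset //; exact/negP].
apply: le_trans (_ : sk_prob Sk (~` A) <= _)%E.
  apply: le_measure; rewrite ?inE //; first exact: measurableC.
  by move=> om bo /Ab; rewrite bo.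
rewrite probability_setC //.
rewrite leeBlDr; last by apply: fin_num_measure.
rewrite -leeBlDl // -EFinB //.
Qed.

Variables (t delta : R).
Hypothesis comp : computes_spanner 2 delta t Sk.
Hypothesis t0 : 0 <= t.
Hypothesis tL : t < L.+1%:R.

Lemma event_F0 w : (forall e, e \in bes -> 1 <= w e <= 2) ->
  (\int[sk_prob Sk]_om (F0 om w)%:E <= delta%:E)%E.
Proof.
move=> hw; have hW := weight_W0 hw.
have nn := edge_nonneg hW.
have ex : exists e, is_edge (W0 w) e.
  have [e be] := block_edge_exists; exists e; rewrite /is_edge /W0 be.
  by have /andP[w1 _] := hw e ltac:(by rewrite mem_bes); rewrite gt_eqF // (lt_le_trans ltr01).
apply: (@event_le delta [set om | spanner t (W0 w) (output om (W0 w))] (fun om =>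
  output om (W0 w) est != 0)).
- apply: measurable_spanner => e; apply: (measurable_output (phi := id) (y := fun=> W0 w)) => //.
- apply: measurable_neq0; exact: (measurable_output (phi := id) (y := fun=> W0 w)).
- move=> om [_ sub _]; rewrite negbK; apply: contraT => ne; have := sub est ne.
  by rewrite /is_edge /W0 est_notin eqxx.
- exact: (comp nn (ratio_le2 hW ex)).
Qed.

Lemma event_F1 w : (forall e, e \in bes -> 1 <= w e <= 2) ->
  (\int[sk_prob Sk]_om (F1 om w)%:E <= delta%:E)%E.
Proof.
move=> hw; have hW := weight_W1 hw.
have nn := edge_nonneg hW.
have ex : exists e, is_edge (W1 w) e by exists est; rewrite /is_edge /W1 eqxx oner_neq0.
have uv : x (uslot L r s) != x None by rewrite (inj_eq xinj).
apply: (@event_le delta [set om | spanner t (W1 w) (output om (W1 w))] (fun om =>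
  output om (W1 w) est == 0)).
- apply: measurable_spanner => e; apply: (measurable_output (phi := id) (y := fun=> W1 w)) => //.
- rewrite (_ : [set _ | _] = ~` [set om | output om (W1 w) est != 0]).
    by apply: measurableC; apply: measurable_neq0; exact: (measurable_output (phi := id) (y :=
      fun=> W1 w)).
  by apply/seteqP; split => om /=; [move=> ->|move=> /negP; rewrite negbK].
- move=> om sp; rewrite -(weight_edge _ estE).
  apply: (@spanner_needs_edge _ _ t (W1 w) _ vlev _ _ sp) => //.
  + move=> a b; rewrite /adj; case: (weight_cases R a b) => [->|[e _ E]]; first by rewrite eqxx.
    by rewrite !E => /hW/andP[].
  + by rewrite (weight_edge _ estE) /W1 eqxx.
  + move=> a b; rewrite /adj; case: (weight_cases R a b) => [->|[e Ee E]]; first by rewrite eqxx.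
    rewrite E -Ee -estE (inj_eq val_inj) /W1 => + /negPf ne; rewrite ne /W0.
    case: ifP => [/existsP[p /existsP[q /andP[cl /eqP Epq]]] _|_]; last by rewrite eqxx.
    rewrite Ee in Epq.
    have : a \in [set x p; x q]%SET by rewrite -Epq !inE eqxx.
    have : b \in [set x p; x q]%SET by rewrite -Epq !inE eqxx orbT.
    move: cl => /andP[c1 c2].
    by rewrite !inE => /orP[]/eqP-> /orP[]/eqP->; rewrite !vlevE // ?leqnSn.
  + by rewrite !vlevE /= subn0.
- exact: (comp nn (ratio_le2 hW ex)).
Qed.

End PerPlacement.

Section Indistinguishable.
Variables (R : realType) (n N : nat) (Sk : linear_sketch R n N).
Variables (L r s : nat) (x : slot L r s -> 'I_n) (est : vpair n).
Hypothesis xinj : injective x.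
Hypothesis estE : val est = [set x (uslot L r s); x None]%SET.
Hypothesis L1 : (0 < L)%N.
Variable g : R -> R.
Hypothesis mg : measurable_fun setT g.
Hypothesis g0 : forall t, 0 <= g t.
Hypothesis gsupp : forall t, g t != 0 -> 1 <= t <= 2.
Hypothesis g1 : lint (fun t => g t ^+ 2) = 1%E.
Hypothesis glip : forall t t', (g t - g t') ^+ 2 <= 32 * (t - t') ^+ 2.

(** The hypothesis and [riesz_bound] give a shift [z] of squared norm at most [C] that hides [uv].
    Tensorization then yields [1 - 48 * C], at least 1/2, as a lower bound for the sum of the square
    roots of the two error probabilities, so their sum is at least 1/8. *)
Lemma indistinguishable (om : sk_space Sk) (C : R) :
  0 <= C -> 48 * C <= 1 / 2 ->
  (forall y : 'I_N -> R, (\sum_l y l * sk_mx om l est) ^+ 2 <=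
     C * \sum_e (if block_edge x e then \sum_l y l * sk_mx om l e else 0) ^+ 2) ->
  1 / 8 <= iint g (bes x) (F0 x est om) (fun=> 0) + iint g (bes x) (F1 x est om) (fun=> 0).
Proof.
move=> C0 C1 H.
pose G (l : 'I_N) (e : vpair n) : R := if block_edge x e then sk_mx om l e else 0.
have combE y e : comb G y e = if block_edge x e then \sum_l y l * sk_mx om l e else 0.
  by rewrite /comb /G; case: ifP => // _; rewrite big1 // => l _; rewrite mulr0.
have [|y0 hy0 hC] := @riesz_bound R _ _ G (fun l => sk_mx om l est) C C0.
  move=> y; apply: le_trans (H y) _; rewrite ler_wpM2l // /dot le_eqVlt; apply/orP; left.
  by apply/eqP; apply: eq_bigr => e _; rewrite combE expr2.
set z := comb G y0 in hy0 hC.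
have zE e : ~~ block_edge x e -> z e = 0 by move=> ne; rewrite /z combE (negPf ne).
have dz : dot z z = \sum_e z e ^+ 2 by apply: eq_bigr => e _; rewrite expr2.
have zC e : z e ^+ 2 <= C.
  apply: le_trans hC; rewrite dz (bigD1 e) //= lerDl sumr_ge0 // => *; exact: sqr_ge0.
have z48 e : 48 * z e ^+ 2 <= 1 by have := zC e; lra.
(* Equal measurements produce equal outputs, so exactly one of the two errors occurs. *)
have pt (w w' : vpair n -> R) : (forall e, w' e = w e - z e) ->
    1 <= Num.sqrt (F0 x est om w) + Num.sqrt (F1 x est om w').
  move=> ww; rewrite /F0 /F1 /output (W0_diff xinj estE L1 (z := z) _ ww) //.
  by case: (_ == 0); rewrite /= sqrtr0 sqrtr1 ?add0r ?addr0.
have J0 := @jmeas_F0 R n N Sk L r s x est; have J1 := @jmeas_F1 R n N Sk L r s x est.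
have U0 := unit_F0 (Sk := Sk) x est; have U1 := unit_F1 (Sk := Sk) x est.
(* Outside the layered graph [z] vanishes, so both integrals may start from the zero vector. *)
have off e : e \notin bes x -> (fun=> 0 : R) e = (fun=> 0 : R) e - z e.
  by rewrite mem_bes => /zE->; rewrite subr0.
have := @iint_hellinger R _ g mg g0 gsupp g1 glip _ _ _ _ om (bes x) z 1 J0 J1 U0 U1 ler01 z48 pt
  (fun=> 0) (fun=> 0) off.
rewrite mul1r.
set p0 := iint _ _ _ _; set p1 := iint _ _ _ _ => hell.
have h12 : 1 / 2 <= Num.sqrt p0 + Num.sqrt p1.
  apply: le_trans hell; apply: le_trans (prod_ge1B (bes x) _); last first.
    by move=> e; rewrite z48 andbT mulr_ge0 // sqr_ge0.
  rewrite -mulr_sumr.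
  have : \sum_(e <- bes x) z e ^+ 2 <= C.
    apply: le_trans hC; rewrite dz /bes big_filter big_enum_cond /=.
    rewrite [leRHS](bigID (block_edge x)) /= lerDl sumr_ge0 // => *; exact: sqr_ge0.
  lra.
have p00 : 0 <= p0.
  by have [_ /(_ om)/(_ (fun=> 0))/andP[]] := jmeas_iint mg g1 (bes x) J0 U0.
have p10 : 0 <= p1.
  by have [_ /(_ om)/(_ (fun=> 0))/andP[]] := jmeas_iint mg g1 (bes x) J1 U1.
have := sqr_sqrtr p00; have := sqr_sqrtr p10.
have := sqrtr_ge0 p0; have := sqrtr_ge0 p1.
move: h12; move: (Num.sqrt p0) (Num.sqrt p1) => a b ab b0 a0 <- <-.
have := sqr_ge0 (a - b); have : (1 / 2) ^+ 2 <=
  (a + b) ^+ 2 by rewrite lerXn2r ?nnegrE ?addr_ge0 //; lra.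
lra.
Qed.

End Indistinguishable.

(** * Averaging over placements *)

Lemma energy_const_ge0 (R : realType) (K tau1 tau2 : R) L s :
  0 <= K -> 0 <= tau1 -> 0 <= tau2 -> 0 <= energy_const K tau1 tau2 L s.
Proof.
move=> K0 t1 t2; rewrite /energy_const.
have e0 : 0 <= 4 * K / s.+1%:R by rewrite divr_ge0 // mulr_ge0.
by rewrite mulr_ge0 // !addr_ge0 // !mulr_ge0 // sqr_ge0.
Qed.

(** For every sampled matrix at least half of the placements are good, so the average error sum is
    at least 1/16. The spanner guarantee bounds it by 2/40, which is smaller; hence the choice of
    1/40. *)
Lemma sketch_impossible (R : realType) (n N : nat) (Sk : linear_sketch R n N) (t : R)
    (K kap tau1 tau2 : R) (L r s : nat) (emb : slot L r s -> 'I_n) :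
  incidence Sk -> computes_spanner 2 (1 / 40) t Sk -> 0 <= t -> t < L.+1%:R ->
  1 <= K -> 0 < kap -> 0 < tau1 -> 0 < tau2 -> (0 < L)%N -> injective emb ->
  (2 * (s.+1 * (r + 3) + 2) ^ 2 <= n)%N -> 16 * (4 * K / s.+1%:R) <= 1 ->
  failure_bound 'I_n N K kap tau1 tau2 L r s <= 1 / 2 ->
  48 * (4 * energy_const K tau1 tau2 L s) <= 1 / 2 -> False.
Proof.
move=> inc comp t0 tL K1 kap0 tau10 tau20 L1 embI few K16 fb ec.
have [g [mg g0 gsupp g1 glip]] := density_exists R.
pose x (sg : {perm 'I_n}) (p : slot L r s) : 'I_n := sg (emb p).
have xI sg : injective (x sg) by move=> p q /perm_inj/embI.
have /choice[est estE] : forall sg, exists e : vpair n,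
    val e = [set x sg (uslot L r s); x sg None]%SET.
  move=> sg.
  have c2 : #|[set x sg (uslot L r s); x sg None]%SET| == 2 by rewrite cards2 (inj_eq (xI sg)).
  by exists (exist (fun e : {set 'I_n} => #|e| == 2) _ c2).
pose p0 sg (om : sk_space Sk) : R := iint g (bes (x sg)) (F0 (x sg) (est sg) om) (fun=> 0).
pose p1 sg (om : sk_space Sk) : R := iint g (bes (x sg)) (F1 (x sg) (est sg) om) (fun=> 0).
have ec0 : 0 <= energy_const K tau1 tau2 L s by apply: energy_const_ge0; rewrite ltW //; lra.
have J0 sg := jmeas_iint mg g1 (bes (x sg)) (@jmeas_F0 R n N Sk L r s (x sg) (est sg)) (unit_F0
  (Sk := Sk) (x sg) (est sg)).
have J1 sg := jmeas_iint mg g1 (bes (x sg)) (@jmeas_F1 R n N Sk L r s (x sg) (est sg)) (unit_F1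
  (Sk := Sk) (x sg) (est sg)).
have p0_ge0 sg om : 0 <= p0 sg om by have [_ /(_ om)/(_ (fun=> 0))/andP[]] := J0 sg.
have p1_ge0 sg om : 0 <= p1 sg om by have [_ /(_ om)/(_ (fun=> 0))/andP[]] := J1 sg.
have mp0 sg : measurable_fun setT (p0 sg).
  have [j _] := J0 sg; apply: (j _ _ id (fun _ => fun=> 0)) => // e; exact: measurable_cst.
have mp1 sg : measurable_fun setT (p1 sg).
  have [j _] := J1 sg; apply: (j _ _ id (fun _ => fun=> 0)) => // e; exact: measurable_cst.
pose m : R := #|{perm 'I_n}|%:R.
have m0 : 0 < m by rewrite ltr0n; apply/card_gt0P; exists 1%g.
(* The set of good placements varies with [om], so only the sum over all placements can be compared
   with the expectation. *)
have lower om : m / 16 <= \sum_sg (p0 sg om + p1 sg om).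
  have /choice[nu hnu] : forall l, exists v : 'I_n, forall e, sk_mx om l e != 0 -> v \in val e.
    exact: inc.
  (* Each measurement is charged to the vertex that carries it, which splits every matrix entry into
     an [a] part and a [b] part of which one is zero. *)
  pose M a l b : R := if nu l == a then weight (sk_mx om l) a b else 0.
  have Md a l : M a l a = 0 by rewrite /M weight_diag; case: ifP.
  have Mn a l b : M a l b != 0 -> nu l = a by rewrite /M; case: ifP => [/eqP//|]; rewrite eqxx.
  have MM a l b : M a l b + M b l a = weight (sk_mx om l) a b.
    rewrite /M [weight _ b a]weightC.
    have [->|ab] := eqVneq a b; first by rewrite weight_diag; case: ifP; rewrite addr0.
    case: (weight_cases R a b) => [->|[e Ee ->]]; first by do 2!case: ifP => _; rewrite addr0.
    have [->|ne] := eqVneq (sk_mx om l e) 0; first by do 2!case: ifP => _; rewrite addr0.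
    have := hnu _ _ ne; rewrite Ee !inE => /orP[]/eqP->; rewrite eqxx.
      by rewrite (negPf ab) addr0.
    by rewrite eq_sym (negPf ab) add0r.
  have few' : (2 * (s.+1 * (r + 3) + 2) ^ 2 <= #|'I_n|)%N by rewrite card_ord.
  have [good [bad hgood]] := finite_theorem Md Mn K1 kap0 tau10 tau20 L1 embI few' K16.
  have rs y a b : rowsum M y a b + rowsum M y b a = weight (fun e =>
    \sum_l y l * sk_mx om l e) a b.
    rewrite weight_lin /rowsum -big_split; apply: eq_bigr => l _ /=.
    by rewrite -mulrDr MM.
  have pg sg : good sg -> 1 / 8 <= p0 sg om + p1 sg om.
    move=> gs; apply: (@indistinguishable R n N Sk L r s (x sg) (est sg) (xI sg) (estE sg) L1 g
      mg g0 gsupp g1 glip om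
      (4 * energy_const K tau1 tau2 L s)) => //; first by rewrite mulr_ge0.
    move=> y; have := hgood sg gs y; rewrite rs (weight_edge _ (estE sg)) => /le_trans; apply.
    rewrite (_ : 4 * energy_const K tau1 tau2 L s = energy_const K tau1 tau2 L s * 4);
      last by ring.
    rewrite -mulrA ler_wpM2l //.
    have := @energy_edges R n L r s (x sg) (xI sg) (fun e => \sum_l y l * sk_mx om l e).
    under [X in _ -> _ * X <= _]eq_bigr => p _ do under eq_bigr => q _ do rewrite rs.
    rewrite -/(x sg); lra.
  have : \sum_sg (~~ good sg)%:R <= m / 2.
    have := le_trans bad fb; rewrite /avg -/m mulrC ler_pdivrMr // mul1r mulrC; lra.
  have -> : \sum_sg ((~~ good sg)%:R : R) = m - \sum_sg (good sg)%:R.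
    apply/eqP; rewrite eq_sym subr_eq -big_split /= (eq_bigr (fun=> 1)) ?sumr_const // => sg _.
    by case: (good sg); rewrite ?addr0 ?add0r.
  have : \sum_sg ((good sg)%:R / 8 : R) <= \sum_sg (p0 sg om + p1 sg om).
    apply: ler_sum => sg _; case: (boolP (good sg)) => [/pg //|_].
    by rewrite mul0r addr_ge0.
  rewrite -mulr_suml; lra.
have d0 : (0 : R) <= 1 / 40 by lra.
have i0 sg : (\int[sk_prob Sk]_om (p0 sg om)%:E <= (1 / 40)%:E)%E.
  apply: (iint_fubini mg gsupp g1 (@jmeas_F0 R n N Sk L r s (x sg) (est sg)) (unit_F0 (Sk :=
    Sk) (x sg) (est sg)) d0).
  move=> w' hw' _; exact: (event_F0 (xI sg) (estE sg) L1 comp hw').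
have i1 sg : (\int[sk_prob Sk]_om (p1 sg om)%:E <= (1 / 40)%:E)%E.
  apply: (iint_fubini mg gsupp g1 (@jmeas_F1 R n N Sk L r s (x sg) (est sg)) (unit_F1 (Sk :=
    Sk) (x sg) (est sg)) d0).
  move=> w' hw' _; exact: (event_F1 (xI sg) (estE sg) comp t0 tL hw').
have mp sg : measurable_fun setT (fun om => (p0 sg om + p1 sg om)%:E).
  by apply/measurable_EFinP; apply: measurable_funD.
have up : (\int[sk_prob Sk]_om (\sum_sg (p0 sg om + p1 sg om))%:E <= (m / 20)%:E)%E.
  under eq_integral => om _ do rewrite -sumEFin.
  rewrite ge0_integral_sum //; last by move=> sg om _; rewrite lee_fin addr_ge0.
  apply: (@le_trans _ _ (\sum_(sg : {perm 'I_n}) (1 / 20)%:E)%E).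
    apply: lee_sum => sg _.
    under eq_integral => om _ do rewrite EFinD.
    rewrite ge0_integralD //; first last.
    - exact/measurable_EFinP.
    - by move=> om _; rewrite lee_fin.
    - exact/measurable_EFinP.
    - by move=> om _; rewrite lee_fin.
    apply: le_trans (leeD (i0 sg) (i1 sg)) _; rewrite -EFinD lee_fin; lra.
  rewrite sumEFin lee_fin.
  have -> : \sum_(sg : {perm 'I_n}) (1 / 20 : R) = m / 20.
    by rewrite sumr_const -[LHS]mulr_natl mul1r.
  by [].
have lo : ((m / 16)%:E <= \int[sk_prob Sk]_om (\sum_sg (p0 sg om + p1 sg om))%:E)%E.
  apply: (@le_trans _ _ (\int[sk_prob Sk]_om (m / 16)%:E)%E).
    have := integral_cst (sk_prob Sk) (@measurableT _ (sk_space Sk)) (m / 16)%:E.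
    by move=> ->; rewrite [X in (_ * X)%E]probability_setT mule1.
  apply: ge0_le_integral => //.
  - by move=> om _; rewrite lee_fin divr_ge0 // ltW.
  - apply/measurable_EFinP; apply: measurable_sum => sg; exact: measurable_funD.
  - by move=> om _; rewrite lee_fin.
have := le_trans lo up; rewrite lee_fin => lu; clear -m0 lu; lra.
Qed.

(** * Choice of parameters *)

(** Raise [y / m <= expR (y / m)] to the power [m]. When [y] is a power of [n], a suitable [m] beats
    any polynomial factor. *)
Lemma expRN_le (R : realType) (y : R) (m : nat) : 0 < y -> (0 < m)%N ->
  expR (- y) <= (m%:R / y) ^+ m.
Proof.
move=> y0 m0; have mR : 0 < m%:R :> R by rewrite ltr0n.
have h : (y / m%:R) ^+ m <= expR y.
  rewrite -[in leRHS](divfK (lt0r_neq0 mR) y) [X in expR X]mulrC expRM_natl.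
  have yy : y / m%:R <= expR (y / m%:R) by apply: le_trans (expR_ge1Dx _); rewrite lerDr.
  by rewrite lerXn2r ?nnegrE ?expR_ge0 // divr_ge0 // ltW.
rewrite expRN -[m%:R / y]invrK invf_div exprVn lef_pV2 ?posrE ?expR_gt0 //.
by rewrite exprn_gt0 // divr_gt0.
Qed.

Lemma slot_embedding (n L r s : nat) : (1 + L.+1 * r.+1 * s.+1 <= n)%N ->
  exists emb : slot L r s -> 'I_n, injective emb.
Proof.
move=> h; have c : (#|{: slot L r s}| <= n)%N by rewrite card_option !card_prod !card_ord -add1n.
exists (fun p => widen_ord c (enum_rank p)) => p q /(congr1 val) /= E.
by apply: enum_rank_inj; apply: val_inj.
Qed.

Lemma powR_exprn (R : realType) (X u : R) k : (X `^ u) ^+ k = X `^ (u * k%:R).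
Proof. by rewrite powRrM powR_mulrn // powR_ge0. Qed.

(** One summand for each summand of [failure_bound] with 20 blocks per level; [32 * 48] comes from
    [32 * 4 ^ 2 * 3], since [2 s + 1] is at most three times the block size. *)
Definition failure_const (R : realType) (Z tau : R) : R :=
  2 * (4 + 80 * Z + (32 * 48) + 1 + 20 * 2 ^+ 20 + 800 * (32 * 48) / tau + 5 * (32 * 48) / tau).

Lemma failure_const_ge (R : realType) (Z tau : R) : 0 <= Z -> 0 < tau ->
  2000 * 2000 <= failure_const Z tau.
Proof.
move=> Z0 tau0; have i0 : 0 <= tau^-1 by rewrite invr_ge0 ltW.
rewrite /failure_const; lra.
Qed.

Lemma failure_bound_le (R : realType) (V : finType) (N L s : nat) (K kap tau S Lr q Z : R) :
  1 <= K -> 0 < kap -> 0 < tau -> 0 < S -> 1 <= Lr -> 0 <= q ->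
  S <= s.+1%:R -> L%:R <= Lr ->
  4 * N%:R / (K * #|V|%:R) <= 4 * q ->
  #|V|%:R ^+ 3 * expR (- (S / (512 * K ^+ 4))) <= Z * q ->
  Lr <= #|V|%:R -> K ^+ 2 <= #|V|%:R ->
  K ^+ 2 / S <= q * kap ^+ 2 -> kap <= q -> kap <= 1 -> Lr * kap ^+ 20 <= q ->
  Lr * K ^+ 2 / S ^+ 2 <= q ->
  failure_bound V N K kap tau tau L 19 s <=
    failure_const Z tau * q.
Proof.
move=> K1 kap0 tau0 S0 Lr1 q0 Ss LL hN hZ LV KV hpb hkq hk1 hk20 hLK.
have [c [c0 cE]] : exists c : R, 0 <= c /\ c = 32 * 48 by exists (32 * 48); split => //; lra.
have K0 : 0 < K by lra.
have S1 : 0 < s.+1%:R :> R by rewrite ltr0n.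
have L0 : 0 <= L%:R :> R by rewrite ler0n.
have K20 : 0 <= K ^+ 2 by rewrite sqr_ge0.
have pbE : 32 * (4 * K / s.+1%:R) ^+ 2 * (2 * s.+1 + 1)%:R <= c * (K ^+ 2 / S).
  have a1 : (2 * s.+1 + 1)%:R <= 3 * s.+1%:R :> R.
    have s0 := ler0n R s; rewrite natrD natrM -natr1; lra.
  apply: (@le_trans _ _ (32 * (4 * K / s.+1%:R) ^+ 2 * (3 * s.+1%:R))).
    by rewrite ler_wpM2l // mulr_ge0 // sqr_ge0.
  have -> : 32 * (4 * K / s.+1%:R) ^+ 2 * (3 * s.+1%:R) = c * (K ^+ 2 / s.+1%:R).
    by rewrite cE; field; rewrite gt_eqF.
  by do 2!apply: ler_wpM2l => //; rewrite lef_pV2 ?posrE.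
have pb0 : 0 <= 32 * (4 * K / s.+1%:R) ^+ 2 * (2 * s.+1 + 1)%:R.
  by rewrite mulr_ge0 // mulr_ge0 // sqr_ge0.
rewrite /failure_bound /failure_const; set D := 512 * K ^+ 4 in hZ *.
have D0 : 0 <= D by apply: mulr_ge0; [exact: ler0n|exact: exprn_ge0 (ltW K0)].
move: pbE pb0; set pb := 32 * _ * _ => pbE pb0. clearbody pb D.
rewrite -[leRHS]mulrA; apply: ler_wpM2l; first by [].
have kap20 : 0 < kap ^+ 2 by rewrite exprn_gt0.
have kap21 : kap ^+ 2 <= 1 by rewrite exprn_ile1 // ltW.
have pbq : pb <= c * q * kap ^+ 2 by rewrite -mulrA; apply: le_trans pbE _; apply: ler_wpM2l.
have pbq' : pb <= c * q by apply: le_trans pbq _; apply: ler_piMr => //; apply: mulr_ge0.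
have t2 : L.+1%:R * 20%:R * (2 * #|V|%:R * K ^+ 2 * expR (- (s.+1%:R / D))) <= 80 * Z * q.
  have V0 : 0 <= #|V|%:R :> R by rewrite ler0n.
  have e1 : expR (- (s.+1%:R / D)) <= expR (- (S / D)).
    by rewrite ler_expR lerN2 ler_wpM2r // invr_ge0.
  have e0 := expR_ge0 (- (s.+1%:R / D)).
  have LS : L.+1%:R <= 2 * #|V|%:R :> R by rewrite -natr1; lra.
  apply: (@le_trans _ _ (2 * #|V|%:R * 20 * (2 * #|V|%:R * #|V|%:R * expR (- (S / D))))).
    have v2 : 0 <= 2 * #|V|%:R :> R by apply: mulr_ge0.
    have vK : 0 <= 2 * #|V|%:R * K ^+ 2 by apply: mulr_ge0.
    apply: ler_pM; first by apply: mulr_ge0.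
    - by apply: mulr_ge0.
    - by apply: ler_wpM2r.
    - by apply: ler_pM => //; apply: ler_wpM2l.
  have -> : forall v E : R, 2 * v * 20 * (2 * v * v * E) = 80 * (v ^+ 3 * E) by move=> v E; ring.
  rewrite -mulrA; lra.
have t3 : pb / kap ^+ 2 <= c * q by rewrite ler_pdivrMr.
have t5 : L%:R * 20%:R * (2 * kap) ^+ 20 <= 20 * 2 ^+ 20 * q.
  rewrite exprMn (_ : L%:R * 20%:R * (2 ^+ 20 * kap ^+ 20) = 20 * 2 ^+ 20 * (L%:R * kap ^+ 20));
    last by ring.
  rewrite ler_wpM2l ?mulr_ge0 ?exprn_ge0 //; apply: le_trans hk20.
  by rewrite ler_wpM2r // exprn_ge0 // ltW.
have t6 : L%:R * 20%:R ^+ 2 * (pb / (s.+1%:R / 2)) / tau <= 800 * c / tau * q.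
  rewrite [leRHS]mulrAC; apply: ler_wpM2r; first by rewrite invr_ge0 ltW.
  have -> : L%:R * 20%:R ^+ 2 * (pb / (s.+1%:R / 2)) = 800 * (L%:R * pb / s.+1%:R).
    by field; rewrite gt_eqF.
  have h1 : L%:R * pb / s.+1%:R <= Lr * (c * (K ^+ 2 / S)) / S.
    apply: ler_pM; first by apply: mulr_ge0.
    - by rewrite invr_ge0 ltW.
    - by apply: ler_pM.
    - by rewrite lef_pV2 ?posrE.
  have h2 : Lr * (c * (K ^+ 2 / S)) / S <= c * q.
    rewrite (_ : Lr * _ / S = c * (Lr * K ^+ 2 / S ^+ 2)); last by field; rewrite gt_eqF.
    exact: ler_wpM2l.
  have h3 := le_trans h1 h2.
  rewrite -[leRHS]mulrA; apply: ler_wpM2l; [exact: ler0n|exact: h3].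
have t7 : 20%:R * (pb / 4) / tau <= 5 * c / tau * q.
  rewrite [leRHS]mulrAC; apply: ler_wpM2r; first by rewrite invr_ge0 ltW.
  rewrite (_ : 20%:R * (pb / 4) = 5 * pb); last by field.
  by rewrite -[leRHS]mulrA; apply: ler_wpM2l.
rewrite cE in t3 t6 t7; rewrite 6![in leRHS]mulrDl mul1r.
exact: (lerD (lerD (lerD (lerD (lerD (lerD hN t2) t3) hkq) t5) t6) t7).
Qed.

(** All parameters are powers of [n]: [K], the block size [S] and the number of levels [Lr] have
    exponents [kp], [sg] and [lam]. The slack [e] makes every failure term at most a constant times
    [q], the power [- e / 4]. *)
Lemma sketch_lower_bound (R : realType) (alpha e : R) : 0 < alpha < 1 / 10 -> 0 < e < alpha ->
  exists2 c : R, 0 < c & forall (n N : nat) (Sk : linear_sketch R n N) (t : R),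
    (0 < n)%N -> n%:R `^ (- (e / 4)) <= c ->
    0 <= t -> t <= n%:R `^ (2 / 3 * (1 - alpha)) ->
    incidence Sk -> computes_spanner 2 (1 / 40) t Sk ->
    n%:R `^ (1 + alpha - e) <= N%:R.
Proof.
move=> /andP[al0 al1] /andP[e0 ea].
pose lam := 2 / 3 * (1 - alpha); pose kp := alpha - e / 2.
pose sg := 1 - lam - e / 4.
(* Exponent of [S / K ^ 4], equal to [(1 - 10 * alpha) / 3 + 7 * e / 4]: the place where
   [alpha < 1 / 10] decides. *)
pose rho := sg - kp * 4.
have rho0 : 0 < rho by rewrite /rho /sg /kp /lam; lra.
(* Chosen so that [rho * m] is at least 4, which outweighs the factor [n ^ 3] of the union bound for
   regularity. *)
pose m := (Num.trunc (4 / rho)).+1.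
have rhoE : rho = sg - kp * 4 by [].
have hm : 4 <= rho * m%:R by rewrite -ler_pdivrMl // mulrC ltW // truncnS_gt.
pose Z : R := (512 * m%:R) ^+ m.
have Z0 : 0 <= Z by apply: exprn_ge0; apply: mulr_ge0; exact: ler0n.
have [tau tauE] : exists tau : R, tau * (100 * 100) = 1 by exists (100 * 100)^-1;
  rewrite mulVf //; lra.
have tau0 : 0 < tau by lra.
have [B BE] : exists B, B = failure_const Z tau by exists (failure_const Z tau).
have B0 : 2000 * 2000 <= B by rewrite BE; exact: failure_const_ge.
exists (1 / (2 * B)); first by rewrite divr_gt0 //; lra.
move=> n N Sk t n0 hq t0 tl inc comp; rewrite leNgt; apply/negP => hN.
have X1 : 1 <= n%:R :> R by rewrite ler1n.
have X0 : 0 < n%:R :> R by rewrite ltr0n.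
have PD u v : n%:R `^ u * n%:R `^ v = n%:R `^ (u + v) :> R.
  by rewrite powRD // (gt_eqF X0) implybT.
have PX (u : R) k : (n%:R `^ u) ^+ k = n%:R `^ (u * k%:R) := powR_exprn n%:R u k.
have P0 (u : R) : 0 < n%:R `^ u by rewrite powR_gt0.
have PM u v : u <= v -> n%:R `^ u <= n%:R `^ v :> R by move=> uv; apply: ler_powR.
have P1 : n%:R `^ 1 = n%:R :> R by rewrite powRr1 // ltW.
set q := n%:R `^ (- (e / 4)) in hq.
have q0 : 0 < q by exact: P0.
have Bq : B * q <= 1 / 2.
  have := ler_wpM2l (_ : 0 <= B) hq; rewrite (_ : B * (1 / (2 * B)) = 1 / 2); last by field; lra.
  by apply; lra.
have [z zE] : exists z : R, z * (100 * 100 * 100) = 1 by exists (100 * 100 * 100)^-1;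
  rewrite mulVf //; lra.
have qz : q <= z by clear -B0 Bq zE q0; nra.
clear hq B0.
pose K := n%:R `^ kp : R; pose S := n%:R `^ sg : R; pose Lr := n%:R `^ lam : R.
(* With 20 blocks per level, [kap ^ 20] is [1 / n] and outweighs the number of levels, while
   [kap ^ 2] stays above [K ^ 2 / S]. *)
pose kap := n%:R `^ (- (1 / 20)) : R.
have K1 : 1 <= K by rewrite -[1](powRr0 n%:R); apply: PM; rewrite /kp; clear -al0 al1 e0 ea; lra.
have S1 : 1 <= S by rewrite -[1](powRr0 n%:R); apply: PM; rewrite /sg /lam; clear -al0 al1 e0 ea;
  lra.
have Lr1 : 1 <= Lr by rewrite -[1](powRr0 n%:R); apply: PM; rewrite /lam; clear -al0 al1 e0 ea;
  lra.
have S0 : 0 < S by exact: lt_le_trans ltr01 S1.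
have K0 : 0 < K by exact: lt_le_trans ltr01 K1.
pose L := Num.trunc Lr; pose s := Num.trunc S.
have L1 : (0 < L)%N by rewrite /L truncn_gt0.
have LL : L%:R <= Lr by rewrite /L truncn_le; exact: le_trans ler01 Lr1.
have LS : Lr < L.+1%:R by exact: truncnS_gt.
have ss : s%:R <= S by rewrite /s truncn_le ltW.
have sS : S < s.+1%:R by exact: truncnS_gt.
have SV : S^-1 = n%:R `^ (- sg) by rewrite powRN.
have KS : K / S <= q by rewrite SV PD; apply: PM; rewrite /kp /sg /lam; clear -al0 al1 e0 ea; lra.
(* The constraint that fixes [lam]: the exponent [lam + 2 kp - 2 sg] is
   [3 lam + 2 alpha - 2 - e / 2], which is [- e / 2] for [lam = 2 / 3 (1 - alpha)]. *)
have LK : Lr * K ^+ 2 / S ^+ 2 <= q.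
  by rewrite -exprVn SV !PX !PD; apply: PM; rewrite /kp /sg /lam; clear -al0 al1 e0 ea; lra.
have SX : S * Lr <= q * n%:R.
  by rewrite -[X in _ <= _ * X]P1 !PD; apply: PM; rewrite /sg; clear -al0 al1 e0 ea; lra.
have S2X : S ^+ 2 <= q * n%:R.
  by rewrite -[X in _ <= _ * X]P1 !PX !PD; apply: PM; rewrite /sg /lam; clear -al0 al1 e0 ea; lra.
have s2 : s.+1%:R <= 2 * S by rewrite -natr1; clear -ss S1; lra.
have L2 : L.+1%:R <= 2 * Lr by rewrite -natr1; clear -LL Lr1; lra.
have zn : z * n%:R * (100 * 100 * 100) = n%:R by rewrite mulrAC zE mul1r.
have qn : q * n%:R <= z * n%:R by rewrite ler_wpM2r.
have slots : (1 + L.+1 * 20 * s.+1 <= n)%N.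
  rewrite -(ler_nat R) natrD !natrM.
  have h1 : L.+1%:R * s.+1%:R <= 2 * Lr * (2 * S) by apply: ler_pM.
  have h2 : 2 * Lr * (2 * S) = 4 * (S * Lr) by ring.
  have h3 : L.+1%:R * 20%:R * s.+1%:R = 20 * (L.+1%:R * s.+1%:R) :> R by ring.
  have n1 : q * n%:R >= 1 by apply: le_trans SX; clear -S1 Lr1; nra.
  rewrite h3; clear -h1 h2 n1 zn qn SX; lra.
have [emb embI] := slot_embedding slots.
have few : (2 * (s.+1 * (19 + 3) + 2) ^ 2 <= n)%N.
  rewrite -(ler_nat R) natrM natrX natrD natrM.
  have : s.+1%:R * (19 + 3)%:R + 2%:R <= 24 * s.+1%:R :> R by rewrite -natr1; have := ler0n R s;
    clear; lra.
  have s0 := ler0n R s.+1.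
  move=> h; apply: (@le_trans _ _ (2 * (48 * S) ^+ 2)).
    have hA : 0 <= s.+1%:R * (19 + 3)%:R + 2%:R :> R by apply: addr_ge0 => //; apply: mulr_ge0.
    have hC : s.+1%:R * (19 + 3)%:R + 2%:R <= 48 * S by clear -h s2; lra.
    apply: ler_wpM2l => //; rewrite lerXn2r ?nnegrE //; exact: le_trans hC.
  rewrite exprMn; clear -X0 zn qn S2X; lra.
have eta : 4 * K / s.+1%:R <= 4 * q.
  rewrite -mulrA ler_wpM2l //; apply: le_trans KS; rewrite ler_wpM2l ?lef_pV2 ?posrE ?ltr0n //;
    exact: ltW.
have eta0 : 0 <= 4 * K / s.+1%:R by rewrite divr_ge0 // mulr_ge0 // ltW.
apply: (@sketch_impossible R n N Sk t K kap tau tau L 19 s emb inc comp t0) => //.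
- exact: le_lt_trans tl LS.
- exact: P0.
- apply: (@le_trans _ _ (16 * (4 * q))); first by apply: ler_wpM2l.
  clear -qz zE; lra.
- apply: le_trans Bq; rewrite BE.
  apply: (@failure_bound_le R 'I_n N L s K kap tau S Lr q Z) => //; rewrite ?card_ord.
  + exact: P0.
  + exact: ltW.
  + exact: ltW.
  + rewrite -mulrA ler_wpM2l // ler_pdivrMr; last by rewrite mulr_gt0.
    apply: le_trans (ltW hN) _; rewrite -[X in _ <= _ * (_ * X)]P1 !PD.
    by apply: PM; rewrite /kp; clear -al0 al1 e0 ea; lra.
  + have D0 : 0 < 512 * K ^+ 4 by apply: mulr_gt0; [rewrite ltr0n|exact: exprn_gt0].
    set D := 512 * K ^+ 4 in D0 *.
    have y0 : 0 < S / D by rewrite divr_gt0.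
    apply: (@le_trans _ _ (n%:R ^+ 3 * (m%:R / (S / D)) ^+ m)).
      by rewrite ler_wpM2l ?exprn_ge0 // expRN_le.
    have -> : m%:R / (S / D) = 512 * m%:R * n%:R `^ (- rho).
      have -> : n%:R `^ (- rho) = K ^+ 4 / S by rewrite PX SV PD; congr (_ `^ _); rewrite /rho;
        ring.
      by rewrite invf_div /D; ring.
    rewrite exprMn mulrCA; apply: ler_wpM2l => //.
    rewrite PX -[X in X ^+ 3]P1 PX PD; apply: PM; clear -hm e0 ea al1; lra.
  + by rewrite -[leRHS]P1; apply: PM; rewrite /lam; clear -al0 al1 e0 ea; lra.
  + by rewrite -[leRHS]P1 PX; apply: PM; rewrite /kp; clear -al0 al1 e0 ea; lra.
  + by rewrite SV !PX !PD; apply: PM; rewrite /kp /sg /lam; clear -al0 al1 e0 ea; lra.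
  + by apply: PM; clear -al0 al1 e0 ea; lra.
  + by rewrite -[1](powRr0 n%:R); apply: PM; clear; lra.
  + by rewrite PX PD; apply: PM; rewrite /lam; clear -al0 al1 e0 ea; lra.
- rewrite /energy_const.
  have : (4 * K / s.+1%:R) ^+ 2 * L%:R <= 16 * q.
    have -> : (4 * K / s.+1%:R) ^+ 2 * L%:R = 16 * (L%:R * K ^+ 2 / s.+1%:R ^+ 2) by field;
      rewrite gt_eqF.
    rewrite ler_wpM2l //; apply: le_trans LK; apply: ler_pM.
    + by rewrite mulr_ge0 // sqr_ge0.
    + by rewrite invr_ge0 sqr_ge0.
    + by rewrite ler_wpM2r // sqr_ge0.
    + by rewrite lef_pV2 ?posrE ?exprn_gt0 // lerXn2r ?nnegrE // ltW.
  move: eta eta0; set h := 4 * K / s.+1%:R => h1 h2 h3.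
  rewrite -[16 * h ^+ 2 * _]mulrA; clear -h1 h2 h3 tauE qz zE; lra.
Qed.

(** * From fixed slack to a vanishing exponent *)

Lemma powRN_near (R : realType) (u c : R) : 0 < u -> 0 < c ->
  \forall n \near \oo, n%:R `^ (- u) <= c.
Proof.
move=> u0 c0; have ge := nbhs_infty_ger (c^-1 `^ u^-1); near=> n.
have h : c^-1 `^ u^-1 <= n%:R by near: n; exact: ge.
have c10 : 0 < c^-1 by rewrite invr_gt0.
have := ge0_ler_powR (ltW u0) _ _ h; rewrite !nnegrE powR_ge0 ler0n => /(_ isT isT).
rewrite -powRrM mulVf ?gt_eqF // powRr1 ?(ltW c10) // => h2.
by rewrite powRN -[leRHS]invrK lef_pV2 ?posrE // (lt_le_trans c10).
Unshelve. all: by end_near.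
Qed.

Theorem theorem1p11 (R : realType) (alpha : R)
    (halpha : 0 < alpha < 1 / 10) :
  exists C delta : R, 1 <= C /\ 0 < delta < 1 /\
    forall t : nat -> R,
      (forall n, 1 <= t n) ->
      t n / n%:R `^ (2 / 3 * (1 - alpha)) @[n --> \oo] --> (0 : R) ->
      exists eps : nat -> R, eps n @[n --> \oo] --> (0 : R) /\
        \forall n \near \oo,
          forall (N : nat) (S : linear_sketch R n N),
            incidence S ->
            computes_spanner C delta (t n) S ->
            n%:R `^ (1 + alpha - eps n) <= N%:R.
Proof.
(* The hard inputs have weights in [[1, 2]], and the failure probability is the one of
   [sketch_impossible]. *)
exists 2, (1 / 40); split; first by lra.
split; first by apply/andP; split; lra.
move=> t t1 tlim.
pose Q n e := forall (N : nat) (S : linear_sketch R n N), incidence S ->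
  computes_spanner 2 (1 / 40) (t n) S -> n%:R `^ (1 + alpha - e) <= N%:R.
have Qmon n e e' : (0 < n)%N -> e <= e' -> Q n e -> Q n e'.
  move=> n0 ee h N S i c; apply: le_trans (h N S i c); apply: ler_powR; first by rewrite ler1n.
  lra.
have ev e : 0 < e < alpha -> \forall n \near \oo, Q n e.
  move=> he; have [c c0 hc] := sketch_lower_bound halpha he.
  have e4 : 0 < e / 4 by move: he => /andP[? _]; lra.
  have lim1 := cvgr_lt _ tlim _ ltr01.
  near=> n; move=> N S i cs; apply: (hc n N S (t n)) => //.
  - by near: n; exact: nbhs_infty_gt.
  - by near: n; exact: powRN_near.
  - exact: le_trans ler01 (t1 n).
  - have n0 : (0 < n)%N by near: n; exact: nbhs_infty_gt.
    have : t n / n%:R `^ (2 / 3 * (1 - alpha)) < 1 by near: n; exact: lim1.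
    by rewrite ltr_pdivrMr ?powR_gt0 ?ltr0n // mul1r => /ltW.
pose E n := [set e | 0 < e /\ Q n e].
have Elb n : lbound (E n) 0 by move=> e [e0 _]; exact: ltW.
have Einf n e : 0 < e -> Q n e -> 0 <= inf (E n) <= e.
  move=> e0 he; apply/andP; split; first by apply: lb_le_inf => //; exists e.
  by apply: ge_inf; [exists 0; exact: Elb|].
have [al0 al1] := andP halpha.
(* The best slack valid at [n], for all sketches together. The infimum need not be attained, so
   [1 / (n + 1)] is added and monotonicity in the slack concludes. *)
exists (fun n => inf (E n) + n.+1%:R^-1); split; last first.
  have h2 : 0 < alpha / 2 < alpha by apply/andP; split; lra.
  near=> n.
  have hQ : Q n (alpha / 2) by near: n; exact: ev.
  have n0 : (0 < n)%N by near: n; exact: nbhs_infty_gt.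
  have hE : has_inf (E n) by split; [exists (alpha / 2); split => //; lra|exists 0; exact: Elb].
  have n10 : 0 < n.+1%:R^-1 :> R by rewrite invr_gt0 ltr0n.
  have [e [e0 he] le] := inf_adherent n10 hE.
  exact: Qmon n0 (ltW le) he.
apply/cvgrPdist_lt => d d0.
pose e0 := Num.min (d / 2) (alpha / 2).
have e0d : e0 <= d / 2 by rewrite ge_min lexx.
have e0a : e0 <= alpha / 2 by rewrite ge_min lexx orbT.
have e00 : 0 < e0 by rewrite lt_min; apply/andP; split; lra.
have he0 : 0 < e0 < alpha by apply/andP; split => //; lra.
have d20 : 0 < d / 2 by lra.
near=> n.
have hQ : Q n e0 by near: n; exact: ev.
have /andP[i0 i1] := Einf n e0 e00 hQ.
have nd : n.+1%:R^-1 < d / 2 by near: n; exact: (near_infty_natSinv_lt (PosNum d20)).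
have n10 : 0 < n.+1%:R^-1 :> R by rewrite invr_gt0 ltr0n.
have nn : 0 <= inf (E n) + n.+1%:R^-1 by apply: addr_ge0 => //; exact: ltW.
rewrite sub0r normrN (ger0_norm nn) [ltRHS]splitr; apply: ler_ltD nd.
exact: le_trans i1 e0d.
Unshelve. all: by end_near.
Qed.
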